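(* Let $(A_N)_{N\geq 1}$ and $(B_N)_{N\geq 1}$ be two deterministic sequences of $N\times N$ Hermitian matrices (respectively real symmetric matrices), and let $(v_N)_{N\geq 1}$ be a sequence of unit vectors of $\mathbb{C}^N$ (resp. of $\mathbb{R}^N$). Assume that almost surely, as $N\to\infty$, the following convergences hold in moment: $$\mu_{A_N}\to \mu_1,\qquad \mu_{A_N}^{v_N}\to \nu_1,\qquad \mu_{B_N}\to \mu_2,$$ for some probability measures $\mu_1,\nu_1,\mu_2$ on $\mathbb{R}$. Let $(U_N)_{N\geq 1}$ be a sequence of Haar distributed unitary (resp. orthogonal) random matrices of size $N$. Then, as $N\to\infty$, almost surely the following convergences hold in moment: $$\mu_{A_N+U_NB_NU_N^*}\to \mu_1\boxplus \mu_2\qquad\text{and}\qquad \mu_{A_N+U_NB_NU_N^*}^{v_N}\to \nu_1\,{}_{\mu_1}\!\boxplus_{\mu_2}\, \mu_2.$$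
   Context: For an $N\times N$ Hermitian matrix $M$, its empirical spectral distribution is $\mu_M=\frac1N\sum_{\lambda}\delta_\lambda$ (sum over eigenvalues with multiplicity), and for a unit vector $v$, $\mu_M^{v}=\sum_{u}|\langle v,u\rangle|^2\delta_{\lambda_u}$, where the sum runs over an orthonormal basis of eigenvectors $u$ of $M$ with eigenvalues $\lambda_u$; equivalently $\int x^k d\mu_M^v=\langle M^kv,v\rangle$. A sequence of probability measures $\mu_N$ converges to $\mu$ in moment if $\int x^k d\mu_N\to\int x^kd\mu$ for every $k\ge 0$. For a probability measure $\mu$ on $\mathbb{R}$, $G_\mu(z)=\int\frac{\mu(dx)}{z-x}$ and $F_\mu=1/G_\mu$ on $\mathbb{C}^+=\{\Im z>0\}$. Given probability measures $\mu_1,\mu_2$, there are unique analytic $\omega_1,\omega_2:\mathbb{C}^+\to\mathbb{C}^+$ with $F_{\mu_1}(\omega_1(z))=F_{\mu_2}(\omega_2(z))$ and $\omega_1(z)+\omega_2(z)=z+F_{\mu_1}(\omega_1(z))$. The free convolution $\mu_1\boxplus\mu_2$ is the unique probability measure with $F_{\mu_1\boxplus\mu_2}(z)=F_{\mu_1}(\omega_1(z))$. For probability measures $\nu_1,\nu_2$, the conditionally free convolution $\nu_1\,{}_{\mu_1}\!\boxplus_{\mu_2}\,\nu_2$ is the unique probability measure with $F_{\nu_1{}_{\mu_1}\boxplus_{\mu_2}\nu_2}(z)=F_{\nu_1}(\omega_1(z))+F_{\nu_2}(\omega_2(z))-F_{\mu_1\boxplus\mu_2}(z)$. *)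

(* Defs.v *)
From HB Require Import structures.
From mathcomp Require Import all_boot all_order all_algebra.
From mathcomp Require Import complex.
From mathcomp Require Import all_classical all_reals all_analysis.
Set Implicit Arguments. Unset Strict Implicit. Unset Printing Implicit Defensive.
Import Order.TTheory GRing.Theory Num.Theory.
Import numFieldNormedType.Exports.
Local Open Scope classical_set_scope.
Local Open Scope ring_scope.
Local Open Scope complex_scope.

(* Standard metric topology of R[i] (as a numClosedFieldType) *)
HB.instance Definition _ (R : rcfType) := PseudoPointedMetric.copy R[i] (R[i])^o.

Section Defs.
Variable R : realType.
Local Notation C := R[i].

Definition cadj m n (M : 'M[C]_(m, n)) : 'M[C]_(n, m) := (map_mx Num.conj M)^T.
Definition is_hermitian n (M : 'M[C]_n) : Prop := cadj M = M.
Definition is_unitary n (U : 'M[C]_n) : Prop := U *m cadj U = 1%:M.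
Definition is_realmx m n (M : 'M[C]_(m, n)) : Prop := forall i j, complex.Im (M i j) = 0.
Definition unit_vec n (v : 'cV[C]_n) : Prop := (cadj v *m v) 0 0 = 1.

Definition esd_moment n (M : 'M[C]_n.+1) (k : nat) : R :=
  complex.Re (\tr (M ^+ k) / n.+1%:R).
Definition spec_moment n (M : 'M[C]_n.+1) (v : 'cV[C]_n.+1) (k : nat) : R :=
  complex.Re ((cadj v *m (M ^+ k *m v)) 0 0).

Definition cvg_moment (a : nat -> nat -> R) (mu : probability R R) : Prop :=
  forall k, mu.-integrable setT (fun x => (x ^+ k)%:E) /\
    (fun n => a n k) @ \oo --> fine (\int[mu]_x (x ^+ k)%:E).

Definition uhp (z : C) : Prop := 0 < complex.Im z.

Definition cauchy (mu : probability R R) (z : C) : C :=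
  (fine (\int[mu]_x (complex.Re ((z - x%:C)^-1))%:E)) +i*
  (fine (\int[mu]_x (complex.Im ((z - x%:C)^-1))%:E)).
Definition Ftr (mu : probability R R) (z : C) : C := (cauchy mu z)^-1.

Definition holo_uhp (f : C -> C) : Prop :=
  forall z, uhp z -> exists l : C, (fun h : C => (f (z + h) - f z) / h) @ (0 : C)^' --> l.

Definition subordination (mu1 mu2 : probability R R) (w1 w2 : C -> C) : Prop :=
  [/\ forall z, uhp z -> uhp (w1 z) /\ uhp (w2 z),
      holo_uhp w1, holo_uhp w2 &
      forall z, uhp z -> Ftr mu1 (w1 z) = Ftr mu2 (w2 z) /\
                         w1 z + w2 z = z + Ftr mu1 (w1 z)].

(* sigma-algebra on matrices generated by the real and imaginary parts of
   the entries (= Borel sigma-algebra of C^{m x n} ~ R^{2mn}) *)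
Definition mx_coord_sets m n : set (set 'M[C]_(m, n)) :=
  [set S | exists (i : 'I_m) (j : 'I_n) (A : set R), measurable A /\
     (S = (fun M : 'M[C]_(m, n) => complex.Re (M i j)) @^-1` A \/
      S = (fun M : 'M[C]_(m, n) => complex.Im (M i j)) @^-1` A)].
Definition mx_measurable m n : set (set 'M[C]_(m, n)) := <<s (@mx_coord_sets m n) >>.

Definition haar_distributed d (Omega : measurableType d) (P : probability Omega R)
    (real_case : bool) n (U : Omega -> 'M[C]_n) : Prop :=
  [/\ forall w, is_unitary (U w) /\ (real_case -> is_realmx (U w)),
      forall A, mx_measurable A -> measurable (U @^-1` A) &
      forall V : 'M[C]_n, is_unitary V -> (real_case -> is_realmx V) ->
        forall A, mx_measurable A ->
          P (U @^-1` A) = P ((fun w => V *m U w) @^-1` A)].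
End Defs.

(* Main.v *)
(* Proof idea.  Put M = U B U^*, H = A + M and let tr be the normalised trace.  Only
   the left invariance of the law of U under real rotations is used.  Differentiating
   it along the planar rotations generated by E_ij - E_ji and summing over i, j shows
   that for every word w in H and M the defect
     D = sum over the splittings w = u L u' into a prefix, a letter and a suffix of
         tr(u) Tr(Q M u') - tr(u M) Tr(Q u')
   is small.  Testing against D^p conj(D)^(p+1) gives
   E|D|^(2p+2) <= (K/N) E|D|^(2p), where K is polynomial in the operator norms of A and
   B; these are N^o(1) because the moments converge.  So E|D|^6 = O(N^-2), and D tends
   to 0 almost surely.
   For Q = A^j/N, Q = v v^* A^j and w = H^k M^l these relations determine recursively
   the limits of tr(A^j H^k), <A^j H^k v, v> and tr(H^k M^l).  The functions
   z int x^j/(w_1(z) - x), with respect to mu_1 and nu_1, and z int x^l/(w_2(z) - x),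
   with respect to mu_2, satisfy the generating function form of the same recursion, so
   that their expansions in powers of 1/z along the imaginary axis have the limits as
   coefficients.  As G_rho = G_mu1(w_1) and G_kappa = G_nu1(w_1), the moments of rho and
   kappa are read off by the Hamburger-Nevanlinna argument. *)
Require Import Defs.
From HB Require Import structures.
From mathcomp Require Import all_boot all_order all_algebra.
From mathcomp Require Import complex.
From mathcomp Require Import all_classical all_reals all_analysis.
From mathcomp Require Import measurable_realfun.
From mathcomp Require Import ring lra zify.
Set Implicit Arguments. Unset Strict Implicit. Unset Printing Implicit Defensive.
Import Order.TTheory GRing.Theory Num.Theory.
Import numFieldNormedType.Exports.
Local Open Scope classical_set_scope.
Local Open Scope ring_scope.

(** * Operator norm and trace norm bounds *)

(** Convergence in moment does not bound operator norms, so every estimate is explicit and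
    polynomial in a norm bound [kap]. A high even moment lets [kap] be an arbitrarily small power of
    N, and the sixth moment of the defect, of order N^-3, leaves a whole factor N to absorb the
    powers of [kap]. Using real rotations only treats the unitary and the orthogonal case at once.
    The price is the transposes produced by E_ji, but these come with a single trace and hence
    without the factor N of the main term. The defect is tested against its own powers because a
    derivative falling on such a power, being a derivative of traces, also contracts to a single
    trace. The moments of D thus close on themselves and no separate concentration inequality
    enters. The state relations alone do not determine tr(H^k M): for j = 0 and Q = 1/N they hold
    identically. The law of B enters through tr(H^k M^l), which is why the mixed words H^k M^l are
    carried along. *)

Section OperatorBounds.
Variable C : numClosedFieldType.
Implicit Types (n : nat).

Definition vnorm n (y : 'cV[C]_n) : C := sqrtC (\sum_i `|y i 0| ^+ 2).

Lemma vnorm_ge0 n (y : 'cV[C]_n) : 0 <= vnorm y.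
Proof. by rewrite sqrtC_ge0 sumr_ge0// => i _; rewrite exprn_ge0. Qed.

Lemma vnorm_sqr n (y : 'cV[C]_n) : vnorm y ^+ 2 = \sum_i `|y i 0| ^+ 2.
Proof. by rewrite sqrtCK. Qed.

Lemma vnorm_conj n (y : 'cV[C]_n) : vnorm (map_mx Num.conj y) = vnorm y.
Proof.
by congr sqrtC; apply: eq_bigr => i _; rewrite mxE norm_conjC.
Qed.

Lemma vnorm_delta n (i : 'I_n) : vnorm (delta_mx i 0) = 1.
Proof.
rewrite /vnorm (bigD1 i)//= big1 ?addr0; last first.
  by move=> j ji; rewrite mxE (negPf ji) normr0 expr0n.
by rewrite mxE !eqxx normr1 expr1n sqrtC1.
Qed.

(** Lagrange's identity: twice the gap between the two sides is the double sum of the squares of a_i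
    b_j - a_j b_i. *)
Lemma sum_sqr_le (I : finType) (a b : I -> C) :
  (forall i, 0 <= a i) -> (forall i, 0 <= b i) ->
  (\sum_i a i * b i) ^+ 2 <= (\sum_i a i ^+ 2) * (\sum_i b i ^+ 2).
Proof.
move=> a0 b0; rewrite -subr_ge0 -(@pmulr_rge0 _ 2)// mulrBr.
have E1 : (\sum_i a i * b i) ^+ 2 = \sum_i \sum_j (a i * b i) * (a j * b j).
  by rewrite expr2 mulr_suml; apply: eq_bigr => i _; rewrite mulr_sumr.
have E2 : (\sum_i a i ^+ 2) * (\sum_i b i ^+ 2) =
    \sum_i \sum_j a i ^+ 2 * b j ^+ 2.
  by rewrite mulr_suml; apply: eq_bigr => i _; rewrite mulr_sumr.
have E3 : (\sum_i a i ^+ 2) * (\sum_i b i ^+ 2) =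
    \sum_i \sum_j a j ^+ 2 * b i ^+ 2.
  by rewrite E2 exchange_big.
rewrite mulr_natl mulr2n {1}E2 E3 E1 mulr_sumr -big_split/= -sumrB sumr_ge0// => i _.
rewrite mulr_sumr -big_split/= -sumrB sumr_ge0// => j _.
have -> : a i ^+ 2 * b j ^+ 2 + a j ^+ 2 * b i ^+ 2 - 2 * (a i * b i * (a j * b j))
    = (a i * b j - a j * b i) ^+ 2 by ring.
by rewrite real_exprn_even_ge0// rpredB// rpredM// ger0_real.
Qed.

Lemma dot_le n (x y : 'cV[C]_n) : `|(x^T *m y) 0 0| <= vnorm x * vnorm y.
Proof.
rewrite -(@ler_pXn2r _ 2) ?nnegrE ?mulr_ge0 ?vnorm_ge0//.
rewrite exprMn !vnorm_sqr; apply: le_trans (sum_sqr_le _ _) => //.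
apply: lerXn2r; rewrite ?nnegrE ?normr_ge0//.
  by apply: sumr_ge0 => i _; rewrite mulr_ge0.
by rewrite mxE; apply: le_trans (ler_norm_sum _ _ _) _; apply: ler_sum => i _; rewrite mxE normrM.
Qed.

Lemma dot_conj n (y : 'cV[C]_n) : ((map_mx Num.conj y)^T *m y) 0 0 = vnorm y ^+ 2.
Proof.
by rewrite vnorm_sqr mxE; apply: eq_bigr => i _; rewrite !mxE normCKC.
Qed.

(** The form is bilinear, with [x^T] in place of the adjoint, so that an operator norm bound passes
    at once to the transpose and to the entrywise conjugate. *)
Definition opbound n (W : 'M[C]_n) (c : C) : Prop :=
  forall x y, `|(x^T *m W *m y) 0 0| <= c * (vnorm x * vnorm y).

Lemma opbound_vec n (W : 'M[C]_n) c : 0 <= c -> opbound W c ->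
  forall y, vnorm (W *m y) <= c * vnorm y.
Proof.
move=> c0 Wc y; have [->|Wy0] := eqVneq (vnorm (W *m y)) 0.
  by rewrite mulr_ge0 ?vnorm_ge0.
have W_gt0 : 0 < vnorm (W *m y) by rewrite lt0r Wy0 vnorm_ge0.
rewrite -(ler_pM2l W_gt0) -expr2.
have := Wc (map_mx Num.conj (W *m y)) y.
rewrite -mulmxA dot_conj vnorm_conj ger0_norm ?exprn_ge0 ?vnorm_ge0//.
by rewrite mulrCA.
Qed.

Lemma vec_opbound n (W : 'M[C]_n) c :
  (forall y, vnorm (W *m y) <= c * vnorm y) -> opbound W c.
Proof.
move=> Wc x y; rewrite -mulmxA; apply: le_trans (dot_le _ _) _.
by rewrite mulrCA; apply: ler_wpM2l; rewrite ?vnorm_ge0.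
Qed.

Lemma opbound_le n (W : 'M[C]_n) c c' : c <= c' -> opbound W c -> opbound W c'.
Proof.
move=> cc' Wc x y; apply: le_trans (Wc x y) _.
by apply: ler_wpM2r => //; rewrite mulr_ge0 ?vnorm_ge0.
Qed.

Lemma opboundD n (W W' : 'M[C]_n) c c' :
  opbound W c -> opbound W' c' -> opbound (W + W') (c + c').
Proof.
move=> Wc Wc' x y; rewrite mulmxDr mulmxDl mxE mulrDl.
by apply: le_trans (ler_normD _ _) _; rewrite lerD.
Qed.

Lemma opboundM n (W W' : 'M[C]_n) c c' : 0 <= c -> 0 <= c' ->
  opbound W c -> opbound W' c' -> opbound (W *m W') (c * c').
Proof.
move=> c0 c'0 /(opbound_vec c0) Wc /(opbound_vec c'0) Wc'; apply: vec_opbound => y.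
rewrite -mulmxA; apply: le_trans (Wc _) _.
by rewrite -mulrA; apply: ler_wpM2l.
Qed.

Lemma opbound_tr n (W : 'M[C]_n) c : opbound W c -> opbound W^T c.
Proof.
move=> Wc x y; rewrite [vnorm x * _]mulrC.
have -> : (x^T *m W^T *m y) 0 0 = ((y^T *m W *m x)^T) 0 0.
  by rewrite !trmx_mul trmxK mulmxA.
by rewrite mxE.
Qed.

Lemma opbound_conj n (W : 'M[C]_n) c : opbound W c -> opbound (map_mx Num.conj W) c.
Proof.
move=> Wc x y.
have -> : x = map_mx Num.conj (map_mx Num.conj x).
  by apply/matrixP => i j; rewrite !mxE conjCK.
have -> : y = map_mx Num.conj (map_mx Num.conj y).
  by apply/matrixP => i j; rewrite !mxE conjCK.
rewrite map_trmx -!map_mxM mxE norm_conjC !(vnorm_conj (map_mx _ _)).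
exact: Wc.
Qed.

Lemma opbound1 n : opbound (1%:M : 'M[C]_n) 1.
Proof. by apply: vec_opbound => y; rewrite mul1mx mul1r. Qed.

Lemma opboundZ n (W : 'M[C]_n) a c : opbound W c -> opbound (a *: W) (`|a| * c).
Proof.
move=> Wc x y; rewrite -scalemxAr -scalemxAl mxE normrM -mulrA.
by apply: ler_wpM2l.
Qed.

Lemma opbound_pow n (W : 'M[C]_n.+1) c k : 0 <= c -> opbound W c ->
  opbound (W ^+ k) (c ^+ k).
Proof.
move=> c0 Wc; elim: k => [|k IH]; first by rewrite !expr0; exact: opbound1.
by rewrite !exprS; apply: opboundM => //; rewrite exprn_ge0.
Qed.

Lemma opbound_isometry n (U : 'M[C]_n) : (map_mx Num.conj U)^T *m U = 1%:M -> opbound U 1.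
Proof.
move=> UU; apply: vec_opbound => y; rewrite mul1r.
rewrite -(@ler_pXn2r _ 2) ?nnegrE ?vnorm_ge0// -!dot_conj map_mxM trmx_mul.
by rewrite mulmxA -(mulmxA _ _ U) UU mulmx1.
Qed.

Lemma opbound_entry n (W : 'M[C]_n) c i j : opbound W c -> `|W i j| <= c.
Proof.
move=> /(_ (delta_mx i 0) (delta_mx j 0)); rewrite !vnorm_delta !mulr1.
by rewrite trmx_delta -rowE -colE !mxE.
Qed.

(** The trace norm in its dual form, by pairing with operators. It gives the normalised trace and a
    unit rank one weight the same size 1, so that both are handled by one argument. *)
Definition trbound n (Q : 'M[C]_n) (q : C) : Prop :=
  forall W c, 0 <= c -> opbound W c -> `|\tr (Q *m W)| <= q * c.

Lemma trbound_tr n (Q : 'M[C]_n) q : trbound Q q -> trbound Q^T q.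
Proof.
move=> Qq W c c0 Wc; rewrite -mxtrace_tr trmx_mul trmxK mxtrace_mulC.
by apply: Qq => //; exact: opbound_tr.
Qed.

Lemma trbound_conj n (Q : 'M[C]_n) q : trbound Q q -> trbound (map_mx Num.conj Q) q.
Proof.
move=> Qq W c c0 Wc.
have -> : W = map_mx Num.conj (map_mx Num.conj W).
  by apply/matrixP => i j; rewrite !mxE conjCK.
rewrite -map_mxM trace_map_mx norm_conjC.
by apply: Qq => //; exact: opbound_conj.
Qed.

Lemma trboundMr n (Q W : 'M[C]_n) q c : 0 <= c -> opbound W c -> trbound Q q ->
  trbound (Q *m W) (q * c).
Proof.
move=> c0 Wc Qq V d d0 Vd; rewrite -mulmxA -mulrA; apply: Qq.
  by rewrite mulr_ge0.
exact: opboundM.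
Qed.

Lemma trboundMl n (Q W : 'M[C]_n) q c : 0 <= c -> opbound W c -> trbound Q q ->
  trbound (W *m Q) (q * c).
Proof.
move=> c0 Wc Qq; rewrite -[W *m Q]trmxK trmx_mul; apply: trbound_tr.
by apply: trboundMr (trbound_tr Qq) => //; exact: opbound_tr.
Qed.

Lemma trbound_dyad n (x y : 'cV[C]_n) : trbound (y *m x^T) (vnorm x * vnorm y).
Proof.
move=> W c c0 Wc; rewrite -mulmxA mxtrace_mulC /mxtrace big_ord1 mulrC.
exact: Wc.
Qed.

(** The trace norm dominates the operator norm: pair [Q] with the dyad [y *m x^T], whose operator
    norm is at most [vnorm x * vnorm y]. *)
Lemma trbound_opbound n (Q : 'M[C]_n) q : trbound Q q -> opbound Q q.
Proof.
move=> Qq x y; have := Qq (y *m x^T) (vnorm x * vnorm y).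
rewrite mulr_ge0 ?vnorm_ge0//.
have -> : `|\tr (Q *m (y *m x^T))| = `|(x^T *m Q *m y) 0 0|.
  by rewrite mulmxA mxtrace_mulC mulmxA /mxtrace big_ord1.
apply => // u v; rewrite mulmxA -mulmxA mxE big_ord1 normrM.
have := ler_pM (normr_ge0 _) (normr_ge0 _) (dot_le u y) (dot_le x v).
by move/le_trans; apply; rewrite mulrACA [X in _ <= X]mulrC [vnorm y * _]mulrC mulrACA [vnorm x * vnorm y]mulrC.
Qed.

Lemma trbound_ge0 n (Q : 'M[C]_n) q : trbound Q q -> 0 <= q.
Proof.
move=> /(_ _ _ ler01 (@opbound1 n)); rewrite mulr1; exact: le_trans.
Qed.

Lemma trbound_scal n : trbound ((n.+1%:R^-1)%:M : 'M[C]_n.+1) 1.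
Proof.
move=> W c c0 Wc; rewrite mul_scalar_mx mxtraceZ normrM normfV normr_nat mul1r.
rewrite ler_pdivrMl ?ltr0Sn//.
apply: le_trans (ler_norm_sum _ _ _) _.
apply: le_trans (_ : \sum_(i < n.+1) c <= _).
  by apply: ler_sum => i _; exact: opbound_entry.
by rewrite sumr_const card_ord mulr_natl.
Qed.

Lemma frobenius_bound n (W : 'M[C]_n) (y : 'cV[C]_n) :
  vnorm (W *m y) ^+ 2 <= \tr (W *m (map_mx Num.conj W)^T) * vnorm y ^+ 2.
Proof.
rewrite vnorm_sqr /mxtrace mulr_suml; apply: ler_sum => i _.
have -> : (W *m y) i 0 = ((row i W)^T^T *m y) 0 0.
  by rewrite trmxK !mxE; apply: eq_bigr => j _; rewrite !mxE.
have -> : (W *m (map_mx Num.conj W)^T) i i = vnorm (row i W)^T ^+ 2.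
  by rewrite vnorm_sqr mxE; apply: eq_bigr => j _; rewrite !mxE normCK.
by rewrite -exprMn lerXn2r ?nnegrE ?mulr_ge0 ?vnorm_ge0// dot_le.
Qed.

Lemma hermitian_pow n (A : 'M[C]_n.+1) k : (map_mx Num.conj A)^T = A ->
  (map_mx Num.conj (A ^+ k))^T = A ^+ k.
Proof.
move=> hA; elim: k => [|k IH]; first by rewrite expr0 map_mx1 trmx1.
rewrite {1}exprS [A * _]/(A *m _) map_mxM trmx_mul IH hA.
exact/esym/exprSr.
Qed.

(* Iterating the Cauchy-Schwarz inequality |A^m y|^2 <= |A^(2m) y| |y| controls
   the operator norm by the moment of order 2^(s+1). *)
Lemma hermitian_opbound n (A : 'M[C]_n.+1) s c : (map_mx Num.conj A)^T = A ->
  0 <= c -> \tr (A ^+ (2 ^ s.+1)) <= c ^+ (2 ^ s.+1) -> opbound A c.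
Proof.
move=> hA c0 trA; apply: vec_opbound => y.
pose a m := vnorm (A ^+ m *m y).
have a_ge0 m : 0 <= a m by exact: vnorm_ge0.
have a0 : a 0%N = vnorm y by rewrite /a expr0 mul1mx.
have a1 : a 1%N = vnorm (A *m y) by rewrite /a expr1.
have AD p q : A ^+ p *m A ^+ q = A ^+ (p + q) by rewrite exprD.
have step m : a m ^+ 2 <= a 0%N * a (m + m)%N.
  rewrite -[a m ^+ 2]ger0_norm ?exprn_ge0// -dot_conj a0.
  rewrite map_mxM trmx_mul (hermitian_pow _ hA) mulmxA -(mulmxA _ (A ^+ m) (A ^+ m)).
  rewrite AD -mulmxA -[vnorm y]vnorm_conj.
  exact: dot_le.
have iter t : a 1%N ^+ (2 ^ t) <= a (2 ^ t)%N * a 0%N ^+ (2 ^ t).-1.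
  elim: t => [|t IH]; first by rewrite expn0 !expr1 expr0 mulr1.
  rewrite expnS mulnC exprM.
  apply: le_trans (_ : (a (2 ^ t)%N * a 0%N ^+ (2 ^ t).-1) ^+ 2 <= _).
    by rewrite lerXn2r ?nnegrE ?mulr_ge0 ?exprn_ge0.
  rewrite exprMn -exprM.
  have -> : (2 ^ t * 2).-1 = ((2 ^ t).-1 * 2).+1.
    by have := expn_gt0 2 t; case: (2 ^ t)%N => // m _; lia.
  rewrite (_ : (2 ^ t * 2 = 2 ^ t + 2 ^ t)%N); last by lia.
  rewrite [a 0%N ^+ _.+1]exprS mulrA [_ * a 0%N]mulrC.
  by apply: ler_wpM2r; rewrite ?exprn_ge0.
(* The doubling stops at the exponent 2^s, where the Hilbert-Schmidt norm of A^(2^s) takes over: its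
   square is the trace of A^(2^(s+1)). *)
have frob : a (2 ^ s)%N ^+ 2 <= \tr (A ^+ (2 ^ s.+1)) * a 0%N ^+ 2.
  rewrite a0; apply: le_trans (frobenius_bound _ _) _.
  by rewrite (hermitian_pow _ hA) AD addnn -mul2n -expnS.
rewrite -a1 -a0 -(@ler_pXn2r _ (2 ^ s.+1)) ?expn_gt0 ?nnegrE ?mulr_ge0//.
rewrite exprMn [X in a 1%N ^+ X]expnS mulnC exprM.
apply: le_trans (_ : (a (2 ^ s)%N * a 0%N ^+ (2 ^ s).-1) ^+ 2 <= _).
  by rewrite lerXn2r ?nnegrE ?mulr_ge0 ?exprn_ge0.
rewrite exprMn; apply: le_trans (ler_wpM2r _ frob) _; first by rewrite !exprn_ge0.
rewrite -mulrA -[_ ^+ 2 * _ ^+ 2]exprMn -exprS prednK ?expn_gt0// -exprM mulnC -expnS.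
by apply: ler_wpM2r; rewrite ?exprn_ge0.
Qed.

End OperatorBounds.

(** * Words in two matrices *)

Section Words.
Variables (C : numClosedFieldType) (n : nat).
Implicit Types (H M K P Q W X Y : 'M[C]_n.+1) (w u : seq bool).

(* A word in the letters true, false is evaluated at (H, M); when H = A + M with
   A fixed, both letters have the same derivative K. *)
Fixpoint weval H M w : 'M[C]_n.+1 :=
  if w is b :: w' then (if b then H else M) *m weval H M w' else 1%:M.

Fixpoint wderiv H M K w : 'M[C]_n.+1 :=
  if w is b :: w' then K *m weval H M w' + (if b then H else M) *m wderiv H M K w'
  else 0.

Lemma weval_cat H M w u : weval H M (w ++ u) = weval H M w *m weval H M u.
Proof. by elim: w => [|b w IH] /=; rewrite ?mul1mx// IH mulmxA. Qed.

Lemma weval_nseq H M b k : weval H M (nseq k b) = (if b then H else M) ^+ k.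
Proof. by elim: k => //= k ->; rewrite exprS. Qed.

Lemma wderivE H M K w : wderiv H M K w =
  \sum_(i < size w) weval H M (take i w) *m K *m weval H M (drop i.+1 w).
Proof.
elim: w => [|b w IH] /=; first by rewrite big_ord0.
rewrite big_ord_recl /= drop0 mul1mx IH mulmx_sumr; congr (_ + _).
by apply: eq_bigr => i _; rewrite !mulmxA.
Qed.

Definition trw H M Q w := \tr (Q *m weval H M w).
Definition dtrw H M K Q w := \tr (Q *m wderiv H M K w).

Definition ntr : 'M[C]_n.+1 := (n.+1%:R^-1)%:M.

(** The letter at the splitting point disappears because both letters have derivative X M - M X. The
    [false] before the suffix or after the prefix is the M standing beside X in the two terms of
    this bracket. *)
Definition defect H M Q w : C :=
  \sum_(i < size w) (trw H M ntr (take i w) * trw H M Q (false :: drop i.+1 w)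
    - trw H M ntr (rcons (take i w) false) * trw H M Q (drop i.+1 w)).

Definition ddefect H M K Q w : C :=
  \sum_(i < size w)
    (dtrw H M K ntr (take i w) * trw H M Q (false :: drop i.+1 w)
     + trw H M ntr (take i w) * dtrw H M K Q (false :: drop i.+1 w)
     - (dtrw H M K ntr (rcons (take i w) false) * trw H M Q (drop i.+1 w)
     + trw H M ntr (rcons (take i w) false) * dtrw H M K Q (drop i.+1 w))).

(** The contribution of the E_ji half of [rotgen]: one trace with a transposed prefix in place of a
    product of two traces. *)
Definition defect_rem H M Q w : C :=
  \sum_(i < size w)
    (\tr (Q *m ((weval H M (take i w))^T *m (M *m weval H M (drop i.+1 w))))
    - \tr (Q *m ((weval H M (take i w) *m M)^T *m weval H M (drop i.+1 w)))).

Definition rotgen (i j : 'I_n.+1) : 'M[C]_n.+1 := delta_mx i j - delta_mx j i.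
Definition bracket X M := X *m M - M *m X.

Lemma mul_delta_mxE P Q a b i j : (P *m delta_mx a b *m Q) i j = P i a * Q b j.
Proof.
rewrite mxE (bigD1 b)//= big1 ?addr0 => [|k kb].
  rewrite mxE (bigD1 a)//= big1 ?addr0 ?mxE ?eqxx ?mulr1// => k ka.
  by rewrite mxE (negPf ka) mulr0.
by rewrite mxE big1 ?mul0r// => l _; rewrite mxE (negPf kb) andbF mulr0.
Qed.

Lemma trace_mulE P Q : \tr (P *m Q) = \sum_i \sum_j P i j * Q j i.
Proof. by apply: eq_bigr => i _; rewrite mxE. Qed.

(** At the indices i, j the matrix unit E_ij separates P from Q into two traces, whereas E_ji joins
    them into one, with a transpose. *)
Lemma contract_rotgen P Q : \sum_i \sum_j (P *m rotgen i j *m Q) i j =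
  \tr P * \tr Q - \tr (P *m Q^T).
Proof.
rewrite mulr_suml trace_mulE -sumrB; apply: eq_bigr => i _.
rewrite mulr_sumr -sumrB; apply: eq_bigr => j _.
by rewrite mulmxBr mulmxBl !mxE -!mul_delta_mxE !mxE.
Qed.

(** Here the rotation sits inside a trace, so contracting it against [Y] leaves single traces. This
    is why derivatives of the test factor cost no power of N. *)
Lemma trace_rotgen Y W : \sum_i \sum_j Y i j * \tr (rotgen i j *m W) =
  \tr (Y *m W) - \tr (Y *m W^T).
Proof.
have D i j : \tr (delta_mx i j *m W) = W j i.
  rewrite /mxtrace (bigD1 i)//= big1 ?addr0 => [|k ki].
    by rewrite -[delta_mx i j]mul1mx mul_delta_mxE mxE eqxx mul1r.
  by rewrite -[delta_mx i j]mul1mx mul_delta_mxE mxE (negPf ki) mul0r.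
rewrite !trace_mulE -sumrB; apply: eq_bigr => i _.
rewrite -sumrB; apply: eq_bigr => j _.
by rewrite mulmxBl raddfB /= !D mulrBr [W^T _ _]mxE.
Qed.

(** The factor N undoes the 1/N inside [ntr] in the products of two traces. The bound on
    [defect_rem] does not involve N, so a mean zero left side forces the defect to be small. *)
Lemma contract_wderiv H M Q w :
  \sum_i \sum_j (wderiv H M (bracket (rotgen i j) M) w *m Q) i j =
  n.+1%:R * defect H M Q w - defect_rem H M Q w.
Proof.
pose E k := weval H M (take k w); pose F k := weval H M (drop k.+1 w).
have -> : \sum_i \sum_j (wderiv H M (bracket (rotgen i j) M) w *m Q) i j =
  \sum_(k < size w) (\sum_i \sum_j (E k *m rotgen i j *m (M *m F k *m Q)) i j
     - \sum_i \sum_j ((E k *m M) *m rotgen i j *m (F k *m Q)) i j).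
  transitivity (\sum_(k < size w) \sum_i \sum_j
      ((E k *m rotgen i j *m (M *m F k *m Q)) i j
       - ((E k *m M) *m rotgen i j *m (F k *m Q)) i j)); last first.
    apply: eq_bigr => k _; rewrite -sumrB; apply: eq_bigr => i _.
    by rewrite -sumrB.
  rewrite [RHS]exchange_big/=; apply: eq_bigr => i _.
  rewrite [RHS]exchange_big/=; apply: eq_bigr => j _.
  rewrite wderivE mulmx_suml summxE; apply: eq_bigr => k _.
  by rewrite /bracket mulmxBr 2!mulmxBl !mulmxA [LHS]mxE [X in _ + X]mxE.
rewrite /defect /defect_rem mulr_sumr -sumrB; apply: eq_bigr => k _.
have Ntrw u : n.+1%:R * trw H M ntr u = \tr (weval H M u).
  by rewrite /trw /ntr mul_scalar_mx mxtraceZ mulrA divff ?mul1r// pnatr_eq0.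
have T P Z : \tr (P *m (Z *m Q)^T) = \tr (Q *m (P^T *m Z)).
  by rewrite -[LHS]mxtrace_tr trmx_mul trmxK [LHS]mxtrace_mulC (mulmxA P^T) [LHS]mxtrace_mulC.
rewrite !contract_rotgen mulrBr !mulrA !Ntrw -cats1 weval_cat /= mulmx1.
rewrite -/(E k) -/(F k) !T /trw /= -/(F k) (mxtrace_mulC _ Q) (mxtrace_mulC (F k)).
ring.
Qed.

Lemma contract_dtrw H M Y Q w :
  \sum_i \sum_j Y i j * dtrw H M (bracket (rotgen i j) M) Q w =
  \sum_(k < size w)
    let W := weval H M (drop k.+1 w) *m Q *m weval H M (take k w) in
    \tr (Y *m (M *m W - W *m M)) - \tr (Y *m (M *m W - W *m M)^T).
Proof.
under [RHS]eq_bigr => k _ do rewrite /= -trace_rotgen.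
rewrite [RHS]exchange_big/=; apply: eq_bigr => i _.
rewrite [RHS]exchange_big/=; apply: eq_bigr => j _.
rewrite /dtrw wderivE mulmx_sumr raddf_sum mulr_sumr; apply: eq_bigr => k _ /=.
set E := weval _ _ (take k w); set F := weval _ _ (drop _ _); set X := rotgen i j; clearbody X.
have T P : \tr (Q *m (E *m P *m F)) = \tr (P *m (F *m Q *m E)).
  by rewrite mulmxA [LHS]mxtrace_mulC !mulmxA [LHS]mxtrace_mulC !mulmxA.
congr (_ * _); rewrite T /bracket mulmxBl mulmxBr [LHS]raddfB [RHS]raddfB /=.
congr (_ - _); first by rewrite -!mulmxA.
by rewrite -!mulmxA [LHS]mxtrace_mulC -!mulmxA.
Qed.

Variables (H M : 'M[C]_n.+1) (kap : C).
Hypotheses (kap1 : 1 <= kap) (Hk : opbound H kap) (Mk : opbound M kap).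

Let kap0 : 0 <= kap. Proof. exact: le_trans ler01 kap1. Qed.
Let kapX k : 0 <= kap ^+ k. Proof. exact: exprn_ge0. Qed.

Lemma weval_bound w : opbound (weval H M w) (kap ^+ size w).
Proof.
elim: w => [|b w IH] /=; first by rewrite expr0; exact: opbound1.
by rewrite exprS; apply: opboundM => //; case: b.
Qed.

Lemma trw_bound Q q w : trbound Q q -> `|trw H M Q w| <= q * kap ^+ size w.
Proof. by apply => //; exact: weval_bound. Qed.

Lemma trw_ntr_bound w : `|trw H M ntr w| <= kap ^+ size w.
Proof. by rewrite -[kap ^+ _]mul1r; apply: trw_bound; exact: trbound_scal. Qed.

Let split_size w (i : 'I_(size w)) : (size (take i w) + (size (drop i.+1 w)).+1 = size w)%N.
Proof. by rewrite size_take size_drop ltn_ord; have := ltn_ord i; lia. Qed.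

Let kap_split w (i : 'I_(size w)) :
  kap ^+ size w = kap ^+ size (take i w) * kap ^+ (size (drop i.+1 w)).+1.
Proof. by rewrite -exprD split_size. Qed.

Lemma defect_bound Q q w : trbound Q q ->
  `|defect H M Q w| <= (2 * size w)%:R * (q * kap ^+ size w).
Proof.
move=> Qq; apply: le_trans (ler_norm_sum _ _ _) _.
apply: le_trans (_ : \sum_(i < size w) 2 * (q * kap ^+ size w) <= _); last first.
  by rewrite sumr_const card_ord natrM -[_ *+ size w]mulr_natr mulrAC.
apply: ler_sum => i _; apply: le_trans (ler_normB _ _) _.
rewrite mulr_natl mulr2n; apply: lerD; rewrite normrM.
  apply: le_trans (ler_pM _ _ (trw_ntr_bound _) (trw_bound _ Qq)) _ => //.
  by rewrite mulrCA -exprD /= split_size.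
apply: le_trans (ler_pM _ _ (trw_ntr_bound _) (trw_bound _ Qq)) _ => //.
by rewrite mulrCA -exprD /= size_rcons addSnnS split_size.
Qed.

Lemma defect_rem_bound Q q w : trbound Q q ->
  `|defect_rem H M Q w| <= (2 * size w)%:R * (q * kap ^+ size w).
Proof.
move=> Qq; apply: le_trans (ler_norm_sum _ _ _) _.
apply: le_trans (_ : \sum_(i < size w) 2 * (q * kap ^+ size w) <= _); last first.
  by rewrite sumr_const card_ord natrM -[_ *+ size w]mulr_natr mulrAC.
apply: ler_sum => i _; apply: le_trans (ler_normB _ _) _.
rewrite mulr_natl mulr2n (kap_split i); apply: lerD; apply: Qq.
- by rewrite mulr_ge0.
- apply: opboundM => //; first exact: opbound_tr (weval_bound _).
  by rewrite exprS; apply: opboundM => //; exact: weval_bound.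
- by rewrite mulr_ge0.
- rewrite exprS mulrA -exprSr exprSr; apply: opboundM => //.
  + by rewrite mulr_ge0.
  + by apply: opbound_tr; apply: opboundM => //; exact: weval_bound.
  + exact: weval_bound.
Qed.

(** The constant 4 is two terms of M W - W M, times two for the matrix and its transpose. An
    operator bound on [Q] suffices since [Y] supplies the trace norm. *)
Lemma contract_dtrw_bound Y Q y q w : 0 <= q -> trbound Y y -> opbound Q q ->
  `|\sum_i \sum_j Y i j * dtrw H M (bracket (rotgen i j) M) Q w| <=
  (4 * size w)%:R * (y * q * kap ^+ size w).
Proof.
move=> q0 Yy Qq; rewrite contract_dtrw; apply: le_trans (ler_norm_sum _ _ _) _.
apply: le_trans (_ : \sum_(i < size w) 4 * (y * q * kap ^+ size w) <= _); last first.
  by rewrite sumr_const card_ord natrM -[_ *+ size w]mulr_natr mulrAC.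
apply: ler_sum => i _ /=; set W := _ *m Q *m _.
set r := q * kap ^+ size w.
have r0 : 0 <= r by rewrite mulr_ge0.
have WMb : opbound (M *m W) r /\ opbound (W *m M) r.
  rewrite /r (kap_split i) exprS.
  set a := kap ^+ size (take i w); set b := kap ^+ _.
  have Wb : opbound W (b * q * a).
    have := opboundM (kapX _) q0 (weval_bound (drop i.+1 w)) Qq.
    by move/opboundM => /(_ _ _ (mulr_ge0 (kapX _) q0) (kapX _)); apply; exact: weval_bound.
  have bqa0 : 0 <= b * q * a := mulr_ge0 (mulr_ge0 (kapX _) q0) (kapX _).
  split.
    by have := opboundM kap0 bqa0 Mk Wb; congr (opbound _ _); ring.
  by have := opboundM bqa0 kap0 Wb Mk; congr (opbound _ _); ring.
have D : opbound (M *m W - W *m M) (2 * r).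
  rewrite mulr_natl mulr2n; apply: opboundD; first by case: WMb.
  by case: WMb => _ /(opboundZ (-1)); rewrite scaleN1r normrN1 mul1r.
have r20 : 0 <= 2 * r by rewrite mulr_ge0.
apply: le_trans (ler_normB _ _) _.
apply: le_trans (lerD (Yy _ _ r20 D) (Yy _ _ r20 (opbound_tr D))) _.
by rewrite /r le_eqVlt; apply/orP; left; apply/eqP; ring.
Qed.

(** The product rule gives four terms at each of the [size w] positions, each with a constant at
    most 4 * size w: hence 16 * size w ^ 2. *)
Lemma contract_ddefect_bound Y Q y q w : trbound Y y -> trbound Q q ->
  `|\sum_i \sum_j Y i j * ddefect H M (bracket (rotgen i j) M) Q w| <=
  (16 * size w ^ 2)%:R * (y * q * kap ^+ size w).
Proof.
move=> Yy Qq; have q0 := trbound_ge0 Qq; have y0 := trbound_ge0 Yy.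
pose S Q' u := \sum_i \sum_j Y i j * dtrw H M (bracket (rotgen i j) M) Q' u.
have -> : \sum_i \sum_j Y i j * ddefect H M (bracket (rotgen i j) M) Q w =
  \sum_(k < size w)
    (S ntr (take k w) * trw H M Q (false :: drop k.+1 w)
     + trw H M ntr (take k w) * S Q (false :: drop k.+1 w)
     - (S ntr (rcons (take k w) false) * trw H M Q (drop k.+1 w)
     + trw H M ntr (rcons (take k w) false) * S Q (drop k.+1 w))).
  pose d Q' u i j := dtrw H M (bracket (rotgen i j) M) Q' u.
  have Sl Q' u c : S Q' u * c = \sum_i \sum_j Y i j * (d Q' u i j * c).
    rewrite mulr_suml; apply: eq_bigr => i _.
    by rewrite mulr_suml; apply: eq_bigr => j _; rewrite mulrA.
  have Sr Q' u c : c * S Q' u = \sum_i \sum_j Y i j * (c * d Q' u i j).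
    rewrite mulr_sumr; apply: eq_bigr => i _.
    by rewrite mulr_sumr; apply: eq_bigr => j _; rewrite mulrCA.
  transitivity (\sum_(k < size w) \sum_i \sum_j Y i j *
    (d ntr (take k w) i j * trw H M Q (false :: drop k.+1 w)
     + trw H M ntr (take k w) * d Q (false :: drop k.+1 w) i j
     - (d ntr (rcons (take k w) false) i j * trw H M Q (drop k.+1 w)
     + trw H M ntr (rcons (take k w) false) * d Q (drop k.+1 w) i j))).
    rewrite [RHS]exchange_big/=; apply: eq_bigr => i _.
    rewrite [RHS]exchange_big/=; apply: eq_bigr => j _.
    by rewrite mulr_sumr.
  apply: eq_bigr => k _; rewrite !Sl !Sr -!big_split/= -sumrB.
  apply: eq_bigr => i _; rewrite -!big_split/= -sumrB.
  by apply: eq_bigr => j _; rewrite -!mulrDr -mulrBr.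
apply: le_trans (ler_norm_sum _ _ _) _.
set r := y * q * kap ^+ size w.
have r0 : 0 <= r by rewrite !mulr_ge0.
apply: le_trans (_ : \sum_(i < size w) (16 * size w)%:R * r <= _); last first.
  rewrite sumr_const card_ord -[_ *+ size w]mulr_natr mulrAC -natrM.
  by rewrite -mulnA mulnn.
apply: ler_sum => i _.
have I1 : opbound (ntr : 'M[C]_n.+1) 1 by apply: trbound_opbound; exact: trbound_scal.
have Qb := trbound_opbound Qq.
have b1 u v : (size u + size v = size w)%N ->
    `|S ntr u * trw H M Q v| <= (4 * size w)%:R * r.
  move=> uv; rewrite normrM.
  apply: le_trans (ler_pM _ _ (contract_dtrw_bound _ ler01 Yy I1) (trw_bound _ Qq)) _ => //.
  rewrite [X in X <= _](_ : _ = (4 * size u)%:R * r); last first.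
    by rewrite /r -uv exprD; ring.
  by apply: ler_wpM2r; rewrite // ler_nat -uv; lia.
have b2 u v : (size u + size v = size w)%N ->
    `|trw H M ntr u * S Q v| <= (4 * size w)%:R * r.
  move=> uv; rewrite normrM.
  apply: le_trans (ler_pM _ _ (trw_ntr_bound _) (contract_dtrw_bound _ q0 Yy Qb)) _ => //.
  rewrite [X in X <= _](_ : _ = (4 * size v)%:R * r); last first.
    by rewrite /r -uv exprD; ring.
  by apply: ler_wpM2r; rewrite // ler_nat -uv; lia.
have s1 : (size (take i w) + size (false :: drop i.+1 w) = size w)%N by exact: split_size.
have s2 : (size (rcons (take i w) false) + size (drop i.+1 w) = size w)%N.
  by rewrite size_rcons addSnnS; exact: split_size.
apply: le_trans (ler_normB _ _) _.
apply: le_trans (lerD (ler_normD _ _) (ler_normD _ _)) _.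
apply: le_trans (lerD (lerD (b1 _ _ s1) (b2 _ _ s1)) (lerD (b1 _ _ s2) (b2 _ _ s2))) _.
by rewrite le_eqVlt; apply/orP; left; apply/eqP; rewrite !natrM; ring.
Qed.

End Words.

(** * Derivatives along the rotations *)

Section Smooth.
Local Open Scope complex_scope.
Variables (R : realType) (d : measure_display) (T : measurableType d).
Variables (S : set T) (gam : R -> T -> T).
Local Notation C := R[i].
Implicit Types (f g : T -> C).

Definition cmeas f : Prop :=
  measurable_fun setT (fun x => complex.Re (f x)) /\
  measurable_fun setT (fun x => complex.Im (f x)).

Lemma cmeas_cst c : cmeas (fun=> c).
Proof. by split; exact: measurable_cst. Qed.

Lemma ReD (x y : C) : complex.Re (x + y) = complex.Re x + complex.Re y.
Proof. by case: x y => [? ?] [? ?]. Qed.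
Lemma ImD (x y : C) : complex.Im (x + y) = complex.Im x + complex.Im y.
Proof. by case: x y => [? ?] [? ?]. Qed.
Lemma ReM (x y : C) :
  complex.Re (x * y) = complex.Re x * complex.Re y - complex.Im x * complex.Im y.
Proof. by case: x y => [? ?] [? ?]. Qed.
Lemma ImM (x y : C) :
  complex.Im (x * y) = complex.Re x * complex.Im y + complex.Im x * complex.Re y.
Proof. by case: x y => [? ?] [? ?] /=; rewrite addrC [X in _ + X]mulrC addrC. Qed.
Lemma ReJ (x : C) : complex.Re (Num.conj x) = complex.Re x.
Proof. by case: x. Qed.
Lemma ImJ (x : C) : complex.Im (Num.conj x) = - complex.Im x.
Proof. by case: x. Qed.
Lemma ReN (x : C) : complex.Re (- x) = - complex.Re x.
Proof. by case: x. Qed.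
Lemma ImN (x : C) : complex.Im (- x) = - complex.Im x.
Proof. by case: x. Qed.

Lemma Re_sum (I : Type) (r : seq I) (G : I -> C) :
  complex.Re (\sum_(i <- r) G i) = \sum_(i <- r) complex.Re (G i).
Proof. by elim: r => [|i r IH]; rewrite ?big_nil// !big_cons ReD IH. Qed.

Lemma normc_ge0 (z : C) : 0 <= Normc.normc z.
Proof. by rewrite -ler0c; exact: (normr_ge0 z). Qed.

Lemma normRe_le (x : C) (c : R) : `|x| <= c%:C -> `|complex.Re x| <= c.
Proof. by move=> xc; rewrite -lecR; exact: le_trans (normc_ge_Re x) xc. Qed.

Lemma cmeasD f g : cmeas f -> cmeas g -> cmeas (fun x => f x + g x).
Proof.
move=> [f1 f2] [g1 g2]; split.
  by under eq_fun do rewrite ReD; exact: measurable_funD.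
by under eq_fun do rewrite ImD; exact: measurable_funD.
Qed.

Lemma cmeasM f g : cmeas f -> cmeas g -> cmeas (fun x => f x * g x).
Proof.
move=> [f1 f2] [g1 g2]; split.
  by under eq_fun do rewrite ReM; apply: measurable_funB; exact: measurable_funM.
by under eq_fun do rewrite ImM; apply: measurable_funD; exact: measurable_funM.
Qed.

Lemma cmeas_conj f : cmeas f -> cmeas (fun x => Num.conj (f x)).
Proof.
move=> [f1 f2]; split; first by under eq_fun do rewrite ReJ.
by under eq_fun do rewrite ImJ; exact: measurable_funN.
Qed.

(** Differentiability along [gam] as a Taylor formula whose remainder c t^2 is uniform on [S]. The
    uniformity allows expectations to be taken before t tends to 0, and carrying f' along makes the
    product rule a computation. *)
Definition smooth f f' : Prop := [/\ cmeas f, cmeas f' &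
  exists c : R, 0 <= c /\ forall x, S x ->
    [/\ `|f x| <= c%:C, `|f' x| <= c%:C &
     forall t, 0 <= t -> t <= 1 ->
       `|f (gam t x) - f x - t%:C * f' x| <= (c * t ^+ 2)%:C]].

Lemma smooth_cst a : smooth (fun=> a) (fun=> 0).
Proof.
split; [exact: cmeas_cst|exact: cmeas_cst|].
exists (Normc.normc a); split; first exact: normc_ge0.
move=> x _; split => [//||t t0 _].
  by rewrite normr0 ler0c normc_ge0.
by rewrite subrr mulr0 subr0 normr0 ler0c mulr_ge0 ?exprn_ge0 ?normc_ge0.
Qed.

Lemma smoothD f f' g g' : smooth f f' -> smooth g g' ->
  smooth (fun x => f x + g x) (fun x => f' x + g' x).
Proof.
move=> [mf mf' [c [c0 fc]]] [mg mg' [e [e0 ge]]].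
split; [exact: cmeasD|exact: cmeasD|].
exists (c + e); split; first exact: addr_ge0.
move=> x Sx; have [f1 f2 f3] := fc x Sx; have [g1 g2 g3] := ge x Sx.
split => [||t t0 t1].
- by rewrite rmorphD; apply: le_trans (ler_normD _ _) _; exact: lerD.
- by rewrite rmorphD; apply: le_trans (ler_normD _ _) _; exact: lerD.
- rewrite mulrDl rmorphD; apply: le_trans (lerD (f3 t t0 t1) (g3 t t0 t1)).
  by apply: le_trans (ler_normD _ _); rewrite le_eqVlt; apply/orP; left; apply/eqP; congr `|_|; ring.
Qed.

Lemma smoothM f f' g g' : smooth f f' -> smooth g g' ->
  smooth (fun x => f x * g x) (fun x => f' x * g x + f x * g' x).
Proof.
move=> [mf mf' [c [c0 fc]]] [mg mg' [e [e0 ge]]].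
split; [exact: cmeasM|by apply: cmeasD; exact: cmeasM|].
(* The two remainders give c e t^2 each; the product of the increments, at most 2 c t and 2 e t when
   t <= 1, gives 4 c e t^2. *)
exists (6 * (c * e)); split; first by rewrite !mulr_ge0.
have ce0 : 0 <= c * e by rewrite mulr_ge0.
move=> x Sx; have [f1 f2 f3] := fc x Sx; have [g1 g2 g3] := ge x Sx.
split => [||t t0 t1].
- rewrite normrM; apply: le_trans (ler_pM _ _ f1 g1) _ => //.
  by rewrite -rmorphM lecR; lra.
- apply: le_trans (ler_normD _ _) _; rewrite !normrM.
  apply: le_trans (lerD (ler_pM _ _ f2 g1) (ler_pM _ _ f1 g2)) _ => //.
  by rewrite -!rmorphM -rmorphD lecR; lra.
- have t2 : t ^+ 2 <= t by rewrite expr2 -[leRHS]mulr1 ler_wpM2l.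
  have D (h h' : T -> C) b : 0 <= b -> `|h' x| <= b%:C ->
      `|h (gam t x) - h x - t%:C * h' x| <= (b * t ^+ 2)%:C ->
      `|h (gam t x) - h x| <= (2 * b * t)%:C.
    move=> b0 h1 h2.
    rewrite -[_ - h x](subrK (t%:C * h' x)).
    apply: le_trans (ler_normD _ _) _; apply: le_trans (lerD h2 (lexx _)) _.
    rewrite normrM (ger0_norm (x := t%:C)) ?ler0c//.
    apply: le_trans (lerD (lexx _) (ler_wpM2l _ h1)) _; first by rewrite ler0c.
    rewrite -rmorphM -rmorphD lecR.
    have : b * t ^+ 2 <= b * t by exact: ler_wpM2l.
    lra.
  have Df := D f f' c c0 f2 (f3 t t0 t1); have Dg := D g g' e e0 g2 (g3 t t0 t1).
  rewrite [X in `|X|](_ : _ =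
    (f (gam t x) - f x - t%:C * f' x) * g x + f x * (g (gam t x) - g x - t%:C * g' x)
    + (f (gam t x) - f x) * (g (gam t x) - g x)); last by ring.
  apply: le_trans (ler_normD _ _) _.
  apply: le_trans (lerD (ler_normD _ _) (lexx _)) _; rewrite !normrM.
  apply: le_trans (lerD (lerD (ler_pM _ _ (f3 t t0 t1) g1) (ler_pM _ _ f1 (g3 t t0 t1)))
    (ler_pM _ _ Df Dg)) _ => //.
  by rewrite -!rmorphM -!rmorphD lecR le_eqVlt; apply/orP; left; apply/eqP; ring.
Qed.

Lemma smooth_conj f f' : smooth f f' ->
  smooth (fun x => Num.conj (f x)) (fun x => Num.conj (f' x)).
Proof.
move=> [mf mf' [c [c0 fc]]]; split; [exact: cmeas_conj|exact: cmeas_conj|].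
exists c; split => // x Sx; have [f1 f2 f3] := fc x Sx; split => [||t t0 t1].
- by rewrite norm_conjC.
- by rewrite norm_conjC.
- have -> : t%:C = Num.conj t%:C :> C by rewrite /= /Num.conj /= oppr0.
  by rewrite -rmorphM -!rmorphB norm_conjC; exact: f3.
Qed.

Lemma smooth_sum (I : Type) (r : seq I) (F F' : I -> T -> C) :
  (forall i, smooth (F i) (F' i)) ->
  smooth (fun x => \sum_(i <- r) F i x) (fun x => \sum_(i <- r) F' i x).
Proof.
move=> h; elim: r => [|i r IH].
  have := smooth_cst 0; congr smooth; apply/funext => x; by rewrite big_nil.
have := smoothD (h i) IH; congr smooth; apply/funext => x; by rewrite big_cons.
Qed.

Lemma smooth_exp f f' k : smooth f f' ->
  smooth (fun x => f x ^+ k) (fun x => k%:R * f x ^+ k.-1 * f' x).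
Proof.
move=> sf; elim: k => [|k IH].
  have := smooth_cst 1; congr smooth; apply/funext => x; by rewrite ?mul0r.
have := smoothM sf IH; congr smooth; apply/funext => x; rewrite ?exprS//=.
case: k {IH} => [|k] /=; first by rewrite !mul0r mulr0 expr0; ring.
by rewrite exprS -[k.+2%:R]natr1; ring.
Qed.

Definition smooth_mx m n (F F' : T -> 'M[C]_(m, n)) : Prop :=
  forall i j, smooth (fun x => F x i j) (fun x => F' x i j).

Lemma smooth_mx_cst m n (A : 'M[C]_(m, n)) : smooth_mx (fun=> A) (fun=> 0).
Proof.
move=> i j; have := smooth_cst (A i j); congr smooth; apply/funext => x.
by rewrite mxE.
Qed.

Lemma smooth_mxD m n (F F' G G' : T -> 'M[C]_(m, n)) :
  smooth_mx F F' -> smooth_mx G G' ->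
  smooth_mx (fun x => F x + G x) (fun x => F' x + G' x).
Proof.
move=> sF sG i j; have := smoothD (sF i j) (sG i j).
by congr smooth; apply/funext => x; rewrite mxE.
Qed.

Lemma smooth_mxM m n p (F F' : T -> 'M[C]_(m, n)) (G G' : T -> 'M[C]_(n, p)) :
  smooth_mx F F' -> smooth_mx G G' ->
  smooth_mx (fun x => F x *m G x) (fun x => F' x *m G x + F x *m G' x).
Proof.
move=> sF sG i j.
have := smooth_sum (index_enum 'I_n) (fun k => smoothM (sF i k) (sG k j)).
congr smooth; apply/funext => x; rewrite !mxE//.
by rewrite big_split.
Qed.

Lemma smooth_trace n (F F' : T -> 'M[C]_n) : smooth_mx F F' ->
  smooth (fun x => \tr (F x)) (fun x => \tr (F' x)).
Proof. by move=> sF; exact: (smooth_sum (index_enum 'I_n) (fun k => sF k k)). Qed.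

Lemma smooth_cadj m n (F F' : T -> 'M[C]_(m, n)) : smooth_mx F F' ->
  smooth_mx (fun x => cadj (F x)) (fun x => cadj (F' x)).
Proof.
move=> sF i j; have := smooth_conj (sF j i).
by congr smooth; apply/funext => x; rewrite !mxE.
Qed.

Lemma smooth_weval n (H M K : T -> 'M[C]_n.+1) w : smooth_mx H K -> smooth_mx M K ->
  smooth_mx (fun x => weval (H x) (M x) w) (fun x => wderiv (H x) (M x) (K x) w).
Proof.
move=> sH sM; elim: w => [|b w IH]; first exact: smooth_mx_cst.
by case: b => /=; exact: smooth_mxM.
Qed.

Lemma smooth_trw n (H M K : T -> 'M[C]_n.+1) Q w : smooth_mx H K -> smooth_mx M K ->
  smooth (fun x => trw (H x) (M x) Q w) (fun x => dtrw (H x) (M x) (K x) Q w).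
Proof.
move=> sH sM.
have := smooth_trace (smooth_mxM (smooth_mx_cst Q) (smooth_weval w sH sM)).
by congr smooth; apply/funext => x; rewrite mul0mx add0r.
Qed.

Lemma smoothN f f' : smooth f f' -> smooth (fun x => - f x) (fun x => - f' x).
Proof.
move=> sf; have := smoothM (smooth_cst (-1)) sf.
by congr smooth; apply/funext => x; rewrite ?mul0r ?add0r mulN1r.
Qed.

Lemma smooth_defect n (H M K : T -> 'M[C]_n.+1) Q w : smooth_mx H K -> smooth_mx M K ->
  smooth (fun x => defect (H x) (M x) Q w) (fun x => ddefect (H x) (M x) (K x) Q w).
Proof.
move=> sH sM; apply: smooth_sum => i.
have sT Q' u := smooth_trw Q' u sH sM.
by apply: smoothD; [|apply: smoothN]; exact: smoothM.
Qed.

End Smooth.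

(** * Expectations of bounded functions and invariance along a path *)

Section BoundedExpectation.
Variables (R : realType) (d : measure_display) (Omega : measurableType d).
Variable P : probability Omega R.

Definition bmeas (g : Omega -> R) : Prop :=
  measurable_fun setT g /\ exists c, forall w, `|g w| <= c.

Lemma bmeas_integrable g : bmeas g -> P.-integrable setT (EFin \o g).
Proof.
move=> [mg [c gc]]; apply: measurable_bounded_integrable => //.
  by rewrite -ge0_fin_numE// fin_num_measure.
by exists c; split; [exact: num_real|move=> x cx w _; exact: le_trans (gc w) (ltW cx)].
Qed.

Lemma bmeasD f g : bmeas f -> bmeas g -> bmeas (fun w => f w + g w).
Proof.
move=> [mf [c fc]] [mg [e ge]]; split; first exact: measurable_funD.
by exists (c + e) => w; apply: le_trans (ler_normD _ _) _; exact: lerD.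
Qed.

Lemma bmeasZ a f : bmeas f -> bmeas (fun w => a * f w).
Proof.
move=> [mf [c fc]]; split; first exact: measurable_funM (measurable_cst _) mf.
by exists (`|a| * c) => w; rewrite normrM ler_wpM2l.
Qed.

Lemma Rintegral_bmeas_sum (I : Type) (r : seq I) (F : I -> Omega -> R) :
  (forall i, bmeas (F i)) ->
  bmeas (fun w => \sum_(i <- r) F i w) /\
  \int[P]_w (\sum_(i <- r) F i w) = \sum_(i <- r) \int[P]_w (F i w).
Proof.
move=> h; elim: r => [|i r [IH1 IH2]].
  have -> : (fun w => \sum_(i <- [::]) F i w) = cst 0 by apply/funext => w; rewrite big_nil.
  split; first by split; [exact: measurable_cst|exists 0 => w; rewrite normr0].
  by rewrite Rintegral_cst// mul0r big_nil.
have E : (fun w => \sum_(j <- i :: r) F j w) = (fun w => F i w + \sum_(j <- r) F j w).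
  by apply/funext => w; rewrite big_cons.
rewrite E big_cons -IH2; split; first exact: bmeasD.
by rewrite RintegralD//; exact: bmeas_integrable.
Qed.

Lemma le_Rintegral_bmeas f g : bmeas f -> bmeas g -> (forall w, f w <= g w) ->
  \int[P]_w (f w) <= \int[P]_w (g w).
Proof. by move=> bf bg fg; apply: le_Rintegral => //; exact: bmeas_integrable. Qed.

End BoundedExpectation.

Section InvariantDerivative.
Local Open Scope complex_scope.
Variables (R : realType) (d : measure_display) (Omega : measurableType d).
Variables (P : probability Omega R) (dT : measure_display) (T : measurableType dT).
Variables (U : Omega -> T) (S : set T) (gam : R -> T -> T).
Hypotheses (mU : measurable_fun setT U) (SU : forall w, S (U w)).
Hypothesis mgam : forall t, measurable_fun setT (gam t).
Hypothesis inv : forall t, 0 <= t -> t <= 1 -> forall A, measurable A ->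
  P (U @^-1` A) = P ((fun w => gam t (U w)) @^-1` A).

Lemma smooth_bmeas f f' : smooth S gam f f' ->
  bmeas (fun w => complex.Re (f (U w))) /\ bmeas (fun w => complex.Re (f' (U w))).
Proof.
move=> [[mf _] [mf' _] [c [c0 fc]]]; split; split.
- exact: (measurableT_comp mf mU).
- by exists c => w; have [h _ _] := fc _ (SU w); exact: normRe_le h.
- exact: (measurableT_comp mf' mU).
- by exists c => w; have [_ h _] := fc _ (SU w); exact: normRe_le h.
Qed.

Lemma expectation_invariant (g : T -> R) t : 0 <= t -> t <= 1 ->
  measurable_fun setT g -> bmeas (fun w => g (U w)) -> bmeas (fun w => g (gam t (U w))) ->
  \int[P]_w g (U w) = \int[P]_w g (gam t (U w)).
Proof.
move=> t0 t1 mg b1 b2; congr fine.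
have mgU : measurable_fun setT (fun w => gam t (U w)) by exact: measurableT_comp.
have mEg : measurable_fun setT (EFin \o g) by exact/measurable_EFinP.
have := integral_pushforward mU mEg (bmeas_integrable P b1) measurableT.
rewrite preimage_setT /= => <-.
have := integral_pushforward mgU mEg (bmeas_integrable P b2) measurableT.
rewrite preimage_setT /= => <-.
by apply: eq_measure_integral => A mA _; exact: inv.
Qed.

(* The law of U is invariant along the path t |-> gam t U, whose expansion at
   t = 0 is f + t f' + O(t^2) uniformly in U. *)
Lemma invariant_derivative f f' : smooth S gam f f' ->
  \int[P]_w complex.Re (f' (U w)) = 0.
Proof.
move=> sf; have [b1 b2] := smooth_bmeas sf.
have [[mf _] [mf' _] [c [c0 fc]]] := sf.
set e := Rintegral _ _ _.
(* Taking t = min(1, x / (c + 1)) brings the bound below any x > 0; the denominator c + 1 is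
   positive even when c = 0. *)
suff h t : 0 < t -> t <= 1 -> `|e| <= c * t.
  apply/normr0_eq0/eqP; rewrite eq_le normr_ge0 andbT.
  apply/ler_addgt0Pl => x x0; rewrite addr0.
  have c1 : 0 < c + 1 by rewrite ltr_wpDl.
  have t_gt0 : 0 < Num.min 1 (x / (c + 1)) by rewrite lt_min ltr01 divr_gt0.
  apply: le_trans (h _ t_gt0 _) _; first by rewrite ge_min lexx.
  apply: le_trans (_ : c * (x / (c + 1)) <= _).
    by apply: ler_wpM2l; rewrite // ge_min lexx orbT.
  rewrite mulrCA -[leRHS]mulr1 ler_wpM2l ?(ltW x0)// ler_pdivrMr// mul1r; lra.
move=> t0 t1.
have b3 : bmeas (fun w => complex.Re (f (gam t (U w)))).
  split; first by apply: (measurableT_comp mf); exact: measurableT_comp.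
  exists (c + c + c * t ^+ 2) => w; have [h1 h2 h3] := fc _ (SU w).
  apply: normRe_le; rewrite !rmorphD.
  rewrite [X in `|X|](_ : _ = f (U w) + t%:C * f' (U w) +
    (f (gam t (U w)) - f (U w) - t%:C * f' (U w))); last by ring.
  apply: le_trans (ler_normD _ _) _; apply: lerD (h3 t (ltW t0) t1).
  apply: le_trans (ler_normD _ _) _; apply: lerD h1 _.
  apply: le_trans (_ : 1 * c%:C <= _); last by rewrite mul1r.
  rewrite normrM; apply: ler_pM h2 => //.
  by rewrite ger0_norm ?ler0c ?(ltW t0)// lecE /= eqxx.
have E := expectation_invariant (ltW t0) t1 mf b1 b3.
(* The real part of the Taylor remainder. By invariance its first two terms cancel in the mean, so
   its expectation is -t e, while |g| <= c t^2. *)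
pose g w := complex.Re (f (gam t (U w))) + (-1) * complex.Re (f (U w))
     + (- t) * complex.Re (f' (U w)).
have bz1 := bmeasZ (-1) b1; have bz2 := bmeasZ (- t) b2.
have bD := bmeasD b3 bz1; have bg : bmeas g := bmeasD bD bz2.
have Eg : \int[P]_w g w = - t * e.
  rewrite (RintegralD _ (bmeas_integrable P bD) (bmeas_integrable P bz2))//.
  rewrite (RintegralD _ (bmeas_integrable P b3) (bmeas_integrable P bz1))//.
  rewrite (RintegralZl _ _ (bmeas_integrable P b1))//.
  rewrite (RintegralZl _ _ (bmeas_integrable P b2))//.
  by rewrite -E mulN1r subrr add0r.
have gle w : `|g w| <= c * t ^+ 2.
  have [_ _ h3] := fc _ (SU w); have := normRe_le (h3 t (ltW t0) t1).
  by congr (`|_| <= _); rewrite !(ReD, ReN, ReM) /g /=; ring.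
have : `|\int[P]_w g w| <= c * t ^+ 2.
  apply: le_trans (le_normr_Rintegral _ (bmeas_integrable P bg)) _ => //.
  have Ec : \int[P]_w (c * t ^+ 2) = c * t ^+ 2.
    by rewrite Rintegral_cst//; have /= -> := @probability_setT _ _ _ P; rewrite mulr1.
  rewrite -[leRHS]Ec; apply: le_Rintegral_bmeas => //.
  - split; first by apply: measurableT_comp => //; case: bg.
    by exists (c * t ^+ 2) => w; rewrite normr_id.
  - split; first exact: measurable_cst.
    by exists `|c * t ^+ 2|.
rewrite Eg normrM normrN (gtr0_norm t0) expr2 mulrCA.
by rewrite ler_pM2l.
Qed.

End InvariantDerivative.

(** * Planar rotations acting on the Haar matrix *)

Section HaarDefect.
Local Open Scope complex_scope.
Variables (R : realType) (n : nat).
Local Notation C := R[i].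
Local Notation mat := 'M[C]_n.+1.
Local Notation T := (g_sigma_algebraType (@mx_coord_sets R n.+1 n.+1)).

Lemma cmeas_entry (i j : 'I_n.+1) : cmeas (fun V : T => (V : mat) i j).
Proof.
by split=> _ A mA; rewrite setTI; apply: sub_gen_smallest; exists i, j, A; split;
  [|left| |right].
Qed.

Lemma cmeas_sum d (X : measurableType d) (I : Type) (r : seq I) (F : I -> X -> C) :
  (forall i, cmeas (F i)) -> cmeas (fun x => \sum_(i <- r) F i x).
Proof.
move=> h; elim: r => [|i r IH].
  rewrite (_ : (fun _ => _) = fun=> 0); first exact: cmeas_cst.
  by apply/funext => x; rewrite big_nil.
rewrite (_ : (fun _ => _) = fun x => F i x + \sum_(j <- r) F j x); first exact: cmeasD.
by apply/funext => x; rewrite big_cons.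
Qed.

Lemma cmeas_mulmx (V : mat) i j : cmeas (fun U : T => (V *m (U : mat)) i j).
Proof.
have -> : (fun U : T => (V *m (U : mat)) i j) = (fun U : T => \sum_k V i k * (U : mat) k j).
  by apply/funext => x; rewrite mxE.
by apply: cmeas_sum => k; apply: cmeasM; [exact: cmeas_cst|exact: cmeas_entry].
Qed.

Lemma measurable_mulmx (V : mat) : measurable_fun setT (fun U : T => (V *m U : T)).
Proof.
apply: (@measurability _ _ T T setT _ (@mx_coord_sets R n.+1 n.+1)) => //.
move=> _ [_ [i [j [A [mA [->|->]]]]] <-]; rewrite setTI.
  by have [/(_ measurableT A mA)] := cmeas_mulmx V i j; rewrite setTI.
by have [_ /(_ measurableT A mA)] := cmeas_mulmx V i j; rewrite setTI.
Qed.

(* The rotation of angle arcsin t in the plane (i, j): 1 + t (E_ij - E_ji) + O(t^2). *)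
Definition rot (i j : 'I_n.+1) (t : R) : mat :=
  if i == j then 1%:M else
  1%:M + (Num.sqrt (1 - t ^+ 2) - 1)%:C *: (delta_mx i i + delta_mx j j)
  + t%:C *: rotgen C i j.

Lemma conj_real (x : R) : Num.conj x%:C = x%:C :> C.
Proof. by rewrite /Num.conj /= oppr0. Qed.

Lemma cadj_delta (i j : 'I_n.+1) : cadj (delta_mx i j : mat) = delta_mx j i.
Proof.
apply/matrixP => a b; rewrite !mxE andbC.
by case: (_ && _); rewrite ?rmorph1 ?rmorph0.
Qed.

Lemma cadjD m p (A B : 'M[C]_(m, p)) : cadj (A + B) = cadj A + cadj B.
Proof. by rewrite /cadj map_mxD linearD. Qed.

Lemma cadjZ m p (a : C) (A : 'M[C]_(m, p)) : cadj (a *: A) = Num.conj a *: cadj A.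
Proof. by rewrite /cadj map_mxZ linearZ. Qed.

Lemma cadjM m p q (A : 'M[C]_(m, p)) (B : 'M[C]_(p, q)) : cadj (A *m B) = cadj B *m cadj A.
Proof. by rewrite /cadj map_mxM trmx_mul. Qed.

Lemma cadj1 m : cadj (1%:M : 'M[C]_m) = 1%:M.
Proof. by rewrite /cadj map_mx1 trmx1. Qed.

Lemma cadj_rotgen (i j : 'I_n.+1) : cadj (rotgen C i j) = - rotgen C i j.
Proof.
by rewrite /rotgen -scaleN1r cadjD cadjZ rmorphN1 !cadj_delta !scaleN1r opprB addrC.
Qed.

Lemma cadj_rot i j t : i != j -> cadj (rot i j t) = 1%:M +
  (Num.sqrt (1 - t ^+ 2) - 1)%:C *: (delta_mx i i + delta_mx j j) - t%:C *: rotgen C i j.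
Proof.
move=> /negPf ij; rewrite /rot ij.
by rewrite !cadjD !cadjZ cadj1 !conj_real cadjD !cadj_delta cadj_rotgen scalerN.
Qed.

(** With D = E_ii + E_jj and X = E_ij - E_ji one has D^2 = D, DX = XD = X and X^2 = -D, and all
    reduces to a^2 = -2a - t^2 for a = sqrt(1 - t^2) - 1. The range of t keeps the radicand
    nonnegative. *)
Lemma rot_unitary i j t : 0 <= t -> t <= 1 -> Defs.is_unitary (rot i j t).
Proof.
move=> t0 t1; have [->|ij] := eqVneq i j.
  by rewrite /Defs.is_unitary /rot eqxx cadj1 mulmx1.
rewrite /Defs.is_unitary cadj_rot// /rot (negPf ij).
set D := delta_mx i i + delta_mx j j; set X := rotgen C i j; set a := (_ - 1)%:C.
have dd (p q r s : 'I_n.+1) : delta_mx p q *m delta_mx r s = (q == r)%:R *: delta_mx p s :> mat.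
  by rewrite mul_delta_mx_cond; case: eqP => _; rewrite ?scale1r ?scale0r.
have ji : j != i by rewrite eq_sym.
have DD : D *m D = D.
  by rewrite /D mulmxDl !mulmxDr !dd !eqxx (negPf ij) (negPf ji) !scale1r !scale0r addr0 add0r.
have DX : D *m X = X.
  by rewrite /D /X /rotgen mulmxDl !mulmxBr !dd !eqxx (negPf ij) (negPf ji) !scale1r !scale0r subr0 sub0r.
have XD : X *m D = X.
  rewrite /D /X /rotgen mulmxDr !mulmxBl !dd !eqxx (negPf ij) (negPf ji) !scale1r !scale0r subr0 sub0r.
  by rewrite addrC.
have XX : X *m X = - D.
  rewrite /D /X /rotgen mulmxBl !mulmxBr !dd !eqxx (negPf ij) (negPf ji) !scale1r !scale0r sub0r subr0.
  by rewrite opprD.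
clearbody X D.
rewrite mulmxBr !mulmxDl !mul1mx !mulmxDr !mulmx1 -!scalemxAl -!scalemxAr DD DX XD XX.
clear DX XD XX DD dd.
have a2 : a * a = - (2 * a) - t%:C ^+ 2.
  rewrite /a -[2 : C](rmorph_nat (real_complex R) 2) -rmorphXn -!rmorphM -rmorphN -rmorphB.
  congr (_ %:C); have : Num.sqrt (1 - t ^+ 2) ^+ 2 = 1 - t ^+ 2.
    by rewrite sqr_sqrtr// subr_ge0 expr_le1.
  set c := Num.sqrt _ => c2; transitivity (c ^+ 2 - 2 * c + 1); first by ring.
  by rewrite c2; ring.
rewrite !scalerA !a2 scalerN.
apply/matrixP => p q; rewrite !mxE; ring.
Qed.

Lemma rot_real i j t : is_realmx (rot i j t).
Proof.
have Imb (b : bool) : complex.Im (1 *+ b : C) = 0 by case: b.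
move=> p q; rewrite /rot; case: ifP => _; first by rewrite mxE Imb.
rewrite /rotgen !mxE !(ImD, ImM, ImN) !Imb /=.
by rewrite oppr0 !(addr0, mulr0, mul0r).
Qed.

Lemma unitary_cadjK (V : mat) : Defs.is_unitary V -> cadj V *m V = 1%:M.
Proof. exact: mulmx1C. Qed.

Lemma unitary_opbound (V : mat) : Defs.is_unitary V -> opbound V 1.
Proof. by move=> uV; apply: opbound_isometry; exact: unitary_cadjK. Qed.

Let S : set T := [set V | Defs.is_unitary (V : mat)].
Let gam (i j : 'I_n.+1) (t : R) : T -> T := fun V => rot i j t *m (V : mat).

Lemma smooth_entry i j :
  smooth_mx S (gam i j) (fun V : T => (V : mat)) (fun V : T => rotgen C i j *m (V : mat)).
Proof.
move=> p q; split; [exact: cmeas_entry|exact: cmeas_mulmx|].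
exists 2; split => // V SV.
have V1 r s : `|(V : mat) r s| <= 1 by apply: opbound_entry; exact: unitary_opbound.
have dV (r s : 'I_n.+1) : `|((delta_mx r s : mat) *m (V : mat)) p q| <= 1.
  rewrite -[delta_mx r s]mul1mx mul_delta_mxE mxE.
  by case: (p == r); rewrite ?mul1r ?mul0r ?normr0.
have C2 : (2 : R)%:C = 1 + 1 :> C by exact: rmorphD.
split => [||t t0 t1].
- by apply: le_trans (V1 _ _) _; rewrite C2 lerDl.
- rewrite mulmxBl !mxE; apply: le_trans (ler_normB _ _) _; rewrite C2.
  by have := lerD (dV i j) (dV j i); rewrite !mxE.
- have [ij|ij] := eqVneq i j.
    rewrite /gam /rot ij eqxx mul1mx subrr /rotgen subrr mul0mx mxE mulr0 subr0 normr0.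
    by rewrite ler0c mulr_ge0 ?exprn_ge0.
  set X := rotgen C i j *m (V : mat).
  set Y := delta_mx i i *m (V : mat) in dV *; set Z := delta_mx j j *m (V : mat) in dV *.
  have -> : gam i j t V = (V : mat) + (Num.sqrt (1 - t ^+ 2) - 1)%:C *: (Y + Z) + t%:C *: X.
    rewrite /gam /rot (negPf ij) (mulmxDl (1%:M + _)) (mulmxDl 1%:M) mul1mx.
    by rewrite -!scalemxAl (mulmxDl (delta_mx i i)).
  have Y1 : `|Y p q| <= 1 by exact: dV.
  have Z1 : `|Z p q| <= 1 by exact: dV.
  clearbody X Y Z.
  (* Once the linear part is removed only the cosine term remains; 1 - t^2 <= sqrt(1 - t^2) <= 1
     makes it of order t^2. *)
  rewrite (_ : _ - _ - _ = (Num.sqrt (1 - t ^+ 2) - 1)%:C * (Y p q + Z p q)); last first.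
    by rewrite !mxE; ring.
  have -> : (2 * t ^+ 2)%:C = (1 + 1) * (t ^+ 2)%:C :> C by rewrite -C2; exact: rmorphM.
  rewrite normrM mulrC; apply: ler_pM => //.
    apply: le_trans (ler_normD _ _) _; exact: lerD.
  rewrite -(ger0_norm (exprn_ge0 2 t0)) /=.
  have t2 : t ^+ 2 <= 1 by rewrite expr_le1.
  have s1 : Num.sqrt (1 - t ^+ 2) <= 1 by rewrite -[leRHS]sqrtr1 ler_wsqrtr// gerBl sqr_ge0.
  have s2 : 1 - t ^+ 2 <= Num.sqrt (1 - t ^+ 2).
    rewrite -[leLHS](sqr_sqrtr (a := 1 - t ^+ 2)) ?subr_ge0//.
    by rewrite expr2 -[leRHS]mulr1 ler_wpM2l ?sqrtr_ge0.
  rewrite normc_def /= expr0n addr0 sqrtr_sqr lecR ler0_norm ?subr_le0// ger0_norm ?exprn_ge0//.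
  by rewrite opprB lerBlDr -lerBlDl.
Qed.

(** The generator X is skew-adjoint, so the product rule applied to U B U^* yields X M - M X. *)
Lemma smooth_conjugation (B : mat) i j :
  smooth_mx S (gam i j) (fun V : T => (V : mat) *m B *m cadj (V : mat))
    (fun V : T => bracket (rotgen C i j) ((V : mat) *m B *m cadj (V : mat))).
Proof.
have sV := smooth_entry i j.
have := smooth_mxM (smooth_mxM sV (smooth_mx_cst _ _ B)) (smooth_cadj sV).
congr smooth_mx; apply/funext => V.
by rewrite mulmx0 addr0 cadjM cadj_rotgen !mulmxN /bracket !mulmxA.
Qed.

End HaarDefect.

(** * Almost sure decay of the defects *)

(** [T1] and [T2] stand for the contracted derivatives of D and of its conjugate, [rm] for the
    transposed terms. Each summand carries |D|^(2p); the surplus factor |D| in the last one is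
    traded for c, and the coefficients p and p + 1 add up to 2p + 1. *)
Lemma defect_power_bound (C : numClosedFieldType) p (D T1 T2 rm b c : C) :
  `|T1| <= b -> `|T2| <= b -> `|rm| <= c -> `|D| <= c ->
  `|p%:R * D ^+ p.-1 * Num.conj D ^+ p.+1 * T1 + p.+1%:R * D ^+ p * Num.conj D ^+ p * T2
    - D ^+ p * Num.conj D ^+ p.+1 * rm| <= `|D| ^+ (2 * p) * ((2 * p + 1)%:R * b + c * c).
Proof.
move=> T1b T2b rmc Dc; set g := `|D|.
have g0 k : 0 <= g ^+ k by exact/exprn_ge0/normr_ge0.
have E : g ^+ (2 * p) * ((2 * p + 1)%:R * b + c * c) =
    p%:R * g ^+ (2 * p) * b + p.+1%:R * g ^+ (2 * p) * b + g ^+ (2 * p) * (c * c).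
  by rewrite natrD natrM -[p.+1%:R]natr1; ring.
rewrite E; apply: le_trans (ler_normB _ _) (lerD _ _).
  apply: le_trans (ler_normD _ _) (lerD _ _).
    rewrite normrM; apply: ler_pM => //.
    rewrite !normrM !normrX norm_conjC -/g normr_nat.
    case: p {E} => [|p]; first by rewrite !mul0r.
    rewrite -mulrA -exprD (_ : (p.+1.-1 + p.+2 = 2 * p.+1)%N)//; lia.
  rewrite normrM; apply: ler_pM => //.
  by rewrite !normrM !normrX norm_conjC -/g normr_nat -mulrA -exprD addnn mul2n.
rewrite normrM !normrM !normrX norm_conjC -/g exprS.
rewrite (_ : g ^+ p * (g * g ^+ p) * `|rm| = g ^+ (2 * p) * (g * `|rm|)); last first.
  by rewrite mul2n -addnn exprD; ring.
by apply: ler_wpM2l => //; apply: ler_pM => //; exact: normr_ge0.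
Qed.

(** * Even moments of the defect *)

Section DefectMoments.
Local Open Scope complex_scope.
Variables (R : realType) (d : measure_display) (Omega : measurableType d).
Variables (P : probability Omega R) (real_case : bool) (n : nat).
Local Notation C := R[i].
Local Notation mat := 'M[C]_n.+1.
Local Notation T := (g_sigma_algebraType (@mx_coord_sets R n.+1 n.+1)).
Variable U : Omega -> mat.
Hypothesis haarU : haar_distributed P real_case U.

Let S : set T := [set V | Defs.is_unitary (V : mat)].
Let gam (i j : 'I_n.+1) (t : R) : T -> T := fun V => rot i j t *m (V : mat).

Lemma haar_derivative i j (f f' : T -> C) : smooth S (gam i j) f f' ->
  bmeas (fun w => complex.Re (f' (U w))) /\ \int[P]_w complex.Re (f' (U w)) = 0.
Proof.
move=> sf; have [hU mU iU] := haarU.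
have mU' : measurable_fun setT (U : Omega -> T).
  by move=> _ A mA; rewrite setTI; exact: mU.
have SU w : S (U w) by case: (hU w).
split; first by case: (smooth_bmeas mU' SU sf).
apply: (invariant_derivative mU' SU _ _ sf) => [t|t t0 t1 A mA].
  exact: measurable_mulmx.
by apply: iU => //; [exact: rot_unitary|move=> _; exact: rot_real].
Qed.

Variables (A B Q : mat) (w : seq bool) (kap q : R).
Hypotheses (kap1 : 1 <= kap) (Ak : opbound A kap%:C) (Bk : opbound B kap%:C).
Hypothesis Qq : trbound Q q%:C.

Let Mx (V : T) : mat := (V : mat) *m B *m cadj (V : mat).
Let Hx (V : T) : mat := A + Mx V.
Let L := size w.
Let y : R := q * (2 * kap) ^+ L.
Let D (V : T) : C := defect (Hx V) (Mx V) Q w.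

Let kap0 : 0 <= kap. Proof. exact: le_trans ler01 kap1. Qed.
Let q0 : 0 <= q. Proof. by rewrite -ler0c; exact: trbound_ge0 Qq. Qed.
Let y0 : 0 <= y. Proof. by rewrite mulr_ge0// exprn_ge0// mulr_ge0. Qed.
Let kapc : 1 <= (2 * kap)%:C. Proof. rewrite lecE /= eqxx /=; move: kap1; lra. Qed.

Let Mx_bound1 V : S V -> opbound (Mx V) kap%:C.
Proof.
move=> SV; have uV := unitary_opbound SV.
have uV' : opbound (cadj (V : mat)) 1 by apply: opbound_tr; exact: opbound_conj.
have kapc0 : 0 <= kap%:C by rewrite ler0c.
have := opboundM (mulr_ge0 ler01 kapc0) ler01 (opboundM ler01 kapc0 uV Bk) uV'.
by rewrite mul1r mulr1.
Qed.

Let kap2 : (2 * kap)%:C = kap%:C + kap%:C.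
Proof. by rewrite mulr_natl mulr2n; exact: rmorphD. Qed.

Let Mx_bound V : S V -> opbound (Mx V) (2 * kap)%:C.
Proof.
by move=> SV; apply: opbound_le (Mx_bound1 SV); rewrite kap2 lerDl ler0c.
Qed.

Let Hx_bound V : S V -> opbound (Hx V) (2 * kap)%:C.
Proof. by move=> SV; rewrite kap2; exact: (opboundD Ak (Mx_bound1 SV)). Qed.

Let yE : q%:C * (2 * kap)%:C ^+ L = y%:C.
Proof. by rewrite /y [RHS]rmorphM; congr (_ * _); exact/esym/rmorphXn. Qed.

Let natc (k : nat) (x : R) : (k%:R * x)%:C = k%:R * x%:C :> C.
Proof. by rewrite [LHS]rmorphM; congr (_ * _); exact: rmorph_nat. Qed.

Let D_bound V : S V -> `|D V| <= ((2 * L)%:R * y)%:C.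
Proof.
move=> SV; apply: le_trans (defect_bound kapc (Hx_bound SV) (Mx_bound SV) w Qq) _.
by rewrite yE natc.
Qed.

Let e p (V : T) : R := complex.Re (D V ^+ p * Num.conj (D V) ^+ p).

Let eE p V : (e p V)%:C = `|D V| ^+ (2 * p).
Proof.
by rewrite /e -exprMn -normCK -exprM RRe_real// rpredX// normr_real.
Qed.

(** The value of (2p + 1) b + c^2 in [defect_power_bound] for b = 16 L^2 y^2, from the contracted
    derivatives, and c = 2 L y, which bounds both the defect and its remainder. *)
Let K p : R := ((16 * (2 * p + 1) + 4) * L ^ 2)%:R * y ^+ 2.

Let Yw V : mat := weval (Hx V) (Mx V) w *m Q.
Let KX i j V : mat := bracket (rotgen C i j) (Mx V).

Let dZ p i j V : C :=
  p%:R * D V ^+ p.-1 * ddefect (Hx V) (Mx V) (KX i j V) Q w * Num.conj (D V) ^+ p.+1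
  + D V ^+ p * (p.+1%:R * Num.conj (D V) ^+ p
      * Num.conj (ddefect (Hx V) (Mx V) (KX i j V) Q w)).

Let dF p i j V : C := dZ p i j V * Yw V i j
  + D V ^+ p * Num.conj (D V) ^+ p.+1 * (wderiv (Hx V) (Mx V) (KX i j V) w *m Q) i j.

Let smooth_Mx i j : smooth_mx S (gam i j) Mx (KX i j).
Proof. exact: smooth_conjugation. Qed.

Let smooth_Hx i j : smooth_mx S (gam i j) Hx (KX i j).
Proof.
have := smooth_mxD (smooth_mx_cst S (gam i j) A) (smooth_Mx i j).
by congr smooth_mx; apply/funext => V; rewrite add0r.
Qed.

Let smooth_D i j :
  smooth S (gam i j) D (fun V => ddefect (Hx V) (Mx V) (KX i j V) Q w).
Proof. by apply: smooth_defect; [exact: smooth_Hx|exact: smooth_Mx]. Qed.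

(** The test function: entry (i, j) of the word times [Q], weighted by D^p conj(D)^(p+1). Its
    derivative along the rotation in the same plane has mean zero, and summing over i, j turns the
    derivative of the entry into N D minus the transposed terms. *)
Let smooth_F p i j :
  smooth S (gam i j) (fun V => D V ^+ p * Num.conj (D V) ^+ p.+1 * Yw V i j) (dF p i j).
Proof.
have sD := smooth_D i j.
have sZ := smoothM (smooth_exp p sD) (smooth_exp p.+1 (smooth_conj sD)).
have sY := smooth_mxM (smooth_weval w (smooth_Hx i j) (smooth_Mx i j))
  (smooth_mx_cst S (gam i j) Q).
have := smoothM sZ (sY i j); congr smooth; apply/funext => V.
by rewrite mulmx0 addr0.
Qed.

Let dF_int p i j : bmeas (fun w => complex.Re (dF p i j (U w))) /\
  \int[P]_w complex.Re (dF p i j (U w)) = 0.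
Proof.
exact: (haar_derivative (smooth_F p i j)).
Qed.

Let dF_sum p V : S V ->
  n.+1%:R * e p.+1 V <= \sum_i \sum_j complex.Re (dF p i j V) + K p * e p V.
Proof.
move=> SV; have Hb := Hx_bound SV; have Mb := Mx_bound SV.
pose T1 := \sum_i \sum_j Yw V i j * ddefect (Hx V) (Mx V) (KX i j V) Q w.
pose T2 := \sum_i \sum_j Yw V i j * Num.conj (ddefect (Hx V) (Mx V) (KX i j V) Q w).
pose rm := defect_rem (Hx V) (Mx V) Q w.
have sumE : \sum_i \sum_j dF p i j V =
  p%:R * D V ^+ p.-1 * Num.conj (D V) ^+ p.+1 * T1
  + p.+1%:R * D V ^+ p * Num.conj (D V) ^+ p * T2
  + D V ^+ p * Num.conj (D V) ^+ p.+1 * (n.+1%:R * D V - rm).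
  rewrite -(contract_wderiv (Hx V) (Mx V) Q w) /T1 /T2 !mulr_sumr -!big_split /=.
  apply: eq_bigr => i _; rewrite !mulr_sumr -!big_split /=.
  by apply: eq_bigr => j _; rewrite /dF /dZ; ring.
have Yb : trbound (Yw V) y%:C.
  rewrite -yE; apply: trboundMl => //; last exact: weval_bound.
  by rewrite exprn_ge0// (le_trans ler01).
have ycy : y%:C * q%:C * (2 * kap)%:C ^+ L = (y ^+ 2)%:C.
  by rewrite -mulrA yE -expr2; exact/esym/rmorphXn.
have T1b : `|T1| <= ((16 * L ^ 2)%:R * y ^+ 2)%:C.
  apply: le_trans (contract_ddefect_bound kapc Hb Mb w Yb Qq) _.
  by rewrite ycy natc.
(* The parameter t is real, so conj(D) has the conjugate derivative. Conjugating the whole sum moves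
   the conjugation onto [Yw], whose trace norm bound is unaffected. *)
have T2b : `|T2| <= ((16 * L ^ 2)%:R * y ^+ 2)%:C.
  rewrite -norm_conjC.
  have -> : Num.conj T2 = \sum_i \sum_j (map_mx Num.conj (Yw V)) i j
       * ddefect (Hx V) (Mx V) (KX i j V) Q w.
    rewrite rmorph_sum; apply: eq_bigr => i _; rewrite rmorph_sum.
      apply: eq_bigr => j _; rewrite [LHS]rmorphM; congr (_ * _); last exact: conjCK.
    by rewrite [RHS]mxE.
  apply: le_trans (contract_ddefect_bound kapc Hb Mb w (trbound_conj Yb) Qq) _.
  by rewrite ycy natc.
have rmb : `|rm| <= ((2 * L)%:R * y)%:C.
  apply: le_trans (defect_rem_bound kapc Hb Mb w Qq) _.
  by rewrite yE natc.
rewrite (_ : \sum_i \sum_j complex.Re (dF p i j V) = complex.Re (\sum_i \sum_j dF p i j V)); last first.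
  by rewrite Re_sum; apply: eq_bigr => i _; rewrite Re_sum.
have main : n.+1%:R * (e p.+1 V)%:C =
    \sum_i \sum_j dF p i j V -
    (p%:R * D V ^+ p.-1 * Num.conj (D V) ^+ p.+1 * T1
     + p.+1%:R * D V ^+ p * Num.conj (D V) ^+ p * T2
     - D V ^+ p * Num.conj (D V) ^+ p.+1 * rm).
  have -> : (e p.+1 V)%:C = D V ^+ p.+1 * Num.conj (D V) ^+ p.+1.
    by rewrite eE exprM normCK exprMn.
  by rewrite sumE exprS; ring.
have rest := defect_power_bound p T1b T2b rmb (D_bound SV).
set X := (X in `|X|) in rest; rewrite -/X in main.
have : n.+1%:R * e p.+1 V = complex.Re (\sum_i \sum_j dF p i j V) - complex.Re X.
  by rewrite -ReN -ReD -main -natc.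
move=> ->; rewrite lerD2l; apply: le_trans (ler_norm _) _; rewrite normrN.
apply: normRe_le; apply: le_trans rest _; rewrite -eE.
rewrite -(rmorph_nat (real_complex R)) -!rmorphM -rmorphD -rmorphM lecR /K mulrC.
rewrite le_eqVlt; apply/orP; left; apply/eqP.
by rewrite !(natrM, natrD, natrX); ring.
Qed.

Let e_bmeas p : bmeas (fun w => e p (U w)).
Proof.
have [hU mU _] := haarU.
have mU' : measurable_fun setT (U : Omega -> T).
  by move=> _ X mX; rewrite setTI; exact: mU.
have SU w' : S (U w') by case: (hU w').
have sD := smooth_D ord0 ord0.
have := smooth_bmeas mU' SU (smoothM (smooth_exp p sD) (smooth_exp p (smooth_conj sD))).
by case.
Qed.

Let defect_moment_step p :
  n.+1%:R * \int[P]_w e p.+1 (U w) <= K p * \int[P]_w e p (U w).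
Proof.
have [hU _ _] := haarU.
have sumi i := Rintegral_bmeas_sum P (index_enum 'I_n.+1) (fun j => (dF_int p i j).1).
have [bF EF] := Rintegral_bmeas_sum P (index_enum 'I_n.+1) (fun i => (sumi i).1).
have F0 : \int[P]_w (\sum_i \sum_j complex.Re (dF p i j (U w))) = 0.
  rewrite EF big1// => i _; rewrite (sumi i).2 big1// => j _.
  exact: (dF_int p i j).2.
have bK := bmeasZ (K p) (e_bmeas p).
rewrite -(RintegralZl _ _ (bmeas_integrable P (e_bmeas p.+1)))//.
rewrite -(RintegralZl _ _ (bmeas_integrable P (e_bmeas p)))//.
rewrite -[leRHS]add0r -F0.
rewrite -(RintegralD _ (bmeas_integrable P bF) (bmeas_integrable P bK))//.
apply: le_Rintegral_bmeas; [exact: bmeasZ|exact: bmeasD|].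
by move=> w'; apply: dF_sum; case: (hU w').
Qed.

Lemma defect_sixth_moment (X := fun w' => Normc.normc (D (U w'))) :
  bmeas (fun w' => X w' ^+ 6) /\
  \int[P]_w' X w' ^+ 6 <= ((84 * L ^ 2)%:R * y ^+ 2 / n.+1%:R) ^+ 3.
Proof.
have XE : (fun w' => X w' ^+ 6) = (fun w' => e 3 (U w')).
  apply/funext => w'; apply: (@complexI R); rewrite eE rmorphXn.
  by congr (_ ^+ 6).
rewrite XE; split; first exact: e_bmeas.
have ge0 p : 0 <= \int[P]_w' e p (U w').
  by apply: Rintegral_ge0 => w' _; rewrite -ler0c eE exprn_ge0.
have E0 : \int[P]_w' e 0 (U w') = 1.
  rewrite (_ : (fun w' => _) = cst 1); last by apply/funext => w'; rewrite /e !expr0 mulr1.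
  by rewrite Rintegral_cst//; have /= -> := @probability_setT _ _ _ P; rewrite mulr1.
set B0 := _ / _.
(* 84 = 16 * 5 + 4 is the constant of [K] at p = 2, the largest of the three steps used. *)
have step p : (p <= 2)%N -> \int[P]_w e p.+1 (U w) <= B0 * \int[P]_w e p (U w).
  move=> p2; rewrite /B0 mulrAC ler_pdivlMr ?ltr0Sn// mulrC.
  apply: le_trans (defect_moment_step p) _; apply: ler_wpM2r => //.
  by apply: ler_wpM2r; rewrite ?exprn_ge0// ler_nat leq_mul2r; apply/orP; right; lia.
have B00 : 0 <= B0 by rewrite divr_ge0// mulr_ge0// exprn_ge0.
apply: le_trans (step 2 isT) _; rewrite exprS; apply: ler_wpM2l => //.
apply: le_trans (step 1 isT) _; rewrite exprS; apply: ler_wpM2l => //.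
by apply: le_trans (step 0 isT) _; rewrite E0 expr1 mulr1.
Qed.

End DefectMoments.

(** * Almost sure convergence from summable expectations *)

Section AlmostSure.
Variables (R : realType) (d : measure_display) (Omega : measurableType d).
Variable P : probability Omega R.

(** The induction needs the sharper bound 2c - 2c/(m+1), whose increment exceeds c/(m+1)^2 by c m /
    ((m+1)^2 (m+2)). *)
Lemma sum_inv_sqr_le (c : R) m : 0 <= c ->
  \sum_(0 <= k < m) c / (k.+1%:R ^+ 2) <= 2 * c.
Proof.
move=> c0; suff : \sum_(0 <= k < m) c / (k.+1%:R ^+ 2) <= 2 * c - 2 * c / m.+1%:R.
  move=> h; apply: le_trans h _; rewrite gerBl divr_ge0// mulr_ge0//.
elim: m => [|m IH]; first by rewrite big_nil divr1 subrr.
rewrite big_nat_recr//=; apply: le_trans (lerD IH (lexx _)) _.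
have m1 : 0 < m.+1%:R :> R by rewrite ltr0Sn.
have m2 : 0 < m.+2%:R :> R by rewrite ltr0Sn.
rewrite -subr_ge0; set r := (X in 0 <= X).
have -> : r = c * m%:R / (m.+1%:R ^+ 2 * m.+2%:R).
  by rewrite /r -!natr1; field; rewrite ?natr1 !pnatr_eq0.
by rewrite divr_ge0// mulr_ge0// exprn_ge0.
Qed.

(** The sum of the nonnegative X n has finite mean, hence is finite almost everywhere, and the terms
    of a convergent series tend to 0. *)
Lemma ae_cvg0_of_summable (X : nat -> Omega -> R) (c : R) : 0 <= c ->
  (forall n, bmeas (X n)) -> (forall n w, 0 <= X n w) ->
  (forall n, \int[P]_w X n w <= c / (n.+1%:R ^+ 2)) ->
  {ae P, forall w, (fun n => X n w) @ \oo --> (0 : R)}.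
Proof.
move=> c0 bX X0 EX.
pose f n w := (X n w)%:E.
have mf n : measurable_fun setT (f n) by apply/measurable_EFinP; case: (bX n).
have f0 n w : setT w -> (0 <= f n w)%E by rewrite lee_fin.
have EXf n : (\int[P]_w f n w <= (c / (n.+1%:R ^+ 2))%:E)%E.
  have : (\int[P]_w f n w)%E \is a fin_num by apply: integrable_fin_num => //; exact: bmeas_integrable.
  by move/fineK <-; rewrite lee_fin; exact: EX.
have sumfin : (\int[P]_w (\sum_(n <oo) f n w) <= (2 * c)%:E)%E.
  rewrite integral_nneseries//.
  apply: lime_le; first by apply: is_cvg_nneseries => n _ _; apply: integral_ge0 => w _; exact: f0.
  apply: nearW => m; apply: le_trans (_ : _ <= \sum_(0 <= k < m) (c / (k.+1%:R ^+ 2))%:E)%E _.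
    exact: lee_sum.
  by rewrite sumEFin lee_fin sum_inv_sqr_le.
have intf : P.-integrable setT (fun w => \sum_(n <oo) f n w)%E.
  apply/integrableP; split.
    by apply: ge0_emeasurable_sum => [k x _ _|k _]; [exact: f0|exact: mf].
  under eq_integral => w _.
    rewrite gee0_abs; last by apply: nneseries_ge0 => n _ _; exact: f0.
    over.
  by apply: le_lt_trans sumfin _; rewrite ltry.
have := integrable_ae measurableT intf.
apply: filterS => w /(_ I) fin.
apply: cvg_series_cvg_0; apply: nondecreasing_is_cvgn.
  by apply/nondecreasing_seqP => n; rewrite /series /= big_nat_recr//= lerDl.
exists (fine (\sum_(n <oo) f n w)%E) => _ [m _ <-].
rewrite -lee_fin fineK// /series /= -sumEFin.
by apply: nneseries_lim_ge => n _ _; exact: f0.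
Qed.

End AlmostSure.

(** * Operator norms controlled by moments *)

Section NormGrowth.
Local Open Scope complex_scope.
Variable R : realType.
Local Notation C := R[i].

Lemma real_root_ge1 (x : R) m : 1 <= x -> (0 < m)%N ->
  exists2 r, 1 <= r & r ^+ m = x.
Proof.
move=> x1 m0; have x0 : 0 <= x := le_trans ler01 x1.
have mE : (x `^ m%:R^-1) ^+ m = x.
  by rewrite -powR_mulrn ?powR_ge0// -powRrM mulVf ?powRr1// pnatr_eq0 -lt0n.
exists (x `^ m%:R^-1) => //.
by rewrite -(@ler_pXn2r _ m) ?nnegrE ?powR_ge0// expr1n mE.
Qed.

Lemma Im_conj_eq (z : C) : Num.conj z = z -> complex.Im z = 0.
Proof. by move/(congr1 (@complex.Im R)); rewrite ImJ => h; lra. Qed.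

Lemma hermitian_trace_real n (A : 'M[C]_n.+1) k : is_hermitian A ->
  complex.Im (\tr (A ^+ k)) = 0.
Proof.
move=> hA; apply: Im_conj_eq; rewrite -trace_map_mx -mxtrace_tr.
by rewrite (hermitian_pow k hA).
Qed.

Lemma hermitian_form_real n (A : 'M[C]_n.+1) (v : 'cV[C]_n.+1) k : is_hermitian A ->
  complex.Im ((cadj v *m (A ^+ k *m v)) 0 0) = 0.
Proof.
move=> hA; apply: Im_conj_eq.
transitivity (cadj (cadj v *m (A ^+ k *m v)) 0 0); first by rewrite !mxE.
have cadjK : cadj (cadj v) = v.
  by apply/matrixP => i j; rewrite !mxE; exact: conjCK.
by rewrite !cadjM (hermitian_pow k hA : cadj _ = _) cadjK mulmxA.
Qed.

(* The operator norm of A n is O(n^(1/2^(s+1))) for every s. *)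
Lemma opbound_of_moments (A : forall n : nat, 'M[C]_n.+1) (mu : probability R R) s :
  (forall n, is_hermitian (A n)) -> cvg_moment (fun n k => esd_moment (A n) k) mu ->
  exists2 c : R, 1 <= c & forall n kap, 1 <= kap -> c * n.+1%:R <= kap ^+ (2 ^ s.+1) ->
    opbound (A n) kap%:C.
Proof.
move=> hA /(_ (2 ^ s.+1)%N) [_ cA].
have [c [_ cb]] := cvg_seq_bounded (cvgP _ cA).
have c1 : c < `|c| + 1 by rewrite ltr_pwDr// ler_norm.
exists (`|c| + 1); first by rewrite lerDr.
move=> n kap kap1 kn; apply: (hermitian_opbound (s := s) (hA n)).
  by rewrite ler0c (le_trans ler01).
have -> : \tr (A n ^+ (2 ^ s.+1)) = (esd_moment (A n) (2 ^ s.+1) * n.+1%:R)%:C.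
  have Im0 := hermitian_trace_real (2 ^ s.+1) (hA n).
  have tE : \tr (A n ^+ (2 ^ s.+1)) = (complex.Re (\tr (A n ^+ (2 ^ s.+1))))%:C.
    by move: Im0; case: (\tr _) => a b /= ->.
  rewrite tE /esd_moment; set t := complex.Re _.
  rewrite {1}tE -/t -(rmorph_nat (real_complex R)) -fmorphV -rmorphM /=.
  by rewrite divfK ?pnatr_eq0.
rewrite -rmorphXn lecR; apply: le_trans kn; apply: ler_wpM2r => //.
by apply: le_trans (ler_norm _) _; exact: cb.
Qed.

End NormGrowth.

Section AlmostSureDefect.
Local Open Scope complex_scope.
Variables (R : realType) (d : measure_display) (Omega : measurableType d).
Variables (P : probability Omega R) (real_case : bool).
Local Notation C := R[i].
Variables (A B : forall n : nat, 'M[C]_n.+1) (mu1 mu2 : probability R R).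
Variable U : forall n : nat, Omega -> 'M[C]_n.+1.
Hypotheses (hA : forall n, is_hermitian (A n)) (hB : forall n, is_hermitian (B n)).
Hypothesis cA : cvg_moment (fun n k => esd_moment (A n) k) mu1.
Hypothesis cB : cvg_moment (fun n k => esd_moment (B n) k) mu2.
Hypothesis haarU : forall n, haar_distributed P real_case (U n).

Definition conjB n w := U n w *m B n *m cadj (U n w).

Lemma ae_defect_cvg0 (Q : forall n : nat, 'M[C]_n.+1) j u :
  (forall n kap, 1 <= kap -> opbound (A n) kap%:C -> trbound (Q n) (kap ^+ j)%:C) ->
  {ae P, forall w, (fun n => Normc.normc (defect (A n + conjB n w) (conjB n w) (Q n) u))
    @ \oo --> (0 : R)}.
Proof.
(* The sixth moment bound contains (kap^j kap^L)^6 = kap^s. Choosing kap as the root of kap^m = ca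
   cb N with m = 2^(s+1) >= s keeps this factor below ca cb N, so N^-3 becomes the summable N^-2. *)
move=> hQ; set L := size u; pose s := (6 * (j + L))%N.
have [ca ca1 Ab] := opbound_of_moments s hA cA.
have [cb cb1 Bb] := opbound_of_moments s hB cB.
pose m := (2 ^ s.+1)%N.
have m0 : (0 < m)%N by rewrite expn_gt0.
have cab1 : 1 <= ca * cb by rewrite mulr_ege1.
have cab0 : 0 <= ca * cb := le_trans ler01 cab1.
have kap_ex n : exists2 kap, 1 <= kap & kap ^+ m = ca * cb * n.+1%:R.
  by apply: real_root_ge1 => //; rewrite mulr_ege1// ler1n.
pose X n w := Normc.normc (defect (A n + conjB n w) (conjB n w) (Q n) u) ^+ 6.
pose c0 : R := ((84 * L ^ 2)%:R * 2 ^+ (2 * L)) ^+ 3.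
have c00 : 0 <= c0 by rewrite exprn_ge0// mulr_ge0// exprn_ge0.
have X6 n : bmeas (X n) /\ \int[P]_w X n w <= c0 * (ca * cb) / (n.+1%:R ^+ 2).
  have [kap kap1 kapm] := kap_ex n.
  have kap0 : 0 <= kap := le_trans ler01 kap1.
  have Ak : opbound (A n) kap%:C.
    apply: Ab => //; rewrite kapm; apply: ler_wpM2r => //.
    by rewrite -[leLHS]mulr1 ler_wpM2l// (le_trans ler01).
  have Bk : opbound (B n) kap%:C.
    apply: Bb => //; rewrite kapm; apply: ler_wpM2r => //.
    by rewrite -[leLHS]mul1r ler_wpM2r// (le_trans ler01).
  have [bX EX] := defect_sixth_moment (haarU n) u kap1 Ak Bk (hQ n kap kap1 Ak).
  split; first exact: bX.
  apply: le_trans EX _; rewrite -/L.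
  have -> : ((84 * L ^ 2)%:R * (kap ^+ j * (2 * kap) ^+ L) ^+ 2 / n.+1%:R) ^+ 3 =
      c0 * (kap ^+ s / n.+1%:R ^+ 3).
    have -> : kap ^+ s = (kap ^+ j * kap ^+ L) ^+ 6 by rewrite /s mulnC exprM exprD.
    rewrite /c0 (_ : 2 ^+ (2 * L) = (2 ^+ L) ^+ 2 :> R); last by rewrite mulnC exprM.
    rewrite -exprVn [(2 * kap) ^+ L]exprMn.
    by ring.
  rewrite -mulrA; apply: ler_wpM2l => //.
  have n1 : 0 < n.+1%:R :> R by rewrite ltr0Sn.
  rewrite ler_pdivrMr ?exprn_gt0//.
  rewrite (_ : ca * cb / n.+1%:R ^+ 2 * n.+1%:R ^+ 3 = kap ^+ m); last first.
    by rewrite kapm; field; rewrite -natr1 in n1 *; rewrite ?gt_eqF.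
  have /ltnW s2 : (s < 2 ^ s)%N by exact: ltn_expl.
  by rewrite ler_weXn2l// /m expnS (leq_trans s2)// leq_pmull.
have X0 n w : 0 <= X n w by rewrite exprn_ge0// normc_ge0.
have := ae_cvg0_of_summable (mulr_ge0 c00 cab0) (fun n => (X6 n).1) X0 (fun n => (X6 n).2).
apply: filterS => w Xw.
apply/cvgr0Pnorm_lt => e e0.
have e6 : 0 < e ^+ 6 by rewrite exprn_gt0.
have near6 := @cvgr0_norm_lt _ _ _ _ _ _ Xw _ e6.
near=> n; have : `|X n w| < e ^+ 6 by near: n; exact: near6.
rewrite !ger0_norm ?X0//; last exact: normc_ge0.
by rewrite /X ltr_pXn2r// nnegrE ?normc_ge0// ltW.
Unshelve. all: by end_near.
Qed.

End AlmostSureDefect.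

(** * Limits of the mixed moments *)

Section ComplexSequences.
Local Open Scope complex_scope.
Variable R : realType.
Local Notation C := R[i].
Implicit Types f g : nat -> C.

Definition cvgC f (l : C) : Prop :=
  ((fun n => complex.Re (f n)) @ \oo --> complex.Re l) /\
  ((fun n => complex.Im (f n)) @ \oo --> complex.Im l).

Lemma cvgC_cst c : cvgC (fun=> c) c.
Proof. by split; exact: cvg_cst. Qed.

Lemma cvgCD f g l m : cvgC f l -> cvgC g m -> cvgC (fun n => f n + g n) (l + m).
Proof.
move=> [f1 f2] [g1 g2]; split.
  by under eq_fun do rewrite ReD; rewrite ReD; exact: cvgD.
by under eq_fun do rewrite ImD; rewrite ImD; exact: cvgD.
Qed.

Lemma cvgCN f l : cvgC f l -> cvgC (fun n => - f n) (- l).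
Proof.
move=> [f1 f2]; split.
  by under eq_fun do rewrite ReN; rewrite ReN; exact: cvgN.
by under eq_fun do rewrite ImN; rewrite ImN; exact: cvgN.
Qed.

Lemma cvgCB f g l m : cvgC f l -> cvgC g m -> cvgC (fun n => f n - g n) (l - m).
Proof. by move=> fl gm; apply: cvgCD => //; exact: cvgCN. Qed.

Lemma cvgCM f g l m : cvgC f l -> cvgC g m -> cvgC (fun n => f n * g n) (l * m).
Proof.
move=> [f1 f2] [g1 g2]; split.
  by under eq_fun do rewrite ReM; rewrite ReM; apply: cvgB; exact: cvgM.
by under eq_fun do rewrite ImM; rewrite ImM; apply: cvgD; exact: cvgM.
Qed.

Lemma cvgC_sum (I : Type) (r : seq I) (F : I -> nat -> C) (l : I -> C) :
  (forall i, cvgC (F i) (l i)) ->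
  cvgC (fun n => \sum_(i <- r) F i n) (\sum_(i <- r) l i).
Proof.
move=> h; elim: r => [|i r IH].
  by rewrite big_nil; under eq_fun do rewrite big_nil; exact: cvgC_cst.
by rewrite big_cons; under eq_fun do rewrite big_cons; exact: cvgCD.
Qed.

Lemma cvgC_unique f l m : cvgC f l -> cvgC f m -> l = m.
Proof.
move=> [f1 f2] [g1 g2]; have r := cvg_unique _ f1 g1; have i := cvg_unique _ f2 g2.
by apply/eqP; rewrite eq_complex; apply/andP; split; apply/eqP; [apply: r|apply: i].
Qed.

Lemma normIm_le (x : C) (c : R) : `|x| <= c%:C -> `|complex.Im x| <= c.
Proof.
move=> xc; have := @normRe_le R (x * 'i%C) c.
by rewrite ReiNIm normrN; apply; rewrite normrM complexiE normCi mulr1.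
Qed.

Lemma cvgC_norm0 f : (fun n => Normc.normc (f n)) @ \oo --> (0 : R) -> cvgC f 0.
Proof.
move=> f0; split; apply: norm_cvg0.
  apply: (@squeeze_cvgr _ _ _ _ (fun=> 0) (fun n => Normc.normc (f n))) => //; last exact: cvg_cst.
  by apply: nearW => n; rewrite normr_ge0 /=; exact: normRe_le.
apply: (@squeeze_cvgr _ _ _ _ (fun=> 0) (fun n => Normc.normc (f n))) => //; last exact: cvg_cst.
by apply: nearW => n; rewrite normr_ge0 /=; exact: normIm_le.
Qed.

End ComplexSequences.

Section LimitRecursion.
Variable R : realType.
Local Notation C := R[i].

(** The defect of the word H^(k+1) with weight Q A^j, for h i = tr(H^i), b i = tr(H^i M) and f j k =
    Tr(Q A^j H^k). The difference of two values of f comes from writing M = H - A behind the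
    weight. *)
Definition state_rel (K : pzRingType) (h b : nat -> K) (f : nat -> nat -> K) j k : K :=
  \sum_(i < k.+1) (h i * (f j (k - i).+1 - f j.+1 (k - i)%N) - b i * f j (k - i)%N).

(** The defect of H^(k+1) M^l under the normalised trace, with t l k = tr(H^k M^l). The letters M
    telescope to h (k+1) t l 0 - t l (k+1), of which the second term is kept apart. *)
Definition mixed_rel (K : pzRingType) (h b : nat -> K) (t : nat -> nat -> K) l k : K :=
  h k.+1 * t l 0%N + \sum_(i < k.+1) (h i * t l.+1 (k - i)%N - b i * t l (k - i)%N).

Lemma cvgC_state_rel (h b : nat -> nat -> C) (f : nat -> nat -> nat -> C) h' b' f' j k : (forall i, cvgC (h i) (h' i)) ->
  (forall i, cvgC (b i) (b' i)) -> (forall j i, cvgC (f j i) (f' j i)) ->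
  cvgC (fun n => state_rel (h ^~ n) (b ^~ n) (fun j i => f j i n) j k) (state_rel h' b' f' j k).
Proof.
move=> ch cb cf; apply: cvgC_sum => i.
by apply: cvgCB; apply: cvgCM => //; exact: cvgCB.
Qed.

Lemma cvgC_mixed_rel (h b : nat -> nat -> C) (f : nat -> nat -> nat -> C) h' b' f' j k : (forall i, cvgC (h i) (h' i)) ->
  (forall i, cvgC (b i) (b' i)) -> (forall j i, cvgC (f j i) (f' j i)) ->
  cvgC (fun n => mixed_rel (h ^~ n) (b ^~ n) (fun j i => f j i n) j k) (mixed_rel h' b' f' j k).
Proof.
move=> ch cb cf; apply: cvgCD; first exact: cvgCM.
by apply: cvgC_sum => i; apply: cvgCB; exact: cvgCM.
Qed.

Variables (phi s t : nat -> nat -> nat -> C).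
Hypothesis phi00 : forall n, phi 0 0 n = 1.
Hypothesis phi0 : forall j, exists l, cvgC (phi j 0) l.
Hypothesis s0 : forall j, exists l, cvgC (s j 0) l.
Hypothesis t0 : forall j, exists l, cvgC (t j 0) l.
Let h k n := phi 0 k n.
Let b k n := t 1 k n.
Hypothesis phi_rel : forall j k,
  cvgC (fun n => state_rel (h ^~ n) (b ^~ n) (fun j i => phi j i n) j k) 0.
Hypothesis s_rel : forall j k,
  cvgC (fun n => state_rel (h ^~ n) (b ^~ n) (fun j i => s j i n) j k) 0.
Hypothesis t_rel : forall l k,
  cvgC (fun n => mixed_rel (h ^~ n) (b ^~ n) (fun j i => t j i n) l k - t l k.+1 n) 0.

Let cv (f : nat -> C) : Prop := exists l, cvgC f l.
Let cvD f g : cv f -> cv g -> cv (fun n => f n + g n).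
Proof. by move=> [l fl] [m gm]; exists (l + m); exact: cvgCD. Qed.
Let cvB f g : cv f -> cv g -> cv (fun n => f n - g n).
Proof. by move=> [l fl] [m gm]; exists (l - m); exact: cvgCB. Qed.
Let cvM f g : cv f -> cv g -> cv (fun n => f n * g n).
Proof. by move=> [l fl] [m gm]; exists (l * m); exact: cvgCM. Qed.
Let cv_sum (I : finType) (F : I -> nat -> C) : (forall i, cv (F i)) ->
  cv (fun n => \sum_i F i n).
Proof.
move=> hF; have [l Fl] := choice hF.
by exists (\sum_i l i); exact: cvgC_sum.
Qed.

(** As h 0 = 1, the summand i = 0 isolates f j (k+1). It involves f (j+1) k, so convergence at the
    lower levels is assumed for all j simultaneously. *)
Let state_step f k : (forall i, (i <= k)%N -> cv (h i)) ->
  (forall i, (i <= k)%N -> cv (b i)) -> (forall j i, (i <= k)%N -> cv (f j i)) ->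
  (forall j, cvgC (fun n => state_rel (h ^~ n) (b ^~ n) (fun j i => f j i n) j k) 0) ->
  forall j, cv (f j k.+1).
Proof.
move=> ch cb cf fr j.
have -> : f j k.+1 = fun n => state_rel (h ^~ n) (b ^~ n) (fun j i => f j i n) j k
   + f j.+1 k n + b 0 n * f j k n
   - \sum_(i < k) (h i.+1 n * (f j (k - i.+1).+1 n - f j.+1 (k - i.+1)%N n) - b i.+1 n * f j (k - i.+1)%N n).
  apply/funext => n; rewrite /state_rel big_ord_recl /= {1}/h phi00 !subn0.
  by rewrite /bump /=; under [in RHS]eq_bigr do rewrite add1n; ring.
apply: cvB; last first.
  apply: cv_sum => i; have ik := ltn_ord i.
  have ik' : (k - i.+1 <= k)%N by rewrite leq_subr.
  apply: cvB; apply: cvM; rewrite ?subnSK//; [exact: ch| |exact: cb|exact: cf].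
  by apply: cvB; apply: cf => //; exact: leq_subr.
apply: cvD; last by apply: cvM; [exact: cb|exact: cf].
by apply: cvD; [exists 0|exact: cf].
Qed.

Lemma recursion_cvg j k : [/\ cv (phi j k), cv (s j k) & cv (t j k)].
Proof.
suff [h1 h2 h3] : [/\ forall j i, (i <= k)%N -> cv (phi j i),
    forall j i, (i <= k)%N -> cv (s j i) & forall j i, (i <= k)%N -> cv (t j i)].
  by split; [exact: h1|exact: h2|exact: h3].
elim: k {j} => [|k [IH1 IH2 IH3]].
  by split => j i; rewrite leqn0 => /eqP ->; [exact: phi0|exact: s0|exact: t0].
have ch i : (i <= k)%N -> cv (h i) by exact: IH1.
have cb i : (i <= k)%N -> cv (b i) by exact: IH3.
(* [phi] comes first: the mixed relation at level k contains h (k+1), whereas the state relations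
   need b only up to k. *)
have ph j : cv (phi j k.+1) by apply: state_step => // i; exact: phi_rel.
split => j i; rewrite leq_eqVlt => /orP[/eqP->|]; rewrite ?ltnS; [exact: ph|exact: IH1| |exact: IH2| |exact: IH3].
  by apply: state_step => // j'; exact: s_rel.
have -> : t j k.+1 = fun n => mixed_rel (h ^~ n) (b ^~ n) (fun j i => t j i n) j k
   - (mixed_rel (h ^~ n) (b ^~ n) (fun j i => t j i n) j k - t j k.+1 n).
  by apply/funext => n; ring.
apply: cvB; last by exists 0; exact: t_rel.
apply: cvD; first by apply: cvM; [exact: ph|exact: t0].
apply: cv_sum => a; have ak : (a <= k)%N by rewrite -ltnS.
have ak' : (k - a <= k)%N by exact: leq_subr.
by apply: cvB; apply: cvM; [exact: ch|exact: IH3|exact: cb|exact: IH3].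
Qed.

End LimitRecursion.

(** * Defects of the words H^k M^l as recursions *)

Section DefectIdentities.
Variables (C : numClosedFieldType) (n : nat) (A M : 'M[C]_n.+1).
Let H := A + M.
Implicit Type Q : 'M[C]_n.+1.

Lemma defect_state Q k : defect H M Q (nseq k.+1 true) =
  \sum_(i < k.+1) (\tr (ntr C n *m H ^+ i) *
       (\tr (Q *m H ^+ (k - i).+1) - \tr (Q *m A *m H ^+ (k - i)))
     - \tr (ntr C n *m (H ^+ i *m M)) * \tr (Q *m H ^+ (k - i))).
Proof.
rewrite /defect size_nseq; apply: eq_bigr => i _.
rewrite take_nseq ?(ltnW (ltn_ord i))// drop_nseq subSS.
rewrite -cats1 /trw /= weval_cat /= mulmx1 !weval_nseq; congr (_ * _ - _).
have -> : M = H - A by rewrite /H addrC addKr.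
by rewrite mulmxBl mulmxBr raddfB /= exprS !mulmxA.
Qed.

Lemma defect_mixed k l : defect H M (ntr C n) (nseq k.+1 true ++ nseq l false) =
  \tr (ntr C n *m H ^+ k.+1) * \tr (ntr C n *m M ^+ l)
  + \sum_(i < k.+1) (\tr (ntr C n *m H ^+ i) * \tr (ntr C n *m (H ^+ (k - i) *m M ^+ l.+1))
     - \tr (ntr C n *m (H ^+ i *m M)) * \tr (ntr C n *m (H ^+ (k - i) *m M ^+ l)))
  - \tr (ntr C n *m (H ^+ k.+1 *m M ^+ l)).
Proof.
have [w wE] : exists w, w = nseq k.+1 true ++ nseq l false by eexists.
have sw : size w = (k.+1 + l)%N by rewrite wE size_cat !size_nseq.
rewrite -wE /defect sw big_split_ord /= [RHS]addrAC [RHS]addrC; congr (_ + _).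
  apply: eq_bigr => i _; have ik : (i < k.+1)%N := ltn_ord i.
  have -> : take i w = nseq i true.
    rewrite wE takel_cat; last by rewrite size_nseq ltnW.
    by rewrite take_nseq// ltnW.
  have -> // : forall a, (a < k.+1)%N -> drop a.+1 w = nseq (k - a) true ++ nseq l false.
    move=> a ak; rewrite wE -{1}(subnKC ak) nseqD -catA.
    by rewrite drop_size_cat ?size_nseq// subSS.
  rewrite -cats1 /trw /= !weval_cat /= mulmx1 !weval_nseq; congr (_ * _ - _).
  by rewrite /ntr !mul_scalar_mx !mxtraceZ mxtrace_mulC -mulmxA exprSr.
(* At a letter M the prefix is H^(k+1) M^i, and the two products in the defect are g i and g (i+1);
   the sum over these letters telescopes to g 0 - g l. *)
pose g i := \tr (ntr C n *m (H ^+ k.+1 *m M ^+ i)) * \tr (ntr C n *m M ^+ (l - i)).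
have tr1 : \tr (ntr C n) = 1 by rewrite /ntr mxtrace_scalar -[_ *+ _]mulr_natr mulVf// pnatr_eq0.
transitivity (\sum_(i < l) (g i - g i.+1)).
  apply: eq_bigr => i _; have il : (i < l)%N := ltn_ord i.
  have -> : take (k.+1 + i) w = nseq k.+1 true ++ nseq i false.
    rewrite wE take_cat size_nseq ltnNge leq_addr; rewrite /= addKn take_nseq ?(ltnW il)//.
  have -> : drop (k.+1 + i).+1 w = nseq (l - i.+1) false.
    rewrite wE drop_cat size_nseq -addnS ltnNge leq_addr; rewrite /= addKn drop_nseq//.
  rewrite -cats1 /trw /g !weval_cat !weval_nseq /= mulmx1 weval_nseq.
  by rewrite -(subnSK il) [M ^+ (l - i.+1).+1]exprS -mulmxA [M ^+ i.+1]exprSr.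
rewrite -(big_mkord xpredT (fun i => g i - g i.+1)).
rewrite (eq_bigr (fun i => - (g i.+1 - g i))) => [|i _]; last by rewrite opprB.
rewrite sumrN telescope_sumr// opprB /g subn0 subnn !expr0 [H ^+ k.+1 *m 1]mulmx1 [ntr C n *m 1]mulmx1.
by rewrite tr1 mulr1.
Qed.

Lemma defect_mixed_rel k l : defect H M (ntr C n) (nseq k.+1 true ++ nseq l false) =
  mixed_rel (fun i => \tr (ntr C n *m H ^+ i)) (fun i => \tr (ntr C n *m (H ^+ i *m M)))
    (fun l k => \tr (ntr C n *m (H ^+ k *m M ^+ l))) l k
  - \tr (ntr C n *m (H ^+ k.+1 *m M ^+ l)).
Proof. by rewrite defect_mixed /mixed_rel expr0 mul1mx. Qed.

Lemma defect_state_rel (Q : nat -> 'M[C]_n.+1) j k : Q j *m A = Q j.+1 ->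
  defect H M (Q j) (nseq k.+1 true) =
  state_rel (fun i => \tr (ntr C n *m H ^+ i)) (fun i => \tr (ntr C n *m (H ^+ i *m M)))
    (fun j k => \tr (Q j *m H ^+ k)) j k.
Proof. by move=> QA; rewrite defect_state QA. Qed.

End DefectIdentities.

(** * Asymptotic expansions on the imaginary axis *)

Section Expansions.
Local Open Scope complex_scope.
Variable R : realType.
Local Notation C := R[i].
Implicit Types (f g : R -> C) (a b : nat -> C).

Definition axis (y : R) : C := 0 +i* y.
Definition uax (y : R) : C := (axis y)^-1.

(* [expands K f a] : f y = a_0 + a_1 u + ... + a_(K-1) u^(K-1) + O(u^K) as y goes
   to infinity, where u = 1/(iy). *)
Fixpoint expands K f a : Prop :=
  if K is K'.+1 then
    exists g, (forall y, 1 <= y -> f y = a 0%N + uax y * g y) /\ expands K' g (fun k => a k.+1)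
  else exists c : R, forall y, 1 <= y -> `|f y| <= c%:C.

Lemma axis_norm y : 1 <= y -> `|axis y| = y%:C.
Proof.
by move=> y1; rewrite normc_def /= expr2 mul0r add0r sqrtr_sqr ger0_norm// (le_trans ler01).
Qed.

Lemma uax_norm y : 1 <= y -> `|uax y| = (y^-1)%:C.
Proof. by move=> y1; rewrite normfV axis_norm// fmorphV. Qed.

Lemma axis_neq0 y : 1 <= y -> axis y != 0.
Proof.
move=> y1; rewrite -normr_eq0 axis_norm// -[0](rmorph0 (real_complex R)).
by rewrite (inj_eq (@complexI R)) gt_eqF// (lt_le_trans ltr01).
Qed.

Lemma uax_norm_le1 y : 1 <= y -> `|uax y| <= 1.
Proof.
move=> y1; rewrite uax_norm// -[1](rmorph1 (real_complex R)) lecR invf_le1//.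
exact: lt_le_trans y1.
Qed.

Lemma expands_eq K f g a b : (forall y, 1 <= y -> f y = g y) -> (forall k, a k = b k) ->
  expands K f a -> expands K g b.
Proof.
move=> fg ab; have -> : b = a by apply/funext => k.
case: K => [|K] /=.
  by move=> [c fc]; exists c => y y1; rewrite -fg// fc.
by move=> [h [fh Kh]]; exists h; split => // y y1; rewrite -fg// fh.
Qed.

Lemma expands_bounded K f a : expands K f a -> exists c : R, forall y, 1 <= y -> `|f y| <= c%:C.
Proof.
elim: K f a => [//|K IH] f a [g [fg Kg]].
have [c gc] := IH g (fun k => a k.+1) Kg.
exists (Normc.normc (a 0%N) + c) => y y1; rewrite fg// rmorphD.
apply: le_trans (ler_normD _ _) _; apply: lerD => //.
rewrite normrM; apply: le_trans (gc y y1).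
by rewrite -[leRHS]mul1r ler_wpM2r// uax_norm_le1.
Qed.

Lemma expandsW K f a : expands K.+1 f a -> expands K f a.
Proof.
elim: K f a => [|K IH] f a; first exact: expands_bounded.
by move=> [g [fg Kg]]; exists g; split => //; exact: IH g (fun k => a k.+1) Kg.
Qed.

Lemma expands_cst K c : expands K (fun=> c) (fun k => if k is 0%N then c else 0).
Proof.
case: K => [|K]; first by exists (Normc.normc c).
exists (fun=> 0); split; first by move=> y _; rewrite mulr0 addr0.
elim: K => [|K IH]; first by exists 0 => y _; rewrite normr0.
by exists (fun=> 0); split => // y _; rewrite mulr0 addr0.
Qed.

Lemma expandsD K f g a b : expands K f a -> expands K g b ->
  expands K (fun y => f y + g y) (fun k => a k + b k).
Proof.
elim: K f g a b => [|K IH] f g a b.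
  move=> [c fc] [e ge]; exists (c + e) => y y1; rewrite rmorphD.
  by apply: le_trans (ler_normD _ _) _; apply: lerD; [exact: fc|exact: ge].
move=> [f' [ff' Kf]] [g' [gg' Kg]]; exists (fun y => f' y + g' y); split.
  by move=> y y1; rewrite ff'// gg'//; ring.
exact: IH.
Qed.

Lemma expands_shift K f a : expands K f a ->
  expands K.+1 (fun y => uax y * f y) (fun k => if k is k'.+1 then a k' else 0).
Proof. by move=> Kf; exists f; split => // y _; rewrite add0r. Qed.

Definition conv a b k : C := \sum_(i < k.+1) a i * b (k - i)%N.

Lemma convS a b k : conv a b k.+1 = a 0%N * b k.+1 + conv (fun i => a i.+1) b k.
Proof. by rewrite /conv big_ord_recl /= subn0. Qed.

Lemma expandsZ K c f a : expands K f a -> expands K (fun y => c * f y) (fun k => c * a k).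
Proof.
elim: K f a => [|K IH] f a.
  move=> [e fe]; exists (Normc.normc c * e) => y y1.
  by rewrite normrM rmorphM; apply: ler_wpM2l; [exact: normr_ge0|exact: fe].
move=> [g [fg Kg]]; exists (fun y => c * g y); split; last exact: IH.
by move=> y y1; rewrite fg//; ring.
Qed.

Lemma expandsM K f g a b : expands K f a -> expands K g b ->
  expands K (fun y => f y * g y) (conv a b).
Proof.
elim: K f g a b => [|K IH] f g a b.
  move=> [c fc] [e ge]; exists (c * e) => y y1; rewrite normrM rmorphM.
  by apply: ler_pM => //; [exact: fc|exact: ge].
move=> [f' [ff' Kf]] Kg; have Kg' := expandsW Kg; case: Kg => [g' [gg' Kg]].
exists (fun y => a 0%N * g' y + f' y * g y); split.
  by move=> y y1; rewrite {1}ff'// {1}gg'// /conv big_ord1 subnn (gg' y y1); ring.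
apply: expands_eq (expandsD (expandsZ (a 0%N) Kg) (IH _ _ _ _ Kf Kg')) => // k.
by rewrite convS.
Qed.

Lemma expandsB K f g a b : expands K f a -> expands K g b ->
  expands K (fun y => f y - g y) (fun k => a k - b k).
Proof.
move=> Kf Kg; apply: expands_eq (expandsD Kf (expandsZ (-1) Kg)) => [y _|k];
by rewrite mulN1r.
Qed.

Variables (p s t : nat -> nat -> C).
Hypothesis p00 : p 0%N 0%N = 1.
Hypothesis pS : forall k, p 0%N k.+1 = p 1%N k + t 1%N k.
Hypothesis p_rel : forall j k, state_rel (p 0%N) (t 1%N) p j k = 0.
Hypothesis s_rel : forall j k, state_rel (p 0%N) (t 1%N) s j k = 0.
Hypothesis t_rel : forall l k, mixed_rel (p 0%N) (t 1%N) t l k = t l k.+1.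

Variables (Phi X T : nat -> R -> C).
(** By [pS], 1 + u D is the generating function of the moments p 0 k; this is where the scalar h i
    of the recursion enters the functional equations. *)
Let D y := Phi 1%N y + T 1%N y.
Hypothesis boundPhi : forall j, expands 0 (Phi j) (p j).
Hypothesis boundX : forall j, expands 0 (X j) (s j).
Hypothesis boundT : forall j, expands 0 (T j) (t j).
Hypothesis PhiE : forall j y, 1 <= y -> Phi j y = p j 0%N + uax y *
  (Phi j.+1 y + T 1%N y * Phi j y - D y * (Phi j y - p j 0%N - uax y * Phi j.+1 y)).
Hypothesis XE : forall j y, 1 <= y -> X j y = s j 0%N + uax y *
  (X j.+1 y + T 1%N y * X j y - D y * (X j y - s j 0%N - uax y * X j.+1 y)).
Hypothesis TE : forall l y, 1 <= y -> T l y = t l 0%N + uax y *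
  (D y * t l 0%N + (1 + uax y * D y) * T l.+1 y - T 1%N y * T l y).

(** The coefficient of u^k in the bracket of [PhiE] and [XE]: replacing h i for i >= 1 through [pS]
    turns the relation into convolutions with the coefficients of [D]. *)
Let state_coef (f : nat -> nat -> C) j k : state_rel (p 0%N) (t 1%N) f j k = 0 ->
  f j.+1 k + conv (t 1%N) (f j) k
   - conv (fun k => p 1%N k + t 1%N k)
       (fun k => f j k - (if k is 0%N then f j 0%N else 0) - (if k is k'.+1 then f j.+1 k' else 0)) k
  = f j k.+1.
Proof.
rewrite /state_rel sumrB big_ord_recl /= p00 !subn0 mul1r => /eqP; rewrite subr_eq0 => /eqP E.
have -> : f j k.+1 = f j.+1 k + conv (t 1%N) (f j) k -
    \sum_(i < k) p 0%N (bump 0 i) * (f j (k - bump 0 i).+1 - f j.+1 (k - bump 0 i)%N).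
  by rewrite /conv -E; ring.
congr (_ - _); rewrite /conv big_ord_recr /= subnn subrr subr0 mulr0 addr0.
apply: eq_bigr => i _; have ik := ltn_ord i; rewrite /bump add1n pS subnSK//.
by rewrite -(subnSK ik) subr0.
Qed.

(** A bootstrap on the order, for all j at once: if every function expands to order K, so do the
    brackets, and the prefactor u gains one order. The base case is mere boundedness. *)
Lemma expands_all K j : [/\ expands K (Phi j) (p j), expands K (X j) (s j) & expands K (T j) (t j)].
Proof.
elim: K j => [|K IH] j; first by split.
have KPhi i : expands K (Phi i) (p i) by case: (IH i).
have KX i : expands K (X i) (s i) by case: (IH i).
have KT i : expands K (T i) (t i) by case: (IH i).
have KD : expands K D (fun k => p 1%N k + t 1%N k) by exact: expandsD.
have Kstate (F : nat -> R -> C) (f : nat -> nat -> C) : (forall i, expands K (F i) (f i)) ->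
    (forall k, state_rel (p 0%N) (t 1%N) f j k = 0) ->
    expands K (fun y => F j.+1 y + T 1%N y * F j y - D y * (F j y - f j 0%N - uax y * F j.+1 y))
      (fun k => f j k.+1).
  move=> KF frel.
  have KS := expandsW (expands_shift (KF j.+1)).
  have Kd := expandsB (expandsB (KF j) (expands_cst K (f j 0%N))) KS.
  have := expandsB (expandsD (KF j.+1) (expandsM (KT 1%N) (KF j))) (expandsM KD Kd).
  by apply: expands_eq => // k; exact: state_coef.
split.
- exists (fun y => Phi j.+1 y + T 1%N y * Phi j y - D y * (Phi j y - p j 0%N - uax y * Phi j.+1 y)).
  by split; [exact: PhiE|exact: Kstate].
- exists (fun y => X j.+1 y + T 1%N y * X j y - D y * (X j y - s j 0%N - uax y * X j.+1 y)).
  by split; [exact: XE|exact: Kstate].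
exists (fun y => D y * t j 0%N + (1 + uax y * D y) * T j.+1 y - T 1%N y * T j y).
split; first exact: TE.
have KG : expands K (fun y => 1 + uax y * D y) (p 0%N).
  apply: expands_eq (expandsD (expands_cst K 1) (expandsW (expands_shift KD))) => // -[|k].
    by rewrite addr0 p00.
  by rewrite add0r pS.
have := expandsB (expandsD (expandsZ (t j 0%N) KD) (expandsM KG (KT j.+1)))
  (expandsM (KT 1%N) (KT j)).
apply: expands_eq => [y _|k]; first by rewrite [t j 0%N * _]mulrC.
by rewrite -t_rel /mixed_rel pS /conv sumrB; ring.
Qed.

End Expansions.

(** * Cauchy transforms and moments *)

Section CauchyTransform.
Local Open Scope complex_scope.
Variables (R : realType) (mu : probability R R).
Local Notation C := R[i].

Definition rintegrable (f : R -> R) : Prop := mu.-integrable setT (EFin \o f).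

Lemma rintegrableD (f g : R -> R) : rintegrable f -> rintegrable g -> rintegrable (fun x => f x + g x).
Proof. exact: integrableD. Qed.

Lemma rintegrableZ (c : R) (f : R -> R) : rintegrable f -> rintegrable (fun x => c * f x).
Proof. exact: integrableZl. Qed.

Lemma rintegrable_cst c : rintegrable (fun=> c).
Proof.
apply: measurable_bounded_integrable => //.
  by rewrite -ge0_fin_numE// fin_num_measure.
by exists `|c|; split; [exact: num_real|move=> x cx w _; exact: ltW].
Qed.

Lemma rintegrable_le (f g : R -> R) : measurable_fun setT f -> (forall x, `|f x| <= `|g x|) -> rintegrable g -> rintegrable f.
Proof.
move=> mf fg; apply: le_integrable => //; first exact/measurable_EFinP.
by move=> x _; rewrite lee_fin.
Qed.

Lemma RintD (f g : R -> R) : rintegrable f -> rintegrable g -> \int[mu]_x (f x + g x) = \int[mu]_x f x + \int[mu]_x g x.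
Proof. by move=> hf hg; rewrite RintegralD. Qed.

Lemma RintZ (c : R) (f : R -> R) : rintegrable f -> \int[mu]_x (c * f x) = c * \int[mu]_x f x.
Proof. by move=> hf; rewrite RintegralZl. Qed.

Lemma Rint_cst (c : R) : \int[mu]_x c = c.
Proof.
by rewrite Rintegral_cst//; have /= -> := @probability_setT _ _ _ mu; rewrite mulr1.
Qed.

Lemma Rint_le (f g : R -> R) : rintegrable f -> rintegrable g -> (forall x, f x <= g x) ->
  \int[mu]_x f x <= \int[mu]_x g x.
Proof. by move=> hf hg fg; apply: le_Rintegral. Qed.

(** Were the integral 0, f would vanish almost everywhere, so the whole space, where f > 0, would be
    null for a probability measure. *)
Lemma Rint_gt0 (f : R -> R) : rintegrable f -> (forall x, 0 < f x) -> 0 < \int[mu]_x f x.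
Proof.
move=> hf f0; rewrite lt_neqAle Rintegral_ge0 ?andbT => [|x _]; last exact: ltW.
apply/eqP => E; have : (\int[mu]_x `|(f x)%:E| = 0)%E.
  under eq_integral => x _ do rewrite gee0_abs ?lee_fin ?(ltW (f0 x))//.
  rewrite -[LHS]fineK; last exact: (integrable_fin_num measurableT hf).
  by rewrite -[fine _]/(\int[mu]_x f x) -E.
move/(ae_eq_integral_abs mu measurableT (measurable_int mu hf)) => [N [mN N0 sN]].
have : setT `<=` N.
  by move=> x _; apply: sN => /= /(_ I) [fx0]; have := f0 x; rewrite fx0 ltxx.
rewrite subTset => NT; move: N0; rewrite NT => h.
have := @probability_setT _ _ _ mu; rewrite /= h => /eqP.
by rewrite eqe eq_sym oner_eq0.
Qed.

Definition ckernel (w : C) (x : R) : C := (w - x%:C)^-1.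
Definition kden (w : C) (x : R) : R := (complex.Re w - x) ^+ 2 + complex.Im w ^+ 2.

Lemma Re_ckernel w x : complex.Re (ckernel w x) = (complex.Re w - x) / kden w x.
Proof. by rewrite /ckernel /kden; case: w => a b /=; rewrite subr0. Qed.

Lemma Im_ckernel w x : complex.Im (ckernel w x) = - complex.Im w / kden w x.
Proof. by rewrite /ckernel /kden; case: w => a b /=; rewrite subr0 mulNr. Qed.

Section UpperHalfPlane.
Variable w : C.
Hypothesis w0 : uhp w.

Let b0 : 0 < complex.Im w. Proof. exact: w0. Qed.

Lemma kden_gt0 x : 0 < kden w x.
Proof. by rewrite ltr_wpDl ?sqr_ge0// exprn_gt0. Qed.

Lemma sub_uhp_neq0 x : w - x%:C != 0.
Proof.
apply/eqP => /(congr1 (@complex.Im R)); move: b0; case: (w) => a b /= b1.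
by rewrite subr0 => b2; move: b1; rewrite b2 ltxx.
Qed.

Lemma ckernel_norm x : `|ckernel w x| <= ((complex.Im w)^-1)%:C.
Proof.
rewrite normfV fmorphV lef_pV2 ?posrE ?normr_gt0 ?sub_uhp_neq0 ?ltcR//.
have -> : complex.Im w = complex.Im (w - x%:C) by case: (w) => a b /=; rewrite subr0.
rewrite -[complex.Im _]gtr0_norm.
  by have := @normIm_le R (w - x%:C) (Normc.normc (w - x%:C)) (lexx _); rewrite -lecR.
by move: b0; case: (w) => a b /=; rewrite subr0.
Qed.

Lemma kden_continuous : continuous (kden w).
Proof.
move=> x; rewrite /kden; apply: cvgD; last exact: cvg_cst.
rewrite (_ : (fun _ => _) = (fun x => (complex.Re w - x) * (complex.Re w - x))); last first.
  by apply/funext => y; rewrite expr2.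
by apply: cvgM; apply: cvgB => //; exact: cvg_cst.
Qed.

Lemma measurable_kdenV : measurable_fun setT (fun x => (kden w x)^-1).
Proof.
apply: continuous_measurable_fun => x.
by apply: cvgV; [rewrite gt_eqF// kden_gt0|exact: kden_continuous].
Qed.

Lemma measurable_pow (k : nat) : measurable_fun setT (fun x : R => x ^+ k).
Proof. exact: exprn_measurable. Qed.

Lemma rintegrable_kernel (j : nat) : rintegrable (fun x => x ^+ j) ->
  rintegrable (fun x => x ^+ j * complex.Re (ckernel w x)) /\
  rintegrable (fun x => x ^+ j * complex.Im (ckernel w x)).
Proof.
move=> hj.
have bd (g : R -> R) : measurable_fun setT g -> (forall x, `|g x| <= (complex.Im w)^-1) ->
    rintegrable (fun x => x ^+ j * g x).
  move=> mg gb; apply: (@rintegrable_le _ (fun x => (complex.Im w)^-1 * x ^+ j)).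
  - by apply: measurable_funM => //; exact: measurable_pow.
  - move=> x; rewrite !normrM mulrC; apply: ler_wpM2r => //.
    by apply: le_trans (gb x) _; exact: ler_norm.
  - exact: rintegrableZ.
split; apply: bd => [|x].
- under eq_fun do rewrite Re_ckernel; apply: measurable_funM measurable_kdenV.
  by apply: measurable_funB => //; exact: measurable_cst.
- exact: normRe_le (ckernel_norm x).
- by under eq_fun do rewrite Im_ckernel; apply: measurable_funM measurable_kdenV; exact: measurable_cst.
- exact: normIm_le (ckernel_norm x).
Qed.

Definition cint (j : nat) : C :=
  (\int[mu]_x (x ^+ j * complex.Re (ckernel w x))) +i*
  (\int[mu]_x (x ^+ j * complex.Im (ckernel w x))).

Lemma cint0 : cint 0 = Defs.cauchy mu w.
Proof.
rewrite /cint /Defs.cauchy /Rintegral; congr (fine _ +i* fine _);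
by apply: eq_integral => x _; rewrite expr0 mul1r.
Qed.

Lemma cint_bound j : rintegrable (fun x => x ^+ j) ->
  `|cint j| <= (2 * (\int[mu]_x `|x ^+ j|) / complex.Im w)%:C.
Proof.
move=> hj; have [h1 h2] := rintegrable_kernel hj.
have hn : rintegrable (fun x => `|x ^+ j|) by exact: integrable_norm.
have bd (g : R -> R) : rintegrable (fun x => x ^+ j * g x) -> (forall x, `|g x| <= (complex.Im w)^-1) ->
    `|\int[mu]_x (x ^+ j * g x)| <= (\int[mu]_x `|x ^+ j|) / complex.Im w.
  move=> hg gb; apply: le_trans (le_normr_Rintegral _ hg) _ => //.
  rewrite mulrC -RintZ//; apply: Rint_le; [exact: integrable_norm|exact: rintegrableZ|].
  by move=> x; rewrite normrM mulrC; apply: ler_wpM2r.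
have b1 := bd _ h1 (fun x => normRe_le (ckernel_norm x)).
have b2 := bd _ h2 (fun x => normIm_le (ckernel_norm x)).
rewrite (complexE (cint j)) /=; apply: le_trans (ler_normD _ _) _.
rewrite normrM complexiE normCi mul1r.
have nr (r : R) : `|r%:C| = `|r|%:C :> C by rewrite normc_def /= expr0n addr0 sqrtr_sqr.
rewrite !nr -rmorphD lecR; lra.
Qed.

(** Multiply x / (w - x) = w / (w - x) - 1 by x^j and integrate; every functional equation for the
    transforms is derived from this identity. *)
Lemma cintS j : rintegrable (fun x => x ^+ j) ->
  cint j.+1 = w * cint j - (\int[mu]_x x ^+ j)%:C.
Proof.
move=> hj; have [h1 h2] := rintegrable_kernel hj.
have ker x : w * ckernel w x = 1 + x%:C * ckernel w x.
  rewrite -[X in _ = X + _](divff (sub_uhp_neq0 x)) -mulrDl; congr (_ * _); ring.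
have kerR x : complex.Re w * complex.Re (ckernel w x) - complex.Im w * complex.Im (ckernel w x)
    = 1 + x * complex.Re (ckernel w x).
  by have := congr1 (@complex.Re R) (ker x); rewrite ReD !ReM /= mul0r subr0.
have kerI x : complex.Re w * complex.Im (ckernel w x) + complex.Im w * complex.Re (ckernel w x)
    = x * complex.Im (ckernel w x).
  by have := congr1 (@complex.Im R) (ker x); rewrite ImD !ImM /= add0r mul0r addr0.
apply/eqP; rewrite eq_complex ReD ImD ReN ImN ReM ImM /= subr0; apply/andP; split; apply/eqP.
- rewrite -(RintZ _ h1) -mulNr -(RintZ _ h2) -(RintD (rintegrableZ _ h1) (rintegrableZ _ h2)).
  rewrite -[X in _ - X]mul1r -mulNr -(RintZ _ hj) -(RintD (rintegrableD (rintegrableZ _ h1) (rintegrableZ _ h2)) (rintegrableZ _ hj)).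
  apply: eq_Rintegral => x _; have := kerR x.
  rewrite exprSr -mulrA => E.
  have -> : x * complex.Re (ckernel w x) = complex.Re w * complex.Re (ckernel w x)
     - complex.Im w * complex.Im (ckernel w x) - 1 by rewrite E; ring.
  ring.
- rewrite -(RintZ _ h1) -(RintZ _ h2) -(RintD (rintegrableZ _ h2) (rintegrableZ _ h1)).
  apply: eq_Rintegral => x _; rewrite exprSr -mulrA -kerI; ring.
Qed.

Let ig1 : rintegrable (fun x => x ^+ 0).
Proof. by have := rintegrable_cst 1; congr rintegrable; apply/funext => x; rewrite expr0. Qed.

Lemma cauchy_Im_lt0 : complex.Im (Defs.cauchy mu w) < 0.
Proof.
have [_ h] := rintegrable_kernel ig1.
rewrite -cint0 /= -oppr_gt0 -mulN1r -RintZ//; apply: Rint_gt0; first exact: rintegrableZ.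
move=> x; rewrite expr0 mul1r mulN1r Im_ckernel mulNr opprK divr_gt0//.
exact: kden_gt0.
Qed.

Lemma cauchy_neq0 : Defs.cauchy mu w != 0.
Proof. by apply/eqP => E; have := cauchy_Im_lt0; rewrite E ltxx. Qed.

(* Jensen: |G(w)|^2 <= int |w - x|^-2 = - Im G(w) / Im w. *)
Lemma Ftr_Im_ge : complex.Im w <= complex.Im (Ftr mu w).
Proof.
have [h1 h2] := rintegrable_kernel ig1.
have G0 := cauchy_Im_lt0.
set G := Defs.cauchy mu w in G0 *.
have GE : G = cint 0 by rewrite cint0.
set r := complex.Re G; set s := complex.Im G in G0 *.
have rE : r = \int[mu]_x (x ^+ 0 * complex.Re (ckernel w x)) by rewrite /r GE.
have sE : s = \int[mu]_x (x ^+ 0 * complex.Im (ckernel w x)) by rewrite /s GE.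
have J : r ^+ 2 + s ^+ 2 <= - s / complex.Im w.
  have : 2 * r * r + 2 * s * s + (- (r ^+ 2 + s ^+ 2)) <= - (complex.Im w)^-1 * s.
    rewrite {2}rE {2}sE [in leRHS]sE -(RintZ (2 * r) h1) -(RintZ (2 * s) h2).
    rewrite -(RintZ _ h2) -(RintD (rintegrableZ _ h1) (rintegrableZ _ h2)).
    rewrite -[- (r ^+ 2 + s ^+ 2)]Rint_cst -(RintD (rintegrableD (rintegrableZ _ h1) (rintegrableZ _ h2)) (rintegrable_cst _)).
    apply: Rint_le; [|exact: rintegrableZ|].
      by apply: rintegrableD (rintegrable_cst _); apply: rintegrableD; exact: rintegrableZ.
    move=> x; rewrite expr0 !mul1r.
    have -> : - (complex.Im w)^-1 * complex.Im (ckernel w x) =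
        complex.Re (ckernel w x) ^+ 2 + complex.Im (ckernel w x) ^+ 2.
      have k0 := kden_gt0 x; rewrite Im_ckernel Re_ckernel.
      have kE : kden w x = (complex.Re w - x) ^+ 2 + complex.Im w ^+ 2 by [].
      transitivity (kden w x / kden w x ^+ 2).
        by field; rewrite !gt_eqF.
      by rewrite {1}kE; field; rewrite !gt_eqF.
    set a := complex.Re _; set c := complex.Im _.
    have := sqr_ge0 (a - r); have := sqr_ge0 (c - s); rewrite !sqrrB; lra.
  rewrite mulNr mulrC mulNr; lra.
have q0 : 0 < r ^+ 2 + s ^+ 2 by rewrite ltr_wpDl ?sqr_ge0// exprn_even_gt0//= lt_eqF.
have -> : complex.Im (Ftr mu w) = - s / (r ^+ 2 + s ^+ 2).
  by rewrite /Ftr -/G /r /s; case: (G) => a c /=; rewrite mulNr.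
by rewrite ler_pdivlMr// mulrC -ler_pdivlMr.
Qed.

End UpperHalfPlane.
End CauchyTransform.

(** * Moments recovered from an expansion along the imaginary axis *)

Section Hamburger.
Local Open Scope complex_scope.
Variables (R : realType) (rho : probability R R).
Local Notation C := R[i].
Local Notation rintegrable := (rintegrable rho).
Implicit Types x y : R.

Lemma cvg_eqlim (f : nat -> R) (l l' : R) : l' = l -> f @ \oo --> l' -> f @ \oo --> l.
Proof. by move=> ->. Qed.

Lemma uhp_axis y : 1 <= y -> uhp (axis y).
Proof. by move=> y1; rewrite /uhp /=; exact: lt_le_trans y1. Qed.

Definition Jmom k (y : R) : C := axis y * cint rho (axis y) k.

Lemma Jmom_step k y : 1 <= y -> rintegrable (fun x => x ^+ k) ->
  Jmom k y = (\int[rho]_x x ^+ k)%:C + uax y * Jmom k.+1 y.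
Proof.
move=> y1 hk; rewrite /Jmom (cintS (uhp_axis y1) hk) /uax mulrA mulVf ?axis_neq0//.
ring.
Qed.

(* The real part of iy/(iy - x). *)
Definition damp (y x : R) : R := y ^+ 2 / (x ^+ 2 + y ^+ 2).

Lemma damp_den y x : 1 <= y -> 0 < x ^+ 2 + y ^+ 2.
Proof. by move=> y1; rewrite ltr_wpDl ?sqr_ge0// exprn_gt0// (lt_le_trans ltr01). Qed.

Lemma damp_ge0 y x : 1 <= y -> 0 <= damp y x.
Proof. by move=> y1; rewrite divr_ge0 ?sqr_ge0// ltW// damp_den. Qed.

Lemma damp_le1 y x : 1 <= y -> damp y x <= 1.
Proof. by move=> y1; rewrite ler_pdivrMr ?damp_den// mul1r lerDr sqr_ge0. Qed.

Lemma damp_mono y y' x : 1 <= y -> y <= y' -> damp y x <= damp y' x.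
Proof.
move=> y1 yy'; have y'1 := le_trans y1 yy'; have y0 := le_trans ler01 y1.
rewrite /damp ler_pdivrMr ?damp_den// mulrAC ler_pdivlMr ?damp_den//.
have : y ^+ 2 * x ^+ 2 <= y' ^+ 2 * x ^+ 2.
  by apply: ler_wpM2r; rewrite ?sqr_ge0// lerXn2r// nnegrE// (le_trans ler01).
lra.
Qed.

Lemma damp_cvg x : (fun n : nat => damp n.+1%:R x) @ \oo --> (1 : R).
Proof.
have E n : damp n.+1%:R x = 1 - x ^+ 2 / (x ^+ 2 + n.+1%:R ^+ 2).
  have d0 : 0 < x ^+ 2 + n.+1%:R ^+ 2 by apply: damp_den; rewrite ler1n.
  by move: d0; rewrite /damp; move: (n.+1%:R : R) => N d0; field; rewrite gt_eqF.
under eq_fun do rewrite E.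
apply: cvg_eqlim (subr0 1) _; apply: cvgB; first exact: cvg_cst.
apply: (@squeeze_cvgr _ _ _ _ (fun=> 0) (fun n => x ^+ 2 * harmonic n)).
- apply: nearW => n; have n1 : 0 < n.+1%:R :> R by rewrite ltr0Sn.
  have d0 : 0 < x ^+ 2 + n.+1%:R ^+ 2 by apply: damp_den; rewrite ler1n.
  rewrite divr_ge0 ?sqr_ge0 ?(ltW d0)//=; apply: ler_wpM2l; first exact: sqr_ge0.
  rewrite lef_pV2 ?posrE//; apply: le_trans (_ : n.+1%:R ^+ 2 <= _).
    by rewrite expr2 -[leLHS]mulr1 ler_wpM2l// ler1n.
  by rewrite lerDr sqr_ge0.
- exact: cvg_cst.
- apply: cvg_eqlim (mulr0 (x ^+ 2)) _; apply: cvgMr; exact: cvg_harmonic.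
Qed.

Lemma measurable_damp y : 1 <= y -> measurable_fun setT (damp y).
Proof.
move=> y1; have h := measurable_kdenV (uhp_axis y1).
have -> : damp y = fun x => y ^+ 2 * (kden (axis y) x)^-1.
  by apply/funext => x; rewrite /damp /kden /= sub0r sqrrN.
by apply: measurable_funM => //; exact: measurable_cst.
Qed.

Lemma Re_Jmom k y : 1 <= y -> rintegrable (fun x => x ^+ k) ->
  rintegrable (fun x => x ^+ k * damp y x) /\
  complex.Re (Jmom k y) = \int[rho]_x (x ^+ k * damp y x).
Proof.
move=> y1 hk; have [_ h] := rintegrable_kernel (uhp_axis y1) hk.
have E : (fun x => x ^+ k * damp y x) =
    (fun x => (- y) * (x ^+ k * complex.Im (ckernel (axis y) x))).
  apply/funext => x; rewrite Im_ckernel /damp /kden /= sub0r sqrrN; ring.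
rewrite E; split; first exact: rintegrableZ.
by rewrite /Jmom ReM /= mul0r sub0r (RintZ _ h) mulNr.
Qed.

Lemma Re_Jmom_cvg k : rintegrable (fun x => x ^+ k) ->
  (fun n : nat => complex.Re (Jmom k n.+1%:R)) @ \oo --> \int[rho]_x x ^+ k.
Proof.
move=> hk.
have n1 n : 1 <= n.+1%:R :> R by rewrite ler1n.
have E n : complex.Re (Jmom k n.+1%:R) = \int[rho]_x (x ^+ k * damp n.+1%:R x).
  by case: (Re_Jmom (n1 n) hk).
under eq_fun do rewrite E.
have := @dominated_cvg _ _ R rho setT measurableT
  (fun n x => (x ^+ k * damp n.+1%:R x)%:E) (fun x => (x ^+ k)%:E) (fun x => `|(x ^+ k)%:E|%E).
move=> H; apply: fine_cvg; rewrite fineK; last exact: (integrable_fin_num measurableT hk).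
apply: H => //.
- move=> n; apply/measurable_EFinP; apply: measurable_funM; first exact: measurable_pow.
  exact: measurable_damp.
- move=> x _; apply: cvg_EFin; first by apply: nearW.
  apply: cvg_eqlim (mulr1 _) _; apply: cvgMr; exact: damp_cvg.
- exact: (integrable_norm hk).
- move=> n x _ /=; rewrite lee_fin normrM -[leRHS]mulr1 ler_wpM2l//.
  by rewrite ger0_norm ?damp_ge0// damp_le1.
Qed.

Lemma expands_Re_cvg (f : R -> C) (a : nat -> C) : expands 1 f a ->
  (fun n : nat => complex.Re (f n.+1%:R)) @ \oo --> complex.Re (a 0%N).
Proof.
move=> [g [fg [c gc]]].
have n1 n : 1 <= n.+1%:R :> R by rewrite ler1n.
have E n : complex.Re (f n.+1%:R) = complex.Re (a 0%N) + complex.Re (uax n.+1%:R * g n.+1%:R).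
  by rewrite fg// ReD.
under eq_fun do rewrite E.
apply: cvg_eqlim (addr0 _) _; apply: cvgD; first exact: cvg_cst.
apply: norm_cvg0.
apply: (@squeeze_cvgr _ _ _ _ (fun=> 0) (fun n => c * harmonic n)).
- apply: nearW => n; rewrite normr_ge0 /=; apply: normRe_le.
  rewrite normrM uax_norm// mulrC [(c * _)%:C]rmorphM; apply: ler_wpM2r; last exact: gc.
  by rewrite ler0c invr_ge0.
- exact: cvg_cst.
- apply: cvg_eqlim (mulr0 c) _; apply: cvgMr; exact: cvg_harmonic.
Qed.

Variable h : nat -> C.
Hypothesis h_real : forall k, complex.Im (h k) = 0.

(** The state of the induction. Carrying the shifted expansion of [Jmom k] makes the moment of order
    k its leading coefficient. *)
Definition moment_upto k : Prop :=
  [/\ rintegrable (fun x => x ^+ k), (\int[rho]_x x ^+ k)%:C = h k &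
    forall K, expands K (Jmom k) (fun i => h (k + i)%N)].

Lemma moment_of_expansion k : rintegrable (fun x => x ^+ k) ->
  (forall K, expands K (Jmom k) (fun i => h (k + i)%N)) -> moment_upto k.
Proof.
move=> hk ek; split => //.
have r := cvg_unique _ (Re_Jmom_cvg hk) (expands_Re_cvg (ek 1%N)).
rewrite addn0 in r.
by apply/eqP; rewrite eq_complex /= h_real eqxx andbT; apply/eqP; exact: r.
Qed.

(** Both [Jmom_step] and the expansion write [Jmom k] as the same constant plus u times a function;
    cancelling u identifies [Jmom k.+1] with the tail of the expansion. *)
Lemma moment_upto_step k : moment_upto k -> rintegrable (fun x => x ^+ k.+1) -> moment_upto k.+1.
Proof.
move=> [hk mk ek] hk1; apply: moment_of_expansion => // K.
have [g [fg Kg]] := ek K.+1.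
apply: expands_eq Kg => [y y1|i]; last by rewrite addnS.
have := fg y y1; rewrite (Jmom_step y1 hk) mk addn0 => /addrI /mulfI E; apply/esym/E.
by rewrite invr_neq0// axis_neq0.
Qed.

(* The second order term of the expansion bounds int x^(2n+2) y^2/(x^2+y^2)
   uniformly in y; let y go to infinity. *)
Lemma rintegrable_even_step n : moment_upto (2 * n) -> rintegrable (fun x => x ^+ (2 * n).+2).
Proof.
set k := (2 * n)%N => -[hk mk ek].
have [g1 [E1 [g2 [E2 [g3 [E3 [c c3]]]]]]] := ek 3%N.
set M := complex.Re (h (k + 2)) + c.
have n1 (N : nat) : 1 <= N.+1%:R :> R by rewrite ler1n.
have pos (N : nat) x : 0 <= x ^+ k.+2 * damp N.+1%:R x.
  by rewrite mulr_ge0 ?damp_ge0// /k -addn2 -mulnSr exprM exprn_ge0 ?sqr_ge0.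
have key (N : nat) : \int[rho]_x (x ^+ k.+2 * damp N.+1%:R x) <= M /\
    rintegrable (fun x => x ^+ k.+2 * damp N.+1%:R x).
  set y : R := N.+1%:R; have y1 : 1 <= y := n1 N.
  have y0 : 0 < y by exact: lt_le_trans y1.
  clearbody y.
  have [hd ReJ] := Re_Jmom y1 hk.
  (* x^2 times the damping factor is y^2 times one minus that factor, so a damped moment of order k
     + 2 is expressed through quantities of order k. *)
  have E : (fun x => x ^+ k.+2 * damp y x) =
      (fun x => y ^+ 2 * x ^+ k + (- y ^+ 2) * (x ^+ k * damp y x)).
    apply/funext => x; rewrite /damp !exprSr; have d0 := damp_den x y1.
    by field; rewrite gt_eqF.
  rewrite E (RintD (rintegrableZ _ hk) (rintegrableZ _ hd)) (RintZ _ hk) (RintZ _ hd) -ReJ.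
  split; last by apply: rintegrableD; exact: rintegrableZ.
  have uE : uax y = 0 -i* y^-1.
    rewrite /uax /axis /=; apply/eqP; rewrite eq_complex /= mul0r eqxx /=.
    by rewrite expr0n add0r; apply/eqP; field; rewrite gt_eqF.
  have mr : \int[rho]_x x ^+ k = complex.Re (h k) by rewrite -mk.
  have JE : Jmom k y = h k + uax y * h (k + 1)%N + uax y ^+ 2 * h (k + 2)%N
      + uax y ^+ 3 * g3 y.
    by rewrite E1// E2// E3// addn0; ring.
  (* u is purely imaginary and h real, so the first order term has no real part. After
     multiplication by y^2 the second order term yields Re h(k+2) and the third at most c / y <= c:
     this is the origin of [M]. *)
  have R1 : complex.Re (uax y * h (k + 1)%N) = 0.
    by rewrite uE ReM h_real /= mul0r mulr0 subr0.
  have R2 : complex.Re (uax y ^+ 2 * h (k + 2)%N) = - (y^-1 ^+ 2 * complex.Re (h (k + 2)%N)).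
    have -> : uax y ^+ 2 = (- y^-1 ^+ 2)%:C.
      by rewrite uE; apply/eqP; rewrite eq_complex /=; apply/andP; split; apply/eqP; ring.
    by rewrite ReM /= mul0r subr0 mulNr.
  have R3 : `|complex.Re (uax y ^+ 3 * g3 y)| <= y^-1 ^+ 3 * c.
    apply: normRe_le; rewrite normrM normrX uax_norm// rmorphM rmorphXn.
    by apply: ler_wpM2l; [rewrite exprn_ge0// ler0c invr_ge0 ltW|exact: c3].
  have c0 : 0 <= c by rewrite -ler0c; apply: le_trans (c3 y y1).
  rewrite JE 3!ReD R1 R2 addr0 mr.
  set q := complex.Re (_ * g3 y) in R3 *.
  have -> : y ^+ 2 * complex.Re (h k) + - y ^+ 2 *
     (complex.Re (h k) - y^-1 ^+ 2 * complex.Re (h (k + 2)%N) + q) =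
     complex.Re (h (k + 2)%N) - y ^+ 2 * q.
    by field; rewrite gt_eqF.
  rewrite /M lerD2l -mulrN; apply: le_trans (_ : y ^+ 2 * (y^-1 ^+ 3 * c) <= _).
    apply: ler_wpM2l; first exact: sqr_ge0.
    by apply: le_trans (ler_norm _) _; rewrite normrN.
  rewrite [X in X <= _](_ : _ = c / y); last by field; rewrite gt_eqF.
  by rewrite ler_pdivrMr// -[leLHS]mulr1 ler_wpM2l.
have mpow : measurable_fun setT (fun x : R => (x ^+ k.+2)%:E).
  by apply/measurable_EFinP; exact: measurable_pow.
apply/integrableP; split => //.
have cv := @cvg_monotone_convergence _ _ R rho setT measurableT
  (fun N x => (x ^+ k.+2 * damp N.+1%:R x)%:E).
under eq_integral => x _.
  rewrite gee0_abs; last first.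
    by rewrite lee_fin /k -addn2 -mulnSr exprM exprn_ge0 ?sqr_ge0.
  over.
apply: (@le_lt_trans _ _ M%:E); last by rewrite ltry.
have lim x : limn (fun N : nat => (x ^+ k.+2 * damp N.+1%:R x)%:E) = (x ^+ k.+2)%:E.
  apply: cvg_lim => //; apply: cvg_EFin; first exact: nearW.
  apply: cvg_eqlim (mulr1 _) _; apply: cvgMr; exact: damp_cvg.
have -> : (\int[rho]_x (x ^+ k.+2)%:E =
    \int[rho]_x limn (fun N : nat => (x ^+ k.+2 * damp N.+1%:R x)%:E))%E.
  by apply: eq_integral => x _; rewrite lim.
have {}cv : (\int[rho]_x (x ^+ k.+2 * damp N.+1%:R x)%:E @[N --> \oo] -->
    \int[rho]_x limn (fun N : nat => (x ^+ k.+2 * damp N.+1%:R x)%:E))%E.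
  apply: cv => [N|N x _|x _ N N' NN'].
  - apply/measurable_EFinP; apply: measurable_funM; first exact: measurable_pow.
    exact: measurable_damp.
  - by rewrite lee_fin.
  - rewrite lee_fin; apply: ler_wpM2l.
      by rewrite /k -addn2 -mulnSr exprM exprn_ge0 ?sqr_ge0.
    by apply: damp_mono => //; rewrite ler_nat.
apply: (cvge_to_le cv); apply: nearW => N; have [kb kig] := key N.
by rewrite -[leLHS]fineK ?lee_fin//; exact: (integrable_fin_num measurableT kig).
Qed.

Lemma hamburger_moments : (forall K, expands K (Jmom 0) h) ->
  forall k, rintegrable (fun x => x ^+ k) /\ \int[rho]_x x ^+ k = complex.Re (h k).
Proof.
move=> e0.
have ig0 : rintegrable (fun x => x ^+ 0) by exact: (rintegrable_cst rho 1).
have M0 : moment_upto 0 by exact: moment_of_expansion.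
have step n : moment_upto (2 * n) -> moment_upto (2 * n).+1 /\ moment_upto (2 * n.+1).
  move=> Mn; have hk2 := rintegrable_even_step Mn; have [hk _ _] := Mn.
  (* The odd power is dominated by its two even neighbours, since |x| <= 1 + x^2. *)
  have hk1 : rintegrable (fun x => x ^+ (2 * n).+1).
    apply: (@rintegrable_le _ _ _ (fun x => x ^+ (2 * n) + x ^+ (2 * n).+2)).
    - exact: measurable_pow.
    - move=> x; rewrite !exprSr; set a := x ^+ (2 * n).
      have a0 : 0 <= a by rewrite /a exprM exprn_ge0// sqr_ge0.
      rewrite [leRHS]ger0_norm; last by rewrite addr_ge0// -mulrA mulr_ge0// -expr2 sqr_ge0.
      rewrite normrM (ger0_norm a0) -{2}[a]mulr1 -mulrA -mulrDr; apply: ler_wpM2l => //.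
      have := normr_ge0 x; have := sqr_ge0 (`|x| - 1); rewrite sqrrB1 real_normK ?num_real// expr2 mulr2n; lra.
    - exact: rintegrableD.
  have M1 := moment_upto_step Mn hk1.
  by split => //; rewrite mulnS; exact: moment_upto_step.
have Meven n : moment_upto (2 * n).
  by elim: n => [|n IH]; [rewrite muln0|case: (step n IH)].
have fin k : moment_upto k.
  rewrite -[k]odd_double_half -mul2n; case: (odd k); last exact: Meven.
  by rewrite add1n; case: (step _ (Meven k./2)).
by move=> k; have [hk <- _] := fin k.
Qed.

End Hamburger.

(** * Functional equations for the subordinated transforms *)

Section SubordinationExpansion.
Local Open Scope complex_scope.
Variables (R : realType) (mu1 nu1 mu2 : probability R R) (w1 w2 : R[i] -> R[i]).
Local Notation C := R[i].
Hypothesis sub12 : subordination mu1 mu2 w1 w2.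
Hypothesis m1 : forall k : nat, rintegrable mu1 (fun x => x ^+ k).
Hypothesis n1 : forall k : nat, rintegrable nu1 (fun x => x ^+ k).
Hypothesis m2 : forall k : nat, rintegrable mu2 (fun x => x ^+ k).

(** Im w2 = Im z + (Im F_mu1(w1) - Im w1), and the bracket is nonnegative by [Ftr_Im_ge]; since
    F_mu1(w1) = F_mu2(w2), the same holds with the indices exchanged. *)
Lemma subordination_Im z : uhp z ->
  complex.Im z <= complex.Im (w1 z) /\ complex.Im z <= complex.Im (w2 z).
Proof.
move=> z0; have [uw _ _ eq12] := sub12; have [u1 u2] := uw z z0.
have [F12 sumw] := eq12 z z0.
have I1 := Ftr_Im_ge mu1 u1; have I2 := Ftr_Im_ge mu2 u2.
have := congr1 (@complex.Im R) sumw; rewrite !ImD => E.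
rewrite F12 in I1 E; split; last by move: I1; rewrite -F12 in E *; move: E; lra.
by move: E I2; lra.
Qed.

Variables (p s t : nat -> nat -> C).
Hypotheses (p0 : forall j, p j 0%N = (\int[mu1]_x x ^+ j)%:C).
Hypotheses (s0 : forall j, s j 0%N = (\int[nu1]_x x ^+ j)%:C).
Hypotheses (t0 : forall j, t j 0%N = (\int[mu2]_x x ^+ j)%:C).
Hypothesis pS : forall k, p 0%N k.+1 = p 1%N k + t 1%N k.
Hypothesis p_rel : forall j k, state_rel (p 0%N) (t 1%N) p j k = 0.
Hypothesis s_rel : forall j k, state_rel (p 0%N) (t 1%N) s j k = 0.
Hypothesis t_rel : forall l k, mixed_rel (p 0%N) (t 1%N) t l k = t l k.+1.

Let Phi j (y : R) := axis y * cint mu1 (w1 (axis y)) j.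
Let X j (y : R) := axis y * cint nu1 (w1 (axis y)) j.
Let T j (y : R) := axis y * cint mu2 (w2 (axis y)) j.

Let u1 y : 1 <= y -> uhp (w1 (axis y)).
Proof. by move=> y1; have [uw _ _ _] := sub12; case: (uw _ (uhp_axis y1)). Qed.
Let u2 y : 1 <= y -> uhp (w2 (axis y)).
Proof. by move=> y1; have [uw _ _ _] := sub12; case: (uw _ (uhp_axis y1)). Qed.

(** The factor |z| = y is compensated by the decay 1 / Im w of the transform, because Im w >= y. *)
Let scaled_bound (mu : probability R R) (w : R -> C) (f : nat -> nat -> C) j :
  (forall k : nat, rintegrable mu (fun x => x ^+ k)) -> (forall y, 1 <= y -> y <= complex.Im (w y)) ->
  expands 0 (fun y => axis y * cint mu (w y) j) (f j).
Proof.
move=> hm hw; exists (2 * \int[mu]_x `|x ^+ j|) => y y1.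
have y0 : 0 < y := lt_le_trans ltr01 y1.
have w0 : 0 < complex.Im (w y) := lt_le_trans y0 (hw y y1).
rewrite normrM axis_norm//; apply: le_trans (ler_wpM2l _ (cint_bound w0 (hm j))) _.
  by rewrite ler0c ltW.
have I0 : 0 <= \int[mu]_x `|x ^+ j| by apply: Rintegral_ge0.
rewrite -rmorphM lecR mulrA ler_pdivrMr// mulrC; apply: ler_wpM2l.
  exact: mulr_ge0.
exact: hw.
Qed.

Let subE y : 1 <= y ->
  [/\ cint mu1 (w1 (axis y)) 0 != 0,
     cint mu2 (w2 (axis y)) 0 = cint mu1 (w1 (axis y)) 0 &
     (w1 (axis y) + w2 (axis y)) * cint mu1 (w1 (axis y)) 0 =
       axis y * cint mu1 (w1 (axis y)) 0 + 1].
Proof.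
move=> y1; have [_ _ _ eq12] := sub12; have [F12 sumw] := eq12 _ (uhp_axis y1).
have g0 := cauchy_neq0 mu1 (u1 y1).
rewrite !cint0; split => //; first by move: F12; rewrite /Ftr => /invr_inj.
by rewrite sumw mulrDl /Ftr mulVf.
Qed.

Let mu_mass (mu : probability R R) : \int[mu]_x x ^+ 0 = 1 :> R.
Proof. by rewrite -[RHS](Rint_cst mu); apply: eq_Rintegral => x _; rewrite expr0. Qed.

(** Each first order transform is w G - 1, and (w1 + w2) G = z G + 1 for the common value G of the
    two Cauchy transforms. *)
Let D_E y : 1 <= y -> uax y * (Phi 1 y + T 1 y) =
  axis y * cint mu1 (w1 (axis y)) 0 - 1.
Proof.
move=> y1; have [g0 gE sumE] := subE y1; have z0 := axis_neq0 y1.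
rewrite /Phi /T /uax -mulrDr mulrA mulVf// mul1r.
rewrite (cintS (u1 y1) (m1 0)) (cintS (u2 y1) (m2 0)) !mu_mass gE.
have -> : w1 (axis y) * cint mu1 (w1 (axis y)) 0 - 1%:C +
   (w2 (axis y) * cint mu1 (w1 (axis y)) 0 - 1%:C) =
   (w1 (axis y) + w2 (axis y)) * cint mu1 (w1 (axis y)) 0 - 1 - 1 by rewrite rmorph1; ring.
rewrite sumE; ring.
Qed.

Let T1E y : 1 <= y -> T 1 y = axis y * ((axis y - w1 (axis y)) * cint mu1 (w1 (axis y)) 0).
Proof.
move=> y1; have [g0 gE sumE] := subE y1.
rewrite /T (cintS (u2 y1) (m2 0)) mu_mass gE rmorph1; congr (_ * _).
transitivity (axis y * cint mu1 (w1 (axis y)) 0 + 1 - w1 (axis y) * cint mu1 (w1 (axis y)) 0 - 1).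
  by rewrite -sumE; ring.
ring.
Qed.

(** The measure [mu] is arbitrary, evaluated at w1. With g = G_mu1(w1) and c the transform of order
    j, T 1 = z (z - w1) g and u D = z g - 1, so the right side collapses to z c. Hence mu1 and nu1
    share one equation, just as phi and s share one recursion. *)
Let state_eq (mu : probability R R) (f : nat -> nat -> C) j y :
  (forall k : nat, rintegrable mu (fun x => x ^+ k)) -> f j 0%N = (\int[mu]_x x ^+ j)%:C -> 1 <= y ->
  let F := fun i (y : R) => axis y * cint mu (w1 (axis y)) i in
  F j y = f j 0%N + uax y * (F j.+1 y + T 1 y * F j y
     - (Phi 1 y + T 1 y) * (F j y - f j 0%N - uax y * F j.+1 y)).
Proof.
move=> hm f0 y1 F; have z0 := axis_neq0 y1.
have uz : uax y * axis y = 1 by rewrite /uax mulVf.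
have DE := D_E y1; have TE := T1E y1.
have FS : F j.+1 y = axis y * (w1 (axis y) * cint mu (w1 (axis y)) j - f j 0%N).
  by rewrite /F (cintS (u1 y1) (hm j)) f0.
transitivity (f j 0%N + uax y * F j.+1 y + uax y * (T 1 y * F j y)
  - (uax y * (Phi 1 y + T 1 y)) * (F j y - f j 0%N - uax y * F j.+1 y)); last by ring.
rewrite DE TE FS /F.
set z := axis y in z0 uz *; set u := uax y in uz *; set g := cint mu1 _ _.
set c := cint mu _ _; set w := w1 z; set a := f j 0%N.
have E1 : u * (z * (w * c - a)) = w * c - a by rewrite mulrA uz mul1r.
have E2 : u * (z * ((z - w) * g) * (z * c)) = (z - w) * g * (z * c) by rewrite !mulrA uz mul1r.
rewrite E1 E2; ring.
Qed.

Let mixed_eq l y : 1 <= y -> T l y = t l 0%N + uax y *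
  ((Phi 1 y + T 1 y) * t l 0%N + (1 + uax y * (Phi 1 y + T 1 y)) * T l.+1 y - T 1 y * T l y).
Proof.
move=> y1; have z0 := axis_neq0 y1; have [g0 gE sumE] := subE y1.
have uz : uax y * axis y = 1 by rewrite /uax mulVf.
have DE := D_E y1.
transitivity (t l 0%N + uax y * (Phi 1 y + T 1 y) * t l 0%N
  + (1 + uax y * (Phi 1 y + T 1 y)) * (uax y * T l.+1 y) - uax y * (T 1 y * T l y)); last by ring.
rewrite DE.
rewrite /T (cintS (u2 y1) (m2 l)) (cintS (u2 y1) (m2 0)) mu_mass t0 gE rmorph1.
set z := axis y in z0 uz *; set u := uax y in uz *; set g := cint mu1 _ _.
set c := cint mu2 _ _; set w := w2 z; set a := (\int[_]_x _)%:C.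
have E1 : u * (z * (w * c - a)) = w * c - a by rewrite mulrA uz mul1r.
have E2 : u * (z * (w * g - 1) * (z * c)) = (w * g - 1) * (z * c).
  by rewrite !mulrA uz mul1r.
rewrite E1 E2; ring.
Qed.

Lemma subordination_expands K :
  expands K (fun y => axis y * Defs.cauchy mu1 (w1 (axis y))) (p 0%N) /\
  expands K (fun y => axis y * Defs.cauchy nu1 (w1 (axis y))) (s 0%N).
Proof.
have im1 y : 1 <= y -> y <= complex.Im (w1 (axis y)).
  by move=> y1; case: (subordination_Im (uhp_axis y1)).
have im2 y : 1 <= y -> y <= complex.Im (w2 (axis y)).
  by move=> y1; case: (subordination_Im (uhp_axis y1)).
have p00 : p 0%N 0%N = 1 by rewrite p0 mu_mass rmorph1.
have [h1 h2 _] := @expands_all R p s t p00 pS p_rel s_rel t_rel Phi X T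
  (fun j => scaled_bound p j m1 im1) (fun j => scaled_bound s j n1 im1)
  (fun j => scaled_bound t j m2 im2)
  (fun j y y1 => state_eq m1 (p0 j) y1) (fun j y y1 => state_eq n1 (s0 j) y1)
  mixed_eq K 0%N.
split; first by apply: expands_eq h1 => // y y1; rewrite /Phi cint0.
by apply: expands_eq h2 => // y y1; rewrite /X cint0.
Qed.

End SubordinationExpansion.

(** * Convergence of the moments *)

Section MomentLimits.
Local Open Scope complex_scope.
Variables (R : realType) (A B U : forall n : nat, 'M[R[i]]_n.+1).
Variable v : forall n : nat, 'cV[R[i]]_n.+1.
Local Notation C := R[i].
Variables (mu1 nu1 mu2 : probability R R).
Hypotheses (hA : forall n, is_hermitian (A n)) (hB : forall n, is_hermitian (B n)).
Hypothesis cA : cvg_moment (fun n k => esd_moment (A n) k) mu1.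
Hypothesis cv : cvg_moment (fun n k => spec_moment (A n) (v n) k) nu1.
Hypothesis cB : cvg_moment (fun n k => esd_moment (B n) k) mu2.
Hypothesis uU : forall n, Defs.is_unitary (U n).

(** Words contain only H and M. Powers of A are stored in the weight, which gains one factor A
    whenever M is rewritten as H - A. *)
Definition esd_weight j n : 'M[C]_n.+1 := ntr C n *m A n ^+ j.
Definition spec_weight j n : 'M[C]_n.+1 := v n *m cadj (v n) *m A n ^+ j.

Let M n : 'M[C]_n.+1 := U n *m B n *m cadj (U n).
Let H n : 'M[C]_n.+1 := A n + M n.

Hypothesis esd_defect : forall j k l,
  (fun n => Normc.normc (defect (H n) (M n) (esd_weight j n) (nseq k true ++ nseq l false)))
    @ \oo --> (0 : R).
Hypothesis spec_defect : forall j k,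
  (fun n => Normc.normc (defect (H n) (M n) (spec_weight j n) (nseq k true)))
    @ \oo --> (0 : R).

Let phi j k n : C := \tr (esd_weight j n *m H n ^+ k).
Let s j k n : C := \tr (spec_weight j n *m H n ^+ k).
Let t l k n : C := \tr (ntr C n *m (H n ^+ k *m M n ^+ l)).

Let tr_ntr n (W : 'M[C]_n.+1) : \tr (ntr C n *m W) = \tr W / n.+1%:R.
Proof. by rewrite /ntr mul_scalar_mx mxtraceZ mulrC. Qed.

Let hermitianM n : is_hermitian (M n).
Proof.
rewrite /is_hermitian /M !cadjM (hB n : cadj _ = _) mulmxA; congr (_ *m _ *m _).
by apply/matrixP => i j; rewrite !mxE; exact: conjCK.
Qed.

Let hermitianH n : is_hermitian (H n).
Proof. by rewrite /is_hermitian /H cadjD (hA n : cadj _ = _) (hermitianM n : cadj _ = _). Qed.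

Let conjB_pow n k : M n ^+ k = U n *m B n ^+ k *m cadj (U n).
Proof.
elim: k => [|k IH]; first by rewrite !expr0 mulmx1; exact/esym/uU.
rewrite exprS IH.
change (M n *m (U n *m B n ^+ k *m cadj (U n)) = U n *m B n ^+ k.+1 *m cadj (U n)).
have -> : M n *m (U n *m B n ^+ k *m cadj (U n)) =
    U n *m B n *m (cadj (U n) *m U n) *m B n ^+ k *m cadj (U n) by rewrite /M !mulmxA.
by rewrite unitary_cadjK// mulmx1 [in RHS]exprS !mulmxA.
Qed.

Let Im_div (z : C) n : complex.Im z = 0 -> complex.Im (z / n.+1%:R) = 0.
Proof.
move=> z0; rewrite -(rmorph_nat (real_complex R)) -fmorphV ImM z0 /=.
by rewrite mul0r mulr0 addr0.
Qed.

Let cvg_real (f : nat -> C) (l : R) : (forall n, complex.Im (f n) = 0) ->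
  (fun n => complex.Re (f n)) @ \oo --> l -> cvgC f l%:C.
Proof.
by move=> f0 fl; split => //; under eq_fun do rewrite f0; exact: cvg_cst.
Qed.

Let phi0 j : cvgC (phi j 0) (\int[mu1]_x x ^+ j)%:C.
Proof.
have E n : phi j 0 n = \tr (A n ^+ j) / n.+1%:R.
  by rewrite /phi /esd_weight expr0 mulmx1 tr_ntr.
apply: cvg_real => [n|]; first by rewrite E Im_div// hermitian_trace_real.
by under eq_fun do rewrite E; case: (cA j).
Qed.

Let spec_trace n (W : 'M[C]_n.+1) : \tr (v n *m cadj (v n) *m W) = (cadj (v n) *m (W *m v n)) 0 0.
Proof. by rewrite -mulmxA mxtrace_mulC -mulmxA /mxtrace big_ord1. Qed.

Let s0 j : cvgC (s j 0) (\int[nu1]_x x ^+ j)%:C.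
Proof.
have E n : s j 0 n = (cadj (v n) *m (A n ^+ j *m v n)) 0 0.
  by rewrite /s /spec_weight expr0 mulmx1 spec_trace.
apply: cvg_real => [n|]; first by rewrite E hermitian_form_real.
by under eq_fun do rewrite E; case: (cv j).
Qed.

Let t0 l : cvgC (t l 0) (\int[mu2]_x x ^+ l)%:C.
Proof.
have E n : t l 0 n = \tr (B n ^+ l) / n.+1%:R.
  rewrite /t expr0 mul1mx tr_ntr conjB_pow mxtrace_mulC mulmxA.
  by rewrite unitary_cadjK// mul1mx.
apply: cvg_real => [n|]; first by rewrite E Im_div// hermitian_trace_real.
by under eq_fun do rewrite E; case: (cB l).
Qed.

Let hE i n : \tr (ntr C n *m H n ^+ i) = phi 0 i n.
Proof. by rewrite /phi /esd_weight expr0 mulmx1. Qed.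

Let bE i n : \tr (ntr C n *m (H n ^+ i *m M n)) = t 1 i n.
Proof. by rewrite /t expr1. Qed.

Let hEf n : (fun i => \tr (ntr C n *m H n ^+ i)) = phi 0 ^~ n.
Proof. by apply/funext => i; exact: hE. Qed.

Let bEf n : (fun i => \tr (ntr C n *m (H n ^+ i *m M n))) = t 1 ^~ n.
Proof. by apply/funext => i; exact: bE. Qed.

Let powSr n k : A n ^+ k *m A n = A n ^+ k.+1.
Proof. exact/esym/exprSr. Qed.

Let phi_rel j k : cvgC (fun n => state_rel (phi 0 ^~ n) (t 1 ^~ n) (fun j i => phi j i n) j k) 0.
Proof.
have wA n : esd_weight j n *m A n = esd_weight j.+1 n by rewrite /esd_weight -mulmxA powSr.
have := cvgC_norm0 (esd_defect j k.+1 0); congr cvgC; apply/funext => n.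
rewrite cats0 (defect_state_rel (Q := esd_weight ^~ n) (M n) k (wA n)).
have E := f_equal2 (fun h b => state_rel h b (fun j i => phi j i n) j k) (hEf n) (bEf n).
exact E.
Qed.

Let s_rel j k : cvgC (fun n => state_rel (phi 0 ^~ n) (t 1 ^~ n) (fun j i => s j i n) j k) 0.
Proof.
have wA n : spec_weight j n *m A n = spec_weight j.+1 n by rewrite /spec_weight -mulmxA powSr.
have := cvgC_norm0 (spec_defect j k.+1); congr cvgC; apply/funext => n.
rewrite (defect_state_rel (Q := spec_weight ^~ n) (M n) k (wA n)).
have E := f_equal2 (fun h b => state_rel h b (fun j i => s j i n) j k) (hEf n) (bEf n).
exact E.
Qed.

Let t_rel l k :
  cvgC (fun n => mixed_rel (phi 0 ^~ n) (t 1 ^~ n) (fun j i => t j i n) l k - t l k.+1 n) 0.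
Proof.
have := cvgC_norm0 (esd_defect 0 k.+1 l); congr cvgC; apply/funext => n.
have -> : esd_weight 0 n = ntr C n by rewrite /esd_weight expr0 mulmx1.
rewrite defect_mixed_rel.
have E := f_equal2 (fun h b => mixed_rel h b (fun j i => t j i n) l k - t l k.+1 n) (hEf n) (bEf n).
exact E.
Qed.

Variables (rho kappa : probability R R) (w1 w2 : C -> C).
Hypothesis sub12 : subordination mu1 mu2 w1 w2.
Hypothesis Frho : forall z, uhp z -> Ftr rho z = Ftr mu1 (w1 z).
Hypothesis Fkappa : forall z, uhp z -> Ftr kappa z = Ftr nu1 (w1 z) + Ftr mu2 (w2 z) - Ftr rho z.

(** A deterministic statement, for one realisation of the U n along which the defects vanish. The
    approximate recursion first yields the existence of all limits; these satisfy it exactly and are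
    thereby the coefficients of the subordinated transforms. *)
Lemma moments_converge :
  cvg_moment (fun n k => esd_moment (H n) k) rho /\
  cvg_moment (fun n k => spec_moment (H n) (v n) k) kappa.
Proof.
have phi00 n : phi 0 0 n = 1.
  by rewrite -hE expr0 tr_ntr mxtrace1 divff// pnatr_eq0.
have phi_S k n : phi 0 k.+1 n = phi 1 k n + t 1 k n.
  have -> : phi 1 k n = \tr (H n ^+ k *m A n) / n.+1%:R.
    by rewrite /phi /esd_weight expr1 -mulmxA tr_ntr mxtrace_mulC.
  rewrite -hE -bE !tr_ntr -mulrDl -mxtraceD -mulmxDr; congr (\tr _ / _).
  exact: exprSr.
have lim j k := recursion_cvg phi00 (fun j => ex_intro _ _ (phi0 j))
  (fun j => ex_intro _ _ (s0 j)) (fun j => ex_intro _ _ (t0 j)) phi_rel s_rel t_rel j k.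
have limits (f : nat -> nat -> nat -> C) : (forall j k, exists l, cvgC (f j k) l) ->
    {q : nat -> nat -> C & forall j k, cvgC (f j k) (q j k)}.
  move=> cf; have [q hq] := choice (fun j => ex_intro _ _ (projT2 (choice (cf j)))).
  by exists q.
have [p cp] : {q : nat -> nat -> C & forall j k, cvgC (phi j k) (q j k)}.
  by apply: limits => j k; case: (lim j k).
have [s' cs] : {q : nat -> nat -> C & forall j k, cvgC (s j k) (q j k)}.
  by apply: limits => j k; case: (lim j k).
have [t' ct] : {q : nat -> nat -> C & forall j k, cvgC (t j k) (q j k)}.
  by apply: limits => j k; case: (lim j k).
have p0 j := cvgC_unique (cp j 0%N) (phi0 j).
have q0 j := cvgC_unique (cs j 0%N) (s0 j).
have r0 j := cvgC_unique (ct j 0%N) (t0 j).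
have pS k : p 0%N k.+1 = p 1%N k + t' 1%N k.
  apply: cvgC_unique (cp 0%N k.+1) _; have := cvgCD (cp 1%N k) (ct 1%N k).
  by congr cvgC; apply/funext => n; rewrite phi_S.
have prel j k : state_rel (p 0%N) (t' 1%N) p j k = 0.
  exact: cvgC_unique (cvgC_state_rel _ _ (cp 0%N) (ct 1%N) cp) (phi_rel j k).
have srel j k : state_rel (p 0%N) (t' 1%N) s' j k = 0.
  exact: cvgC_unique (cvgC_state_rel _ _ (cp 0%N) (ct 1%N) cs) (s_rel j k).
have trel l k : mixed_rel (p 0%N) (t' 1%N) t' l k = t' l k.+1.
  apply/eqP; rewrite -subr_eq0; apply/eqP.
  exact: cvgC_unique (cvgCB (cvgC_mixed_rel _ _ (cp 0%N) (ct 1%N) ct) (ct l k.+1)) (t_rel l k).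
have ex K := subordination_expands sub12 (fun k => (cA k).1) (fun k => (cv k).1)
  (fun k => (cB k).1) p0 q0 r0 pS prel srel trel K.
have Im_lim (f : nat -> C) l : (forall n, complex.Im (f n) = 0) -> cvgC f l -> complex.Im l = 0.
  move=> f0 [_]; rewrite (_ : (fun n => _) = fun=> 0); last exact/funext.
  by move=> fl; exact: (cvg_unique _ fl (cvg_cst 0)).
have phiE k n : phi 0 k n = \tr (H n ^+ k) / n.+1%:R by rewrite -hE tr_ntr.
have sE k n : s 0 k n = (cadj (v n) *m (H n ^+ k *m v n)) 0 0.
  by rewrite /s /spec_weight expr0 mulmx1 spec_trace.
have p_real k : complex.Im (p 0%N k) = 0.
  by apply: Im_lim (cp 0%N k) => n; rewrite phiE Im_div// hermitian_trace_real.
have s_real k : complex.Im (s' 0%N k) = 0.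
  by apply: Im_lim (cs 0%N k) => n; rewrite sE hermitian_form_real.
have [_ _ _ eq12] := sub12.
have rhoE y : 1 <= y -> Defs.cauchy rho (axis y) = Defs.cauchy mu1 (w1 (axis y)).
  by move=> y1; apply: invr_inj; exact: Frho (uhp_axis y1).
(* F_mu2(w2) = F_mu1(w1) = F_rho, so the last two terms in the formula for F_kappa cancel and
   F_nu1(w1) remains. *)
have kappaE y : 1 <= y -> Defs.cauchy kappa (axis y) = Defs.cauchy nu1 (w1 (axis y)).
  move=> y1; apply: invr_inj; have y0 := uhp_axis y1.
  rewrite -[LHS]/(Ftr kappa (axis y)) Fkappa// Frho//.
  by have [-> _] := eq12 _ y0; rewrite addrK.
have hr := hamburger_moments p_real (fun K => expands_eq
  (fun y y1 => congr1 (fun c => axis y * c) (etrans (esym (rhoE y y1)) (esym (cint0 rho (axis y)))))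
  (fun k => erefl _) (ex K).1).
have hk := hamburger_moments s_real (fun K => expands_eq
  (fun y y1 => congr1 (fun c => axis y * c) (etrans (esym (kappaE y y1)) (esym (cint0 kappa (axis y)))))
  (fun k => erefl _) (ex K).2).
split=> k.
  have [ik mk] := hr k; split; first exact: ik.
  rewrite -[fine _]/(\int[rho]_x x ^+ k) mk /esd_moment.
  by under eq_fun do rewrite -phiE; case: (cp 0%N k).
have [ik mk] := hk k; split; first exact: ik.
rewrite -[fine _]/(\int[kappa]_x x ^+ k) mk /spec_moment.
by under eq_fun do rewrite -sE; case: (cs 0%N k).
Qed.

End MomentLimits.

Lemma trbound_esd_weight (R : realType) (A : forall n : nat, 'M[R[i]]_n.+1) j n (kap : R) :
  1 <= kap -> opbound (A n) kap%:C%C -> trbound (esd_weight A j n) (kap ^+ j)%:C%C.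
Proof.
move=> kap1 Ak; have kap0 : 0 <= kap%:C%C by rewrite ler0c (le_trans ler01).
have := trboundMr (exprn_ge0 j kap0) (opbound_pow j kap0 Ak) (@trbound_scal _ n).
by rewrite mul1r -rmorphXn.
Qed.

Lemma trbound_spec_weight (R : realType) (A : forall n : nat, 'M[R[i]]_n.+1)
    (v : forall n : nat, 'cV[R[i]]_n.+1) j n (kap : R) : unit_vec (v n) ->
  1 <= kap -> opbound (A n) kap%:C%C -> trbound (spec_weight A v j n) (kap ^+ j)%:C%C.
Proof.
move=> v1 kap1 Ak; have kap0 : 0 <= kap%:C%C by rewrite ler0c (le_trans ler01).
have vn : vnorm (v n) = 1.
  have := dot_conj (v n); rewrite (v1 : ((map_mx Num.conj (v n))^T *m v n) 0 0 = 1).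
  by move/esym/eqP; rewrite sqrp_eq1 ?vnorm_ge0// => /eqP.
have := trboundMr (exprn_ge0 j kap0) (opbound_pow j kap0 Ak)
  (trbound_dyad (map_mx Num.conj (v n)) (v n)).
by rewrite vnorm_conj vn !mul1r -rmorphXn.
Qed.

(* real_case = false : Hermitian A_N, B_N, complex unit vectors, Haar unitary U_N;
   real_case = true  : real symmetric A_N, B_N, real unit vectors, Haar orthogonal U_N.
   Matrices of size N are indexed by n with N = n.+1 (N >= 1). *)
Theorem theorem1p1 (R : realType) (real_case : bool)
    (A B : forall n : nat, 'M[R[i]]_n.+1) (v : forall n : nat, 'cV[R[i]]_n.+1)
    (mu1 nu1 mu2 : probability R R)
    (d : measure_display) (Omega : measurableType d) (P : probability Omega R)
    (U : forall n : nat, Omega -> 'M[R[i]]_n.+1) :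
  (forall n, is_hermitian (A n) /\ is_hermitian (B n)) ->
  (forall n, unit_vec (v n)) ->
  (real_case -> forall n, [/\ is_realmx (A n), is_realmx (B n) & is_realmx (v n)]) ->
  cvg_moment (fun n k => esd_moment (A n) k) mu1 ->
  cvg_moment (fun n k => spec_moment (A n) (v n) k) nu1 ->
  cvg_moment (fun n k => esd_moment (B n) k) mu2 ->
  (forall n, haar_distributed P real_case (U n)) ->
  (* rho = mu1 [+] mu2 and kappa = nu1 _{mu1}[+]_{mu2} mu2, defined through the
     (unique) analytic subordination functions w1, w2 *)
  forall (rho kappa : probability R R) (w1 w2 : R[i] -> R[i]),
  subordination mu1 mu2 w1 w2 ->
  (forall z, uhp z -> Ftr rho z = Ftr mu1 (w1 z)) ->
  (forall z, uhp z -> Ftr kappa z = Ftr nu1 (w1 z) + Ftr mu2 (w2 z) - Ftr rho z) ->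
  {ae P, forall w,
     cvg_moment (fun n k => esd_moment (A n + U n w *m B n *m cadj (U n w)) k) rho /\
     cvg_moment (fun n k => spec_moment (A n + U n w *m B n *m cadj (U n w)) (v n) k) kappa}.
Proof.
move=> hAB v1 _ cA cv cB haarU rho kappa w1 w2 sub12 Frho Fkappa.
have hA n : is_hermitian (A n) by case: (hAB n).
have hB n : is_hermitian (B n) by case: (hAB n).
(* One almost sure event serves all moments, as the exponents j, k, l range over a countable set. *)
have esd := ae_foralln (fun j => ae_foralln (fun k => ae_foralln (fun l =>
  ae_defect_cvg0 hA hB cA cB haarU (nseq k true ++ nseq l false)
    (@trbound_esd_weight R A j)))).
have spec := ae_foralln (fun j => ae_foralln (fun k =>
  ae_defect_cvg0 hA hB cA cB haarU (nseq k true)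
    (fun n kap => @trbound_spec_weight R A v j n kap (v1 n)))).
apply: filterS (filterI esd spec) => w [esd_w spec_w].
have uU n : Defs.is_unitary (U n w) by have [/(_ w) []] := haarU n.
exact: (moments_converge hA hB cA cv cB uU esd_w spec_w sub12 Frho Fkappa).
Qed.
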